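(* Let $\Omega\subset\mathbb C^m$ be a bounded domain and let $\{p_1,\dots,p_t\}$ and $\{q_1,\dots,q_t\}$ be two sets of generators of an ideal $\mathcal I\subseteq\mathbb C[z_1,\dots,z_m]$ consisting of homogeneous polynomials of the same degree. Let $\mathcal H,\mathcal H'\subseteq\mathcal O(\Omega)$ be two analytic Hilbert modules and let $\mathcal M,\mathcal M'$ be the closures of $\mathcal I$ in $\mathcal H,\mathcal H'$, respectively. Assume that $V(\mathcal M)=V(\mathcal M')=\{z\in\Omega:f(z)=0\ \forall f\in\mathcal I\}$ is a (complex) submanifold of $\Omega$ of codimension $t$. Let $F^p_{\mathcal M}$ be the canonical global frame of $E_{\mathcal M}$ associated with $\{p_1,\dots,p_t\}$ and let $F^q_{\mathcal M'}$ be the canonical global frame of $E_{\mathcal M'}$ associated with $\{q_1,\dots,q_t\}$. If $\mathcal M$ and $\mathcal M'$ are unitarily equivalent, then there exists a constant invertible $t\times t$ matrix $A$ such that $$\mathcal K_{E_{\mathcal M}}(F^p_{\mathcal M})=(A^* )^{-1}\cdot\mathcal K_{E_{\mathcal M'}}(F^q_{\mathcal M'})\cdot A^*,$$ where $\mathcal K_{E_{\mathcal M}}(F^p_{\mathcal M})$ and $\mathcal K_{E_{\mathcal M'}}(F^q_{\mathcal M'})$ are the curvature matrices of $E_{\mathcal M}$ and $E_{\mathcal M'}$ with respect to these frames.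
   Context: A domain is a connected open set; $\mathcal O(\Omega)$ is the ring of holomorphic functions on $\Omega$. An analytic Hilbert module over $\mathbb C[z_1,\dots,z_m]$ is a Hilbert space $\mathcal H\subseteq\mathcal O(\Omega)$ possessing a reproducing kernel (holomorphic in the first variable, anti-holomorphic in the second), such that pointwise multiplication by every polynomial is bounded on $\mathcal H$, and such that $\mathbb C[z_1,\dots,z_m]$ is contained and dense in $\mathcal H$. Two Hilbert modules $\mathcal M,\mathcal M'$ are unitarily equivalent if there is a unitary $L:\mathcal M\to\mathcal M'$ with $LM_p=M'_pL$ for all polynomials $p$, where $M_p,M'_p$ denote multiplication by $p$ on $\mathcal M,\mathcal M'$. Canonical frame. Let $\mathcal M$ be the closure of $\mathcal I=\langle p_1,\dots,p_t\rangle$ in an analytic Hilbert module, with reproducing kernel $K$, and suppose $V(\mathcal M)$ is a submanifold of codimension $t$. There are unique anti-holomorphic maps $F_1,\dots,F_t:V(\mathcal M)\to\mathcal M$ such that each $w\in V(\mathcal M)$ has a neighbourhood $\Omega_w\subseteq\Omega$ and anti-holomorphic maps $F^1_{\Omega_w},\dots,F^t_{\Omega_w}:\Omega_w\to\mathcal M$ with $F^j_{\Omega_w}=F_j$ on $V(\mathcal M)\cap\Omega_w$ and $K(\cdot,u)=\sum_{j=1}^t\overline{p_j(u)}F^j_{\Omega_w}(u)$ for $u\in\Omega_w$. For each $w\in V(\mathcal M)$ the vectors $F_1(w),\dots,F_t(w)$ are linearly independent and span $\bigcap_{i=1}^m\ker(M_{z_i}-w_i)^*\subseteq\mathcal M$.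 These maps form the canonical global frame associated with $\{p_1,\dots,p_t\}$. $E_{\mathcal M}$ is the rank $t$ anti-holomorphic vector bundle on $V(\mathcal M)$ whose fibre at $w$ is the joint kernel $\bigcap_{i=1}^m\ker(M_{z_i}-w_i)^*=\mathrm{span}\{F_1(w),\dots,F_t(w)\}$, with the hermitian structure induced by the inner product of $\mathcal M$. For an anti-holomorphic frame $F=(F_1,\dots,F_t)$ let $N(F)=(\langle F_j,F_i\rangle)_{i,j=1}^t$; the curvature matrix with respect to $F$ is $\mathcal K(F)=\partial\big(N(F)^{-1}\bar\partial N(F)\big)$, a matrix of forms on $V(\mathcal M)$. $A^*$ is the conjugate transpose of $A$. *)

(* Defs.v *)
From HB Require Import structures.
From mathcomp Require Import all_boot all_order all_algebra.
From mathcomp Require Import complex.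
From mathcomp Require Import all_classical all_reals all_analysis.
(* The notations of [mpoly] clash with those of the analysis library. *)
From mathcomp Require Import -(notations) mpoly.

Set Implicit Arguments.
Unset Strict Implicit.
Unset Printing Implicit Defensive.

Import Order.TTheory GRing.Theory Num.Theory.
Import numFieldNormedType.Exports.

Local Open Scope classical_set_scope.
Local Open Scope ring_scope.
Local Open Scope complex_scope.
Local Open Scope sesquilinear_scope.

(* Naming the [numClosedFieldType] lets [R[i]] inherit the topology and the
   normed module structure that the library puts on every [numFieldType]. *)
Definition CC (R : realType) : numClosedFieldType := R[i].

Definition cpoly (R : realType) (m : nat) := mpoly.mpoly m (CC R).

Section ComplexAnalysis.
Variable R : realType.
Local Notation C := (CC R).

Definition peval (m : nat) (p : cpoly R m) (z : 'rV[C]_m) : C :=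
  mpoly.meval (fun i => z ord0 i) p.

Definition homogeneous (m d : nat) (p : cpoly R m) : Prop :=
  p \is @mpoly.ishomog1 m (CC R) d (@mpoly.mdeg m).

Definition ideal_gen (m t : nat) (p : 'I_t -> cpoly R m) : set (cpoly R m) :=
  [set f | exists a : 'I_t -> cpoly R m, f = \sum_(j < t) a j * p j].

(* Since the scalar field is [C], [differentiable] is complex (Frechet)
   differentiability; the notion is used on open sets only. *)
Definition holomorphic_on (m : nat) (W : normedModType C)
    (U : set 'rV[C]_m) (f : 'rV[C]_m -> W) : Prop :=
  forall z, U z -> differentiable f z.

Definition conjv (m : nat) (z : 'rV[C]_m) : 'rV[C]_m := map_mx Num.conj z.

Definition antiholomorphic_on (m : nat) (W : normedModType C)
    (U : set 'rV[C]_m) (f : 'rV[C]_m -> W) : Prop :=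
  holomorphic_on (@conjv m @^-1` U) (f \o @conjv m).

(* Derivative of [f] at [z] in the real direction [v], taken separately on the
   real and the imaginary part. *)
Definition real_derive (d : nat) (f : 'rV[C]_d -> C) (v z : 'rV[C]_d) : C :=
  (derive1 (fun s : R => complex.Re (f (z + (s%:C : C) *: v))) 0 +i*
   derive1 (fun s : R => complex.Im (f (z + (s%:C : C) *: v))) 0)%C.

(* Wirtinger derivatives: with z_k = x_k + i y_k,
   dz k = (d/dx_k - i d/dy_k) / 2 and dzbar k = (d/dx_k + i d/dy_k) / 2. *)
Definition dz (d : nat) (k : 'I_d) (f : 'rV[C]_d -> C) (z : 'rV[C]_d) : C :=
  (real_derive f (delta_mx 0 k) z
     - 'i * real_derive f ('i *: delta_mx 0 k) z) / 2%:R.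

Definition dzbar (d : nat) (k : 'I_d) (f : 'rV[C]_d -> C) (z : 'rV[C]_d) : C :=
  (real_derive f (delta_mx 0 k) z
     + 'i * real_derive f ('i *: delta_mx 0 k) z) / 2%:R.

Definition mx_dz (d t : nat) (k : 'I_d) (A : 'rV[C]_d -> 'M[C]_t)
    (z : 'rV[C]_d) : 'M[C]_t :=
  \matrix_(i, j) dz k (fun x => A x i j) z.

Definition mx_dzbar (d t : nat) (k : 'I_d) (A : 'rV[C]_d -> 'M[C]_t)
    (z : 'rV[C]_d) : 'M[C]_t :=
  \matrix_(i, j) dzbar k (fun x => A x i j) z.

(* Locally V is the zero set of a holomorphic map to C^t whose differential
   has rank t. *)
Definition submanifold_codim (m t : nat) (Omega V : set 'rV[C]_m) : Prop :=
  V `<=` Omega /\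
  forall w, V w ->
    exists (U : set 'rV[C]_m) (g : 'rV[C]_m -> 'rV[C]_t),
      [/\ open U, U w & U `<=` Omega] /\
      [/\ holomorphic_on U g,
          V `&` U = [set z | U z /\ g z = 0] &
          forall z, V z -> U z -> \rank ('J g z) = t].

(* The inverse of a holomorphic coordinate chart of V: a holomorphic injective
   immersion of an open set of C^d that is a homeomorphism onto an open subset
   of V. *)
Record chart (m d : nat) (V : set 'rV[C]_m) := Chart {
  chart_dom : set 'rV[C]_d;
  chart_map : 'rV[C]_d -> 'rV[C]_m;
  chart_open : open chart_dom;
  chart_hol : holomorphic_on chart_dom chart_map;
  chart_inj : forall x y, chart_dom x -> chart_dom y ->
    chart_map x = chart_map y -> x = y;
  chart_immersion : forall x, chart_dom x -> injective ('d chart_map x);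
  chart_embedding : forall U, open U -> U `<=` chart_dom ->
    exists2 O, open O & chart_map @` U = V `&` O
}.

Definition antiholomorphic_on_submanifold (m d : nat) (W : normedModType C)
    (V : set 'rV[C]_m) (F : 'rV[C]_m -> W) : Prop :=
  forall c : chart d V,
    antiholomorphic_on (chart_dom c) (F \o chart_map c).

End ComplexAnalysis.

(* The elements of [ahm_space] are identified with holomorphic functions on
   Omega through the linear evaluation [ahm_fun], which is injective when
   restricted to Omega (values outside Omega are irrelevant). *)
Record analytic_hilbert_module (R : realType) (m : nat)
    (Omega : set 'rV[CC R]_m) := AnalyticHilbertModule {
  ahm_space :> completeNormedModType (CC R);
  ahm_dot : {dot ahm_space for @Num.conj (CC R)};
  ahm_normE : forall f, `|f| ^+ 2 = ahm_dot f f;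
  ahm_fun : ahm_space -> 'rV[CC R]_m -> CC R;
  ahm_fun_linear : forall a f g z, Omega z ->
    ahm_fun (a *: f + g) z = a * ahm_fun f z + ahm_fun g z;
  ahm_fun_inj : forall f g,
    (forall z, Omega z -> ahm_fun f z = ahm_fun g z) -> f = g;
  ahm_fun_hol : forall f, holomorphic_on Omega (ahm_fun f);
  (* [ahm_ker w] is the function K(., w). *)
  ahm_ker : 'rV[CC R]_m -> ahm_space;
  ahm_ker_reproducing : forall f w, Omega w ->
    ahm_fun f w = ahm_dot f (ahm_ker w);
  ahm_ker_hol : forall w, Omega w -> holomorphic_on Omega (ahm_fun (ahm_ker w));
  ahm_ker_antihol : forall z, Omega z ->
    antiholomorphic_on Omega (fun w => ahm_fun (ahm_ker w) z);
  ahm_mul : cpoly R m -> ahm_space -> ahm_space;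
  ahm_mulE : forall p f z, Omega z ->
    ahm_fun (ahm_mul p f) z = peval p z * ahm_fun f z;
  ahm_mul_bounded : forall p, exists c, forall f, `|ahm_mul p f| <= c * `|f|;
  ahm_poly : cpoly R m -> ahm_space;
  ahm_polyE : forall p z, Omega z -> ahm_fun (ahm_poly p) z = peval p z;
  ahm_poly_dense : dense (range ahm_poly)
}.

Section Modules.
Variables (R : realType) (m : nat) (Omega : set 'rV[CC R]_m).
Local Notation C := (CC R).
Local Notation module := (analytic_hilbert_module Omega).

Definition ideal_closure (H : module) (I : set (cpoly R m)) : set H :=
  closure (@ahm_poly _ _ _ H @` I).

Definition ideal_zeros (I : set (cpoly R m)) : set 'rV[C]_m :=
  [set z | Omega z /\ forall f, I f -> peval f z = 0].

Definition zero_set (H : module) (M : set H) : set 'rV[C]_m :=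
  [set z | Omega z /\ forall f, M f -> ahm_fun f z = 0].

(* [M] and [M'] carry the Hilbert space and module structures induced by [H]
   and [H']; only the values of [L] on [M] matter. *)
Definition unitarily_equivalent (H H' : module) (M : set H) (M' : set H')
    : Prop :=
  exists L : H -> H',
    [/\ forall a f g, M f -> M g -> L (a *: f + g) = a *: L f + L g,
        L @` M = M',
        forall f g, M f -> M g -> ahm_dot H' (L f) (L g) = ahm_dot H f g &
        forall p f, M f -> L (ahm_mul p f) = ahm_mul p (L f)].

Definition reproducing_kernel (H : module) (M : set H) (K : 'rV[C]_m -> H)
    : Prop :=
  forall w, Omega w ->
    M (K w) /\ forall f, M f -> ahm_fun f w = ahm_dot H f (K w).

(* [h] is the image of [f] under the adjoint of the operator [T] on [M]. *)
Definition adjoint_graph (H : module) (M : set H) (T : H -> H) (f h : H)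
    : Prop :=
  [/\ M f, M h & forall g, M g -> ahm_dot H (T g) f = ahm_dot H g h].

(* The fibre over [w] of the bundle E_M, i.e. the intersection of the kernels
   of the operators (M_{z_i} - w_i)^* on M. *)
Definition joint_kernel (H : module) (M : set H) (w : 'rV[C]_m) : set H :=
  [set f | M f /\ forall i : 'I_m,
     adjoint_graph M
       (fun g => ahm_mul (mpoly.mpolyX C (mpoly.mnm1 i)) g - w ord0 i *: g)
       f 0].

Definition basis_of_fibre (t : nat) (H : module) (M : set H)
    (w : 'rV[C]_m) (v : 'I_t -> H) : Prop :=
  (forall a : 'I_t -> C, \sum_(j < t) a j *: v j = 0 -> forall j, a j = 0) /\
  joint_kernel M w = [set f | exists a : 'I_t -> C, f = \sum_(j < t) a j *: v j].

(* When the zero set of [M] is a submanifold of codimension t, the last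
   condition alone determines the [F j] on it. *)
Record canonical_frame (t : nat) (H : module) (M : set H)
    (p : 'I_t -> cpoly R m) (F : 'I_t -> 'rV[C]_m -> H) : Prop :=
  CanonicalFrame {
  canonical_frame_in : forall j w, zero_set M w -> M (F j w);
  canonical_frame_antihol : forall j,
    antiholomorphic_on_submanifold (m - t) (zero_set M) (F j);
  canonical_frame_basis : forall w, zero_set M w ->
    basis_of_fibre M w (fun j => F j w);
  canonical_frame_local : exists2 K, reproducing_kernel M K &
    forall w, zero_set M w ->
    exists (U : set 'rV[C]_m) (G : 'I_t -> 'rV[C]_m -> H),
      [/\ open U, U w & U `<=` Omega] /\
      [/\ forall j, antiholomorphic_on U (G j),
          forall j u, U u -> M (G j u),
          forall j u, zero_set M u -> U u -> G j u = F j u &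
          forall u, U u -> K u = \sum_(j < t) (peval (p j) u)^* *: G j u]
}.

Definition gram (t : nat) (H : module) (F : 'I_t -> 'rV[C]_m -> H)
    (w : 'rV[C]_m) : 'M[C]_t :=
  \matrix_(i, j) ahm_dot H (F j w) (F i w).

(* Expression in the coordinates of the chart [c] of the matrix of (1,1)-forms
   del (N^-1 delbar N), with N the Gram matrix of the frame: as
   N^-1 delbar N = sum_l N^-1 (dN/dzbar_l) dzbar_l,
   [curvature F c k l] is the coefficient of dz_k /\ dzbar_l. *)
Definition curvature (t d : nat) (H : module) (V : set 'rV[C]_m)
    (F : 'I_t -> 'rV[C]_m -> H) (c : chart d V) (k l : 'I_d)
    : 'rV[C]_d -> 'M[C]_t :=
  let N := gram F \o chart_map c in
  mx_dz k (fun x => invmx (N x) *m mx_dzbar l N x).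

End Modules.

Arguments ideal_closure {R m Omega} H I.

(* Main.v *)
Require Import Defs.
From mathcomp Require Import all_boot all_order all_algebra.
From mathcomp Require Import complex.
From mathcomp Require Import all_classical all_reals all_analysis.
From mathcomp Require Import -(notations) mpoly.
From mathcomp Require Import ring lra.
Set Implicit Arguments.
Unset Strict Implicit.
Unset Printing Implicit Defensive.
Import Order.TTheory GRing.Theory Num.Theory.
Import numFieldNormedType.Exports.
Local Open Scope classical_set_scope.
Local Open Scope ring_scope.
Local Open Scope sesquilinear_scope.

(** Why the theorem holds. Comparing homogeneous parts of the common degree,
    [q = A p] with a constant matrix [A] ([homogeneous_generators]). Let [L] be
    the unitary equivalence and [h j := L (p j)]. Because [L] commutes with
    polynomials, [p i * h j = p j * h i]; because of the decomposition of the
    reproducing kernel by the frame of [q], near a common zero [w] each [h j] is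
    a combination [\sum_l b j l * p l] with coefficients continuous at [w] and
    [b j l w = \sum_k A k l <h j, Fq k w>]. The claim that carries the proof is
    that [b w] is a scalar matrix [phi w] ([frames_intertwined]); the same
    argument shows that [<p j, Fp l w>] is the identity matrix ([frame_dual]).
    The joint kernels are determined by pairings with the generators, so [L^-1]
    carries [\sum_k conj (A k l) Fq k] to [conj phi Fp l], whence
    [A^T N' conj A = |phi|^2 N] for the Gram matrices ([gram_relation]).
    Finally [conj phi] is a combination of the [<Fq k, L (p i0)>], hence
    anti-holomorphic along the zero set: [|phi|^2] adds to the connection matrix
    [N^-1 delbar N] only the scalar form [delbar log |phi|^2], which [del] kills,
    and the constant matrices come out ([curvature_relation]). The matrix of the theorem
    is [A^T].

    That [b w] is scalar is seen by approaching [w] through points where [p] is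
    proportional to a unit vector, or to a sum of two ([coefficients_scalar]).
    Such points exist arbitrarily close to [w] since the codimension of the zero
    set is the number [t] of generators ([direction_attained]): if [p] avoided a
    line, the [t - 1] equations of the line would have [w] as an isolated zero
    on a transversal slice of dimension [t], and fewer than [t] holomorphic
    functions of [t] variables have no isolated common zero
    ([no_isolated_zero]). The latter is proved by an elementary minimum argument
    based on Cauchy's estimates in one variable, which are derived here from
    Goursat's lemma for squares ([goursat], [centre_bound], [taylor_bound]);
    the same estimates show that derivatives of the frames are again
    differentiable ([holomorphic_derivative]), as the curvature requires. *)

(** * Moduli and derivatives along subsets of the plane *)

Section Modulus.
Variable R : realType.
Local Notation C := (CC R).

(** The norm of a complex normed module is itself a complex number; [nrm] is its
    value in the totally ordered field [R]. *)
Definition nrm (W : normedModType C) (w : W) : R := complex.Re `|w|.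

Lemma nrmE (W : normedModType C) (w : W) : `|w| = (nrm w)%:C%C :> C.
Proof. by rewrite /nrm RRe_real. Qed.

Lemma nrm_leM (W W' : normedModType C) (w : W) (w' : W') (k : R) :
  (`|w| <= k%:C%C * `|w'| :> C) = (nrm w <= k * nrm w').
Proof. by rewrite !nrmE -rmorphM lecR. Qed.

Lemma nrm_ge0 (W : normedModType C) (w : W) : 0 <= nrm w.
Proof. by have := normr_ge0 w; rewrite nrmE ler0c. Qed.

Lemma nrm_eq0 (W : normedModType C) (w : W) : (nrm w == 0) = (w == 0).
Proof. by rewrite -(normr_eq0 w) nrmE -(inj_eq (@complexI R)). Qed.

Lemma nrm0 (W : normedModType C) : nrm (0 : W) = 0.
Proof. by apply/eqP; rewrite nrm_eq0. Qed.

Lemma nrm_gt0 (W : normedModType C) (w : W) : (0 < nrm w) = (w != 0).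
Proof. by rewrite lt_def nrm_ge0 nrm_eq0 andbT. Qed.

Lemma nrmN (W : normedModType C) (w : W) : nrm (- w) = nrm w.
Proof. by rewrite /nrm normrN. Qed.

Lemma nrmB (W : normedModType C) (v w : W) : nrm (v - w) = nrm (w - v).
Proof. by rewrite /nrm distrC. Qed.

Lemma nrmD (W : normedModType C) (v w : W) : nrm (v + w) <= nrm v + nrm w.
Proof. by rewrite -lecR rmorphD /= -!nrmE ler_normD. Qed.

Lemma nrmDB (W : normedModType C) (v w : W) : nrm (v - w) <= nrm v + nrm w.
Proof. by rewrite -[nrm w]nrmN nrmD. Qed.

Lemma nrm_tri (W : normedModType C) (u v w : W) :
  nrm (u - w) <= nrm (u - v) + nrm (v - w).
Proof. by have := nrmD (u - v) (v - w); rewrite addrA subrK. Qed.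

Lemma nrmZ (W : normedModType C) (a : C) (w : W) :
  nrm (a *: w) = nrm a * nrm w.
Proof. by apply: complexI; rewrite rmorphM /= -!nrmE normrZ. Qed.

Lemma nrmM (a b : C) : nrm (a * b) = nrm a * nrm b.
Proof. by apply: complexI; rewrite rmorphM /= -!nrmE normrM. Qed.

Lemma nrmX (a : C) n : nrm (a ^+ n) = nrm a ^+ n.
Proof. by apply: complexI; rewrite rmorphXn /= -!nrmE normrX. Qed.

Lemma nrmV (a : C) : nrm a^-1 = (nrm a)^-1.
Proof. by apply: complexI; rewrite fmorphV /= -!nrmE normfV. Qed.

Lemma nrmJ (a : C) : nrm a^* = nrm a.
Proof. by rewrite /nrm norm_conjC. Qed.

Lemma nrm1 : nrm (1 : C) = 1.
Proof. by rewrite /nrm normr1. Qed.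

Lemma nrmi : nrm ('i : C) = 1.
Proof. by rewrite /nrm normCi. Qed.

Lemma nrmR (s : R) : nrm (s%:C%C : C) = `|s|.
Proof. by rewrite /nrm normc_def /= expr0n addr0 sqrtr_sqr. Qed.

Lemma nrm2 (a : C) : nrm a ^+ 2 = complex.Re a ^+ 2 + complex.Im a ^+ 2.
Proof. by rewrite /nrm normc_def /= sqr_sqrtr // addr_ge0 ?sqr_ge0. Qed.

Lemma normRe (a : C) : `|complex.Re a| <= nrm a.
Proof.
rewrite -(@ler_pXn2r _ 2) ?nnegrE ?nrm_ge0 // nrm2 real_normK ?num_real //.
by rewrite lerDl sqr_ge0.
Qed.

Lemma normIm (a : C) : `|complex.Im a| <= nrm a.
Proof.
rewrite -(@ler_pXn2r _ 2) ?nnegrE ?nrm_ge0 // nrm2 real_normK ?num_real //.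
by rewrite lerDr sqr_ge0.
Qed.

Lemma nrm_ReIm (a : C) : nrm a <= `|complex.Re a| + `|complex.Im a|.
Proof.
rewrite -(@ler_pXn2r _ 2) ?nnegrE ?nrm_ge0 ?addr_ge0 // nrm2.
rewrite -(real_normK (num_real (complex.Re a))).
rewrite -(real_normK (num_real (complex.Im a))).
have := normr_ge0 (complex.Re a); have := normr_ge0 (complex.Im a); nra.
Qed.

Lemma mulJ_nrm (a : C) : a * a^* = (nrm a ^+ 2)%:C%C.
Proof. by rewrite -normCK nrmE -rmorphXn. Qed.

Lemma nbhs_nrmP (W : normedModType C) (x : W) (A : set W) :
  nbhs x A <-> exists2 d : R, 0 < d & forall y, nrm (y - x) < d -> A y.
Proof.
split=> [/nbhs_normP[e /= e0 eA]|[d d0 dA]].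
  exists (complex.Re e).
    by rewrite -ltcR RRe_real ?gtr0_real.
  move=> y yx; apply: eA; rewrite /ball_ /= distrC nrmE.
  by rewrite -[e]RRe_real ?gtr0_real // ltcR.
apply/nbhs_normP; exists (d%:C%C : C); first by rewrite /= ltcR.
by move=> y; rewrite /ball_ /= distrC nrmE ltcR => /dA.
Qed.

Lemma open_nrm (W : normedModType C) (U : set W) (x : W) : open U -> U x ->
  exists2 d : R, 0 < d & forall y, nrm (y - x) < d -> U y.
Proof. by move=> oU Ux; apply/nbhs_nrmP; exact: open_nbhs_nbhs. Qed.

Lemma diff_eps (V W : normedModType C) (f : V -> W) x : differentiable f x ->
  forall e : R, 0 < e -> exists2 d : R, 0 < d & forall h, nrm h < d ->
    nrm (f (x + h) - f x - 'd f x h) <= e * nrm h.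
Proof.
move=> /diff_locally /eqaddoP fx e e0.
have e0' : 0 < (e%:C%C : C) by rewrite ltcR.
have /nbhs_nrmP[d d0 fd] := fx _ e0'.
exists d => // h hd.
have : nrm (f (h + x) - (f x + 'd f x h)) <= e * nrm h.
  by rewrite -nrm_leM; apply: fd; rewrite subr0.
by rewrite opprD addrA [h + x]addrC.
Qed.

(** Differentiability at [0] of a function of a complex variable restricted to
    [S]: with [S] the whole plane this is complex differentiability, with [S]
    the real axis it is differentiability along a real line. *)
Definition tangent (S : set C) (W : normedModType C) (f : C -> W) (l : W) :=
  forall e : R, 0 < e -> exists2 d : R, 0 < d &
    forall h, S h -> nrm h < d -> nrm (f h - f 0 - h *: l) <= e * nrm h.

Definition realline : set C := [set h | (complex.Re h)%:C%C = h].

Lemma realline0 : realline 0. Proof. by []. Qed.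

Lemma reallineR (s : R) : realline s%:C%C. Proof. by []. Qed.

Lemma reallineJ (h : C) : realline h -> h^* = h.
Proof. by move=> <-; exact: conjc_real. Qed.

Lemma is_derive_epsP (f : R -> R) (x l : R) :
  is_derive x 1 f l <->
  (forall e, 0 < e -> exists2 d, 0 < d &
    forall h, `|h| < d -> `|f (x + h) - f x - h * l| <= e * `|h|).
Proof.
split=> [[/derivable1_diffP dfx xl] e e0|fx].
  have /diff_locally /eqaddoP fx := dfx.
  have /nbhs_normP[d /= d0 fd] := fx _ e0.
  exists d => // h hd.
  have : `|f (h + x) - (f x + 'd f x h)| <= e * `|h|.
    by apply: fd; rewrite /ball_ /= sub0r normrN.
  rewrite opprD addrA [h + x]addrC.
  suff -> : 'd f x h = h * l by [].
  rewrite -xl deriveE //.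
  by rewrite -[h in LHS]mulr1 linearZ.
have cv : h^-1 *: ((f \o shift x) (h *: 1) - f x) @[h --> 0^'] --> l.
  apply/cvgrPdist_le => e e0; have [d d0 fd] := fx e e0.
  exists d => // h /=; rewrite sub0r normrN => hd h0.
  have -> : l - h^-1 *: (f (h *: 1 + x) - f x)
      = - (h^-1 * (f (x + h) - f x - h * l)).
    rewrite /GRing.scale /= mulr1 [h + x]addrC.
    by field.
  rewrite normrN normrM normfV mulrC ler_pdivrMr ?normr_gt0 //.
  exact: fd.
split; first by apply/cvg_ex; exists l.
exact/cvg_lim.
Qed.

Section TangentRules.
Variables (S : set C).
Hypothesis S0 : S 0.

Lemma tangent_near (W : normedModType C) (f g : C -> W) l :
  (exists2 d : R, 0 < d & forall h, S h -> nrm h < d -> f h = g h) ->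
  tangent S f l -> tangent S g l.
Proof.
move=> [d d0 fg] fl e e0; have [d' d'0 H] := fl e e0.
exists (Num.min d d'); first by rewrite lt_min d0.
move=> h Sh; rewrite lt_min => /andP[hd hd'].
rewrite -(fg h Sh hd) -(fg 0) ?nrm0 //; exact: H.
Qed.

Lemma tangent_ext (W : normedModType C) (f g : C -> W) l :
  f =1 g -> tangent S f l -> tangent S g l.
Proof. by move=> fg; apply: tangent_near; exists 1. Qed.

Lemma tangent_cst (W : normedModType C) (w : W) : tangent S (fun=> w) 0.
Proof.
move=> e e0; exists 1 => // h _ _.
by rewrite subrr scaler0 subr0 nrm0 mulr_ge0 ?nrm_ge0 ?ltW.
Qed.

Lemma tangent_scale (W : normedModType C) (w : W) : tangent S (fun h => h *: w) w.
Proof.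
move=> e e0; exists 1 => // h _ _.
by rewrite scale0r subr0 subrr nrm0 mulr_ge0 ?nrm_ge0 ?ltW.
Qed.

Lemma tangent_id : tangent S id (1 : C).
Proof.
by apply: tangent_ext (@tangent_scale _ (1 : C)) => h; rewrite /GRing.scale /= mulr1.
Qed.

Lemma tangentD (W : normedModType C) (f g : C -> W) l k :
  tangent S f l -> tangent S g k -> tangent S (fun h => f h + g h) (l + k).
Proof.
move=> fl gk e e0; have e2 : 0 < e / 2 by rewrite divr_gt0.
have [d d0 H] := fl _ e2; have [d' d'0 H'] := gk _ e2.
exists (Num.min d d'); first by rewrite lt_min d0.
move=> h Sh; rewrite lt_min => /andP[hd hd'].
have -> : f h + g h - (f 0 + g 0) - h *: (l + k)
    = (f h - f 0 - h *: l) + (g h - g 0 - h *: k).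
  by rewrite scalerDr !opprD [f h + g h + _]addrACA [LHS]addrACA.
apply: le_trans (nrmD _ _) _; rewrite [e]splitr mulrDl.
by rewrite lerD ?H ?H'.
Qed.

(** Any bounded map compatible with the scalars of [S] can be pushed through a
    derivative; for [S] the real line this includes antilinear maps. *)
Lemma tangent_linear (V W : normedModType C) (l : V -> W) (K : R)
    (f : C -> V) k :
  (forall x y, l (x - y) = l x - l y) ->
  (forall h x, S h -> l (h *: x) = h *: l x) ->
  (forall x, nrm (l x) <= K * nrm x) ->
  tangent S f k -> tangent S (fun h => l (f h)) (l k).
Proof.
move=> lB lZ lK fk e e0.
have K0 : 0 < `|K| + 1 by rewrite ltr_wpDl.
have [d d0 H] := fk (e / (`|K| + 1)) ltac:(by rewrite divr_gt0).
exists d => // h Sh hd; rewrite -lZ // -!lB.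
apply: le_trans (lK _) _; apply: (@le_trans _ _ ((`|K| + 1) * nrm (f h - f 0 - h *: k))).
  by apply: ler_wpM2r; rewrite ?nrm_ge0 // (le_trans (ler_norm _)) // lerDl.
by rewrite mulrC -ler_pdivlMr // mulrAC H.
Qed.

Lemma tangentZ (W : normedModType C) (c : C) (f : C -> W) l :
  tangent S f l -> tangent S (fun h => c *: f h) (c *: l).
Proof.
apply: (@tangent_linear _ _ (fun x => c *: x) (nrm c)) => [x y|h x _|x].
- by rewrite scalerBr.
- by rewrite !scalerA mulrC.
- by rewrite nrmZ.
Qed.

Lemma tangentB (W : normedModType C) (f g : C -> W) l k :
  tangent S f l -> tangent S g k -> tangent S (fun h => f h - g h) (l - k).
Proof.
move=> fl gk; apply: tangentD => //; rewrite -scaleN1r.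
by apply: tangent_ext (tangentZ (-1) gk) => h; rewrite scaleN1r.
Qed.

Lemma tangent_sum (W : normedModType C) (I : Type) (r : seq I)
    (f : I -> C -> W) (l : I -> W) :
  (forall i, tangent S (f i) (l i)) ->
  tangent S (fun h => \sum_(i <- r) f i h) (\sum_(i <- r) l i).
Proof.
move=> fl; elim: r => [|i r IH].
  by rewrite big_nil; apply: tangent_ext (tangent_cst 0) => h; rewrite big_nil.
rewrite big_cons; apply: tangent_ext (tangentD (fl i) IH) => h.
by rewrite big_cons.
Qed.

Lemma tangent_lip (W : normedModType C) (f : C -> W) l : tangent S f l ->
  exists2 d : R, 0 < d & forall h, S h -> nrm h < d ->
    nrm (f h - f 0) <= (nrm l + 1) * nrm h.
Proof.
move=> fl; have [d d0 H] := fl 1 ltr01.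
exists d => // h Sh hd; rewrite -[f h - f 0](subrK (h *: l)).
apply: le_trans (nrmD _ _) _; rewrite mulrDl addrC nrmZ mulrC.
by rewrite lerD2l H.
Qed.

Lemma tangent_cont (W : normedModType C) (f : C -> W) l : tangent S f l ->
  forall e : R, 0 < e -> exists2 d : R, 0 < d & forall h, S h -> nrm h < d ->
    nrm (f h - f 0) < e.
Proof.
move=> /tangent_lip[d d0 H] e e0.
have L0 : 0 < nrm l + 1 by rewrite ltr_wpDl ?nrm_ge0.
exists (Num.min d (e / (nrm l + 1))); first by rewrite lt_min d0 divr_gt0.
move=> h Sh; rewrite lt_min => /andP[hd he].
by apply: le_lt_trans (H h Sh hd) _; rewrite mulrC -ltr_pdivlMr.
Qed.

Lemma tangent_bilinear (U V W : normedModType C) (B : U -> V -> W)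
    (f : C -> U) (g : C -> V) l k :
  (forall x x' y, B (x - x') y = B x y - B x' y) ->
  (forall x y y', B x (y - y') = B x y - B x y') ->
  (forall h x y, S h -> B (h *: x) y = h *: B x y) ->
  (forall h x y, S h -> B x (h *: y) = h *: B x y) ->
  (forall x y, nrm (B x y) <= nrm x * nrm y) ->
  tangent S f l -> tangent S g k ->
  tangent S (fun h => B (f h) (g h)) (B l (g 0) + B (f 0) k).
Proof.
move=> Bl Br Zl Zr BB fl gk e e0.
(* [M] bounds whichever factor is not small in each of the three terms below. *)
pose M := nrm (f 0) + nrm (g 0) + nrm l + 1.
have M0 : 0 < M by rewrite /M ltr_wpDl // !addr_ge0 ?nrm_ge0.
have M30 : 0 < e / 3 / M by rewrite !divr_gt0.
have [d1 d10 H1] := fl _ M30.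
have [d2 d20 H2] := gk _ M30.
have [d3 d30 H3] := tangent_lip fl.
have [d4 d40 H4] := tangent_cont gk M30.
exists (Num.min (Num.min d1 d2) (Num.min d3 d4)); first by rewrite !lt_min d10 d20 d30.
move=> h Sh; rewrite !lt_min => /andP[/andP[h1 h2] /andP[h3 h4]].
have -> : B (f h) (g h) - B (f 0) (g 0) - h *: (B l (g 0) + B (f 0) k)
   = B (f h - f 0) (g h - g 0) + B (f h - f 0 - h *: l) (g 0)
     + B (f 0) (g h - g 0 - h *: k).
  have Bl' x x' y : B (x + x') y = B x y + B x' y.
    by rewrite -[in LHS](opprK x') Bl -[- x']sub0r Bl -{1}(subrr x') Bl subrr
               sub0r opprK.
  have Br' x y y' : B x (y + y') = B x y + B x y'.
    by rewrite -[in LHS](opprK y') Br -[- y']sub0r Br -{1}(subrr y') Br subrr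
               sub0r opprK.
  (* With increments as variables the identity is purely bilinear. *)
  rewrite -{1}(subrK (f 0) (f h)) -{1}(subrK (g 0) (g h)).
  move: (f h - f 0) (g h - g 0) => x y.
  rewrite (Bl x) Zl // (Br _ y) Zr // scalerDr !Bl' !Br' addrA addrK opprD.
  by rewrite !addrA; congr (_ + _); rewrite addrAC.
apply: le_trans (nrmD _ _) _; rewrite [e](_ : _ = e / 3 + e / 3 + e / 3); last first.
  by field.
rewrite !mulrDl; apply: lerD; last first.
  apply: le_trans (BB _ _) _; apply: (@le_trans _ _ (M * (e / 3 / M * nrm h))).
    apply: ler_pM; rewrite ?nrm_ge0 ?H2 //.
    by rewrite /M -!addrA lerDl !addr_ge0 ?nrm_ge0.
  by rewrite mulrA [M * _]mulrC divfK ?gt_eqF.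
apply: le_trans (nrmD _ _) _; apply: lerD; last first.
  apply: le_trans (BB _ _) _; apply: (@le_trans _ _ (e / 3 / M * nrm h * M)).
    apply: ler_pM; rewrite ?nrm_ge0 ?H1 //.
    by rewrite /M [_ + nrm (g 0)]addrC -!addrA lerDl !addr_ge0 ?nrm_ge0.
  by rewrite mulrAC divfK ?gt_eqF.
apply: le_trans (BB _ _) _; apply: (@le_trans _ _ (M * nrm h * (e / 3 / M))).
  apply: ler_pM; rewrite ?nrm_ge0 //; last exact/ltW/H4.
  apply: le_trans (H3 _ Sh h3) _; apply: ler_wpM2r; rewrite ?nrm_ge0 //.
  by rewrite /M -!addrA [leRHS]addrA lerDr addr_ge0 ?nrm_ge0.
rewrite [leLHS](_ : _ = e / 3 * nrm h) //.
by field; rewrite gt_eqF.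
Qed.

Lemma tangentM (f g : C -> C) l k : tangent S f l -> tangent S g k ->
  tangent S (fun h => f h * g h) (l * g 0 + f 0 * k).
Proof.
apply: (@tangent_bilinear _ _ _ (fun x y : C => x * y)) => [x x' y|x y y'|h x y _|h x y _|x y].
- by rewrite mulrBl.
- by rewrite mulrBr.
- by rewrite -scalerAl.
- by rewrite -scalerAr.
- by rewrite nrmM.
Qed.

Lemma tangentV (f : C -> C) l : f 0 != 0 -> tangent S f l ->
  tangent S (fun h => (f h)^-1) (- (l / f 0 ^+ 2)).
Proof.
move=> f0 fl e e0; set a := f 0; set n := nrm a.
have n0 : 0 < n by rewrite nrm_gt0.
have l0 : 0 < nrm l + 1 by rewrite ltr_wpDl ?nrm_ge0.
have e1 : 0 < e * n ^+ 2 / 4 by rewrite divr_gt0 ?mulr_gt0 ?exprn_gt0.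
have e2 : 0 < e * n ^+ 3 / 4 / (nrm l + 1).
  by rewrite !divr_gt0 ?mulr_gt0 ?exprn_gt0.
have n2 : 0 < n / 2 by rewrite divr_gt0.
have [d1 d10 H1] := fl _ e1.
have [d2 d20 H2] := tangent_cont fl e2.
have [d3 d30 H3] := tangent_cont fl n2.
exists (Num.min d1 (Num.min d2 d3)); first by rewrite !lt_min d10 d20.
move=> h Sh; rewrite !lt_min => /and3P[h1 h2 h3].
have {}H1 := H1 h Sh h1; have {}H2 := H2 h Sh h2; have {}H3 := H3 h Sh h3.
rewrite -/a in H1 H2 H3 *.
have xn : n / 2 < nrm (f h).
  have := nrm_tri a (f h) 0; rewrite !subr0 nrmB -/n; lra.
have x0 : f h != 0 by rewrite -nrm_gt0; apply: lt_trans xn.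
have -> : (f h)^-1 - a^-1 - h *: - (l / a ^+ 2)
    = (- (f h - a - h * l) * a + h * l * (f h - a)) / (f h * a ^+ 2).
  by rewrite /GRing.scale /=; field; rewrite x0 f0.
rewrite nrmM nrmV nrmM nrmX -/n ler_pdivrMr; last first.
  by rewrite mulr_gt0 ?exprn_gt0 // (lt_trans _ xn).
apply: le_trans (nrmD _ _) _; rewrite !nrmM nrmN -/n.
have h0 := nrm_ge0 h; have ll0 := nrm_ge0 l.
apply: (@le_trans _ _ (e * nrm h * (n / 2 * n ^+ 2))); last first.
  apply: ler_wpM2l; first by rewrite mulr_ge0 // ltW.
  by apply: ler_wpM2r; rewrite ?exprn_ge0 ?ltW.
have A1 : nrm (f h - a - h * l) * n <= e * n ^+ 2 / 4 * nrm h * n.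
  by apply: ler_wpM2r H1; exact: ltW.
have A2 : nrm h * nrm l * nrm (f h - a) <= nrm h * (e * n ^+ 3 / 4).
  rewrite -mulrA; apply: ler_wpM2l => //.
  apply: (@le_trans _ _ ((nrm l + 1) * (e * n ^+ 3 / 4 / (nrm l + 1)))).
    by apply: ler_pM; rewrite ?nrm_ge0 // ?lerDl // ltW.
  by rewrite mulrC divfK // gt_eqF.
apply: le_trans (lerD A1 A2) _.
by rewrite le_eqVlt; apply/orP; left; apply/eqP; field.
Qed.

Definition tangentiable (f : C -> C) := exists l, tangent S f l.

Lemma tangentiable_ext (f g : C -> C) : f =1 g ->
  tangentiable f -> tangentiable g.
Proof. by move=> fg [l fl]; exists l; exact: tangent_ext fl. Qed.

Lemma tangentiable_cst (c : C) : tangentiable (fun=> c).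
Proof. by exists 0; exact: tangent_cst. Qed.

Lemma tangentiableM (f g : C -> C) : tangentiable f -> tangentiable g ->
  tangentiable (fun h => f h * g h).
Proof. by move=> [l fl] [k gk]; eexists; exact: tangentM fl gk. Qed.

Lemma tangentiableV (f : C -> C) : f 0 != 0 -> tangentiable f ->
  tangentiable (fun h => (f h)^-1).
Proof. by move=> f0 [l fl]; eexists; exact: tangentV fl. Qed.

Lemma tangentiable_sum (I : Type) (r : seq I) (P : pred I) (f : I -> C -> C) :
  (forall i, tangentiable (f i)) ->
  tangentiable (fun h => \sum_(i <- r | P i) f i h).
Proof.
move=> fl; elim: r => [|i r [l IH]].
  by apply: tangentiable_ext (tangentiable_cst 0) => h; rewrite big_nil.
case Pi : (P i); last first.
  by exists l; apply: tangent_ext IH => h; rewrite big_cons Pi.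
have [k ik] := fl i; exists (k + l).
by apply: tangent_ext (tangentD ik IH) => h; rewrite big_cons Pi.
Qed.

Lemma tangentiable_prod (I : Type) (r : seq I) (f : I -> C -> C) :
  (forall i, tangentiable (f i)) ->
  tangentiable (fun h => \prod_(i <- r) f i h).
Proof.
move=> fl; elim: r => [|i r IH].
  by apply: tangentiable_ext (tangentiable_cst 1) => h; rewrite big_nil.
by apply: tangentiable_ext (tangentiableM (fl i) IH) => h; rewrite big_cons.
Qed.

Lemma tangentiableX (f : C -> C) n : tangentiable f ->
  tangentiable (fun h => f h ^+ n).
Proof.
move=> fl; elim: n => [|n IH].
  by apply: tangentiable_ext (tangentiable_cst 1) => h; rewrite expr0.
by apply: tangentiable_ext (tangentiableM fl IH) => h; rewrite exprS.
Qed.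

End TangentRules.

Lemma tangent_reparam (S S' : set C) (W : normedModType C) (f : C -> W) l c :
  (forall h, S' h -> S (c * h)) -> tangent S f l ->
  tangent S' (fun h => f (c * h)) (c *: l).
Proof.
move=> SS' fl e e0; have c0 : 0 < nrm c + 1 by rewrite ltr_wpDl ?nrm_ge0.
have [d d0 H] := fl _ (divr_gt0 e0 c0).
exists (d / (nrm c + 1)); first by rewrite divr_gt0.
move=> h Sh; rewrite ltr_pdivlMr // => hd.
have hc : nrm (c * h) <= (nrm c + 1) * nrm h.
  by rewrite nrmM ler_wpM2r ?nrm_ge0 // lerDl.
rewrite mulr0 scalerA [h * c]mulrC.
apply: le_trans (H _ (SS' _ Sh) _) _.
  by apply: le_lt_trans hc _; rewrite mulrC.
by rewrite mulrAC ler_pdivrMr // -mulrA ler_pM2l // [leRHS]mulrC.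
Qed.

Lemma tangent_sub (S S' : set C) (W : normedModType C) (f : C -> W) l :
  S' `<=` S -> tangent S f l -> tangent S' f l.
Proof.
move=> SS' fl e e0; have [d d0 H] := fl e e0.
by exists d => // h /SS'; exact: H.
Qed.

Lemma diff_tangent (V W : normedModType C) (f : V -> W) x v :
  differentiable f x -> tangent setT (fun h => f (x + h *: v)) ('d f x v).
Proof.
move=> fx e e0; have v0 : 0 < nrm v + 1 by rewrite ltr_wpDl ?nrm_ge0.
have [d d0 H] := diff_eps fx (divr_gt0 e0 v0).
exists (d / (nrm v + 1)); first by rewrite divr_gt0.
move=> h _; rewrite ltr_pdivlMr // => hd; rewrite scale0r addr0 -linearZ.
have hv : nrm (h *: v) <= nrm h * (nrm v + 1).
  by rewrite nrmZ ler_wpM2l ?nrm_ge0 // lerDl.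
apply: le_trans (H _ (le_lt_trans hv hd)) _.
by rewrite -mulrA ler_pM2l // mulrC ler_pdivrMr.
Qed.

(** * Mean value inequality and primitives *)

Section MeanValue.
Variables (G Gd : R -> C) (a b : R).
Hypothesis ab : a <= b.
Hypothesis GGd : forall x, a <= x <= b ->
  tangent realline (fun h => G (x + complex.Re h)) (Gd x).

(** A complex-valued function has no intermediate values, but the real mean value
    theorem applies to all the functions [Re (u * G)]. *)
Lemma mean_value_Re (u : C) (m : R) :
  (forall x, a <= x <= b -> complex.Re (u * Gd x) <= m) ->
  complex.Re (u * (G b - G a)) <= m * (b - a).
Proof.
move=> um.
have dG x : x \in `[a, b] -> is_derive x (1 : R) (fun t => complex.Re (u * G t))
    (complex.Re (u * Gd x)).
  rewrite in_itv /= => xab; apply/is_derive_epsP => e e0.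
  have u0 : 0 < nrm u + 1 by rewrite ltr_wpDl ?nrm_ge0.
  have [d d0 H] := GGd xab (divr_gt0 e0 u0).
  exists d => // h hd.
  have := H h%:C%C (reallineR h); rewrite nrmR => /(_ hd) /=; rewrite addr0.
  set X := (X in nrm X) => HX.
  have -> : complex.Re (u * G (x + h)) - complex.Re (u * G x)
      - h * complex.Re (u * Gd x) = complex.Re (u * X).
    rewrite /X; case: (u) (G (x + h)) (G x) (Gd x) => [u1 u2] [b1 b2] [c1 c2] [d1 d2] /=.
    by rewrite /GRing.scale /=; ring.
  apply: le_trans (normRe _) _; rewrite nrmM.
  apply: (@le_trans _ _ ((nrm u + 1) * (e / (nrm u + 1) * `|h|))).
    by apply: ler_pM; rewrite ?nrm_ge0 // lerDl.
  by rewrite mulrA [_ * (e / _)]mulrC divfK // gt_eqF.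
pose phi (t : R) : R := complex.Re (u * G t).
pose dphi (t : R) : R := complex.Re (u * Gd t).
have dG' x : x \in `]a, b[ -> is_derive x (1 : R) phi (dphi x).
  by move=> /subset_itv_oo_cc; exact: dG.
have cphi : {within `[a, b], continuous phi}.
  by apply: derivable_within_continuous => x /dG[].
have [c cab] := MVT_segment ab dG' cphi; rewrite /phi /dphi.
have -> : complex.Re (u * (G b - G a)) = complex.Re (u * G b) - complex.Re (u * G a).
  by rewrite mulrBr; case: (u * G b) (u * G a) => [? ?] [? ?].
move=> ->; apply: ler_wpM2r; first by rewrite subr_ge0.
by apply: um; move: cab; rewrite in_itv.
Qed.

(** The case where [u] is the conjugate of the increment to be estimated. *)
Lemma mean_value_nrm (M : R) :
  (forall x, a <= x <= b -> nrm (Gd x) <= M) ->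
  nrm (G b - G a) <= M * (b - a).
Proof.
move=> GM; set D := G b - G a.
have M0 : 0 <= M by apply: le_trans (nrm_ge0 _) (GM a _); rewrite lexx.
have : complex.Re (D^* * D) <= nrm D * M * (b - a).
  apply: mean_value_Re => x xab.
  apply: le_trans (ler_norm _) _; apply: le_trans (normRe _) _.
  by rewrite nrmM nrmJ ler_wpM2l ?nrm_ge0 ?GM.
rewrite mulrC mulJ_nrm /= expr2 -mulrA.
have := nrm_ge0 D; rewrite le_eqVlt => /predU1P[<- _|D0].
  by rewrite mulr_ge0 // subr_ge0.
by rewrite ler_pM2l.
Qed.

End MeanValue.

(** A primitive of the complex function [g] of a real variable. *)
Definition prim (a0 : R) (g : R -> C) (x : R) : C :=
  ((\int[lebesgue_measure]_(t in `[a0, x]) complex.Re (g t)) +i*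
   (\int[lebesgue_measure]_(t in `[a0, x]) complex.Im (g t)))%C.

Lemma FTC_eps (a0 : R) (g : R -> R) x : continuous g -> a0 < x ->
  forall e, 0 < e -> exists2 d, 0 < d & forall h, `|h| < d ->
  `|(\int[lebesgue_measure]_(t in `[a0, (x + h)%R]) g t) -
    (\int[lebesgue_measure]_(t in `[a0, x]) g t) - h * g x| <= e * `|h|.
Proof.
move=> cg a0x; apply/(is_derive_epsP (fun x => \int[lebesgue_measure]_(t in `[a0, x]) g t)).
have x1 : x < x + 1 by rewrite ltrDl.
have ig : lebesgue_measure.-integrable `[a0, x + 1] (EFin \o g).
  apply: continuous_compact_integrable; first exact: segment_compact.
  exact: continuous_subspaceT.
have [dF Fg] := continuous_FTC1_closed x1 ig a0x (cg x).
by split; [exact: dF|rewrite -derive1E; exact: Fg].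
Qed.

Lemma prim_tangent (a0 : R) (g : R -> C) x :
  (forall y e, 0 < e -> exists2 d : R, 0 < d &
     forall z, `|z - y| < d -> nrm (g z - g y) < e) -> a0 < x ->
  tangent realline (fun h => prim a0 g (x + complex.Re h)) (g x).
Proof.
move=> cg a0x e e0; have e2 : 0 < e / 2 by rewrite divr_gt0.
have cRe : continuous (fun t => complex.Re (g t)).
  move=> y; apply/cvgrPdist_lt => r r0; have [d d0 H] := cg y r r0.
  apply/nbhs_normP; exists d => // z /=; rewrite distrC => /H.
  by apply: le_lt_trans; rewrite distrC -raddfB normRe.
have cIm : continuous (fun t => complex.Im (g t)).
  move=> y; apply/cvgrPdist_lt => r r0; have [d d0 H] := cg y r r0.
  apply/nbhs_normP; exists d => // z /=; rewrite distrC => /H.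
  by apply: le_lt_trans; rewrite distrC -raddfB normIm.
have [d1 d10 H1] := FTC_eps cRe a0x e2; have [d2 d20 H2] := FTC_eps cIm a0x e2.
exists (Num.min d1 d2); first by rewrite lt_min d10.
move=> h <-; rewrite nrmR lt_min => /andP[h1 h2] /=.
apply: le_trans (nrm_ReIm _) _; rewrite [e]splitr mulrDl.
have {H1 H2} := (H1 _ h1, H2 _ h2).
rewrite /prim addr0 /=; case: (g x) => gr gi [] /=.
by rewrite !mul0r subr0 addr0 => H1 H2; exact: lerD.
Qed.

End Modulus.

(** * Goursat's lemma for squares *)

Section Cauchy.
Variable R : realType.
Local Notation C := (CC R).
Implicit Types (x y r s : R).

Definition pt x y : C := (x +i* y)%C.

Lemma ptE x y : pt x y = x%:C%C + 'i * y%:C%C.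
Proof. exact: complexE. Qed.

Lemma ptB x y x' y' : pt x y - pt x' y' = pt (x - x') (y - y').
Proof. by []. Qed.

Lemma nrm_pt x y : nrm (pt x y) <= `|x| + `|y|.
Proof. exact: nrm_ReIm. Qed.

Definition ccont (g : R -> C) := forall y (e : R), 0 < e ->
  exists2 d : R, 0 < d & forall z, `|z - y| < d -> nrm (g z - g y) < e.

Variable a0 : R.

(** The integral from [x0] to [x1] is taken as a difference of primitives based at
    [a0], which makes additivity an identity of rings. *)
Definition seg (g : R -> C) x0 x1 := prim a0 g x1 - prim a0 g x0.

Lemma seg_cat g x0 x1 x2 : seg g x0 x2 = seg g x0 x1 + seg g x1 x2.
Proof. rewrite /seg; ring. Qed.

Lemma tangent_real (x : R) :
  tangent (@realline R) (fun h : C => ((x + complex.Re h)%:C%C : C)) (1 : C).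
Proof.
have H : tangent (@realline R) (fun h : C => (x%:C%C : C) + h) (0 + 1).
  by apply: tangentD; [exact: tangent_cst|exact: tangent_id].
rewrite add0r in H; apply: tangent_near H; first exact: realline0.
by exists 1 => // h Sh _; rewrite rmorphD /= Sh.
Qed.

(** An affine function has an explicit primitive, which the mean value inequality
    compares with that of [g]. *)
Lemma seg_affine g x0 x1 (a b : C) (e : R) : ccont g -> a0 < x0 -> x0 <= x1 ->
  (forall x, x0 <= x <= x1 -> nrm (g x - (a + x%:C%C * b)) <= e) ->
  nrm (seg g x0 x1 - (a * (x1%:C%C - x0%:C%C)
     + b * (x1%:C%C ^+ 2 - x0%:C%C ^+ 2) / 2)) <= e * (x1 - x0).
Proof.
move=> cg ax x01 ge.
pose G x : C := prim a0 g x - (a * x%:C%C + b * x%:C%C ^+ 2 / 2).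
have -> : seg g x0 x1 - (a * (x1%:C%C - x0%:C%C)
     + b * (x1%:C%C ^+ 2 - x0%:C%C ^+ 2) / 2) = G x1 - G x0.
  by rewrite /G /seg; field.
apply: (mean_value_nrm x01 (Gd := fun x => g x - (a + x%:C%C * b))) => //.
move=> x /andP[x0x xx1]; rewrite /G.
apply: tangentB; first exact: realline0.
  by apply: prim_tangent => //; apply: lt_le_trans x0x.
apply: tangentD.
  apply: (@tangent_ext _ _ (@realline0 R) _ (fun h : C => a *: ((x + complex.Re h)%:C%C : C))) => //.
  rewrite -[X in tangent _ _ X]mulr1.
  by apply: tangentZ; exact: tangent_real.
have := tangentM (tangent_real x) (tangent_real x).
rewrite /= addr0 => /(tangentZ (b / 2)).
have -> : (b / 2) *: (1 * x%:C%C + x%:C%C * 1) = x%:C%C * b :> C.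
  by rewrite /GRing.scale /=; field.
apply: tangent_ext; first exact: realline0.
by move=> h; rewrite /GRing.scale /=; field.
Qed.

Lemma seg_lin g g' g'' (c : C) x0 x1 :
  ccont g -> ccont g' -> ccont g'' -> a0 < x0 -> x0 <= x1 ->
  (forall x, x0 <= x <= x1 -> g'' x = g x + c * g' x) ->
  seg g'' x0 x1 = seg g x0 x1 + c * seg g' x0 x1.
Proof.
move=> cg cg' cg'' ax x01 gE.
pose G x : C := prim a0 g'' x - (prim a0 g x + c * prim a0 g' x).
apply/eqP; rewrite -subr_eq0.
have -> : seg g'' x0 x1 - (seg g x0 x1 + c * seg g' x0 x1) = G x1 - G x0.
  by rewrite /G /seg; ring.
rewrite -nrm_eq0 eq_le nrm_ge0 andbT -[leRHS](mul0r (x1 - x0)).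
apply: (mean_value_nrm x01 (Gd := fun x => g'' x - (g x + c *: g' x))).
  move=> x /andP[x0x xx1].
  have ax' : a0 < x by apply: lt_le_trans x0x.
  apply: tangentB; first exact: realline0.
    exact: prim_tangent.
  apply: tangentD; first exact: prim_tangent.
  by apply: tangentZ; exact: prim_tangent.
by move=> x xx; rewrite gE // subrr nrm0.
Qed.

Lemma seg_eq g g' x0 x1 : ccont g -> ccont g' -> a0 < x0 -> x0 <= x1 ->
  (forall x, x0 <= x <= x1 -> g' x = g x) -> seg g' x0 x1 = seg g x0 x1.
Proof.
move=> cg cg' ax x01 gE; rewrite (@seg_lin g g g' 0) ?mul0r ?addr0 // => x xx.
by rewrite gE // mul0r addr0.
Qed.

(** The integral of [g x y (dx + i dy)] along the boundary of a rectangle. *)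
Definition rint (g : R -> R -> C) x0 x1 y0 y1 : C :=
  seg (g^~ y0) x0 x1 + 'i * seg (g x1) y0 y1
  - seg (g^~ y1) x0 x1 - 'i * seg (g x0) y0 y1.

Lemma rint_catx g x0 x1 x2 y0 y1 :
  rint g x0 x2 y0 y1 = rint g x0 x1 y0 y1 + rint g x1 x2 y0 y1.
Proof.
rewrite /rint (seg_cat (g^~ y0) x0 x1) (seg_cat (g^~ y1) x0 x1); ring.
Qed.

Lemma rint_caty g x0 x1 y0 y1 y2 :
  rint g x0 x1 y0 y2 = rint g x0 x1 y0 y1 + rint g x0 x1 y1 y2.
Proof. by rewrite /rint (seg_cat (g x0) y0 y1) (seg_cat (g x1) y0 y1); ring. Qed.

Definition sides_cont (g : R -> R -> C) x0 x1 y0 y1 :=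
  [/\ ccont (g^~ y0), ccont (g^~ y1), ccont (g x0) & ccont (g x1)].

(** Around the boundary the primitive of the affine part returns to its initial
    value; what remains is the error times the perimeter. *)
Lemma rint_affine g x0 x1 y0 y1 (a b : C) (e : R) :
  sides_cont g x0 x1 y0 y1 -> a0 < x0 -> x0 <= x1 -> a0 < y0 -> y0 <= y1 ->
  (forall x y, x0 <= x <= x1 -> y0 <= y <= y1 ->
     [|| x == x0, x == x1, y == y0 | y == y1] ->
     nrm (g x y - (a + pt x y * b)) <= e) ->
  nrm (rint g x0 x1 y0 y1) <= 2 * e * ((x1 - x0) + (y1 - y0)).
Proof.
move=> [c1 c2 c3 c4] ax x01 ay y01 ge.
have xx0 : x0 <= x0 <= x1 by rewrite lexx.
have xx1 : x0 <= x1 <= x1 by rewrite lexx x01.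
have yy0 : y0 <= y0 <= y1 by rewrite lexx.
have yy1 : y0 <= y1 <= y1 by rewrite lexx y01.
pose aff (c d : C) (s0 s1 : R) : C := c * (s1%:C%C - s0%:C%C)
  + d * (s1%:C%C ^+ 2 - s0%:C%C ^+ 2) / 2.
pose S1 := seg (g^~ y0) x0 x1 - aff (a + 'i * y0%:C%C * b) b x0 x1.
pose S2 := seg (g^~ y1) x0 x1 - aff (a + 'i * y1%:C%C * b) b x0 x1.
pose S3 := seg (g x0) y0 y1 - aff (a + x0%:C%C * b) ('i * b) y0 y1.
pose S4 := seg (g x1) y0 y1 - aff (a + x1%:C%C * b) ('i * b) y0 y1.
have -> : rint g x0 x1 y0 y1 = S1 + 'i * S4 - S2 - 'i * S3.
  by rewrite /rint /S1 /S2 /S3 /S4 /aff; field.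
have H1 : nrm S1 <= e * (x1 - x0).
  apply: seg_affine => // x xx.
  have -> : a + 'i * y0%:C%C * b + x%:C%C * b = a + pt x y0 * b.
    by rewrite ptE; ring.
  by rewrite ge // eqxx !orbT.
have H2 : nrm S2 <= e * (x1 - x0).
  apply: seg_affine => // x xx.
  have -> : a + 'i * y1%:C%C * b + x%:C%C * b = a + pt x y1 * b.
    by rewrite ptE; ring.
  by rewrite ge // eqxx !orbT.
have H3 : nrm S3 <= e * (y1 - y0).
  apply: seg_affine => // y yy.
  have -> : a + x0%:C%C * b + y%:C%C * ('i * b) = a + pt x0 y * b.
    by rewrite ptE; ring.
  by rewrite ge // eqxx .
have H4 : nrm S4 <= e * (y1 - y0).
  apply: seg_affine => // y yy.
  have -> : a + x1%:C%C * b + y%:C%C * ('i * b) = a + pt x1 y * b.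
    by rewrite ptE; ring.
  by rewrite ge // eqxx orbT.
apply: le_trans (nrmDB _ _) _; rewrite nrmM nrmi mul1r.
have := nrmDB (S1 + 'i * S4) S2; have := nrmD S1 ('i * S4).
rewrite nrmM nrmi mul1r; lra.
Qed.

Lemma rint_bound g x0 x1 y0 y1 (e : R) :
  sides_cont g x0 x1 y0 y1 -> a0 < x0 -> x0 <= x1 -> a0 < y0 -> y0 <= y1 ->
  (forall x y, x0 <= x <= x1 -> y0 <= y <= y1 ->
     [|| x == x0, x == x1, y == y0 | y == y1] -> nrm (g x y) <= e) ->
  nrm (rint g x0 x1 y0 y1) <= 2 * e * ((x1 - x0) + (y1 - y0)).
Proof.
move=> sg ax x01 ay y01 ge; apply: (@rint_affine _ _ _ _ _ 0 0) => // x y *.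
by rewrite mulr0 addr0 subr0 ge.
Qed.

Lemma rint_lin g g' g'' (c : C) x0 x1 y0 y1 :
  sides_cont g x0 x1 y0 y1 -> sides_cont g' x0 x1 y0 y1 ->
  sides_cont g'' x0 x1 y0 y1 -> a0 < x0 -> x0 <= x1 -> a0 < y0 -> y0 <= y1 ->
  (forall x y, g'' x y = g x y + c * g' x y) ->
  rint g'' x0 x1 y0 y1 = rint g x0 x1 y0 y1 + c * rint g' x0 x1 y0 y1.
Proof.
move=> [c1 c2 c3 c4] [d1 d2 d3 d4] [e1 e2 e3 e4] ax x01 ay y01 gE.
rewrite /rint (seg_lin c1 d1 e1 ax x01 (fun x _ => gE x y0)).
rewrite (seg_lin c2 d2 e2 ax x01 (fun x _ => gE x y1)).
rewrite (seg_lin c3 d3 e3 ay y01 (fun y _ => gE x0 y)).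
rewrite (seg_lin c4 d4 e4 ay y01 (fun y _ => gE x1 y)).
move: (seg (g^~ y0) _ _) (seg (g^~ y1) _ _) (seg (g x0) _ _) (seg (g x1) _ _).
move: (seg (g'^~ y0) _ _) (seg (g'^~ y1) _ _) (seg (g' x0) _ _) (seg (g' x1) _ _).
by move=> s1 s2 s3 s4 s5 s6 s7 s8; ring.
Qed.

Definition sqint g x y t := rint g x (x + t) y (y + t).

Lemma large_summand (a b c d : C) :
  [\/ nrm (a + b + (c + d)) <= 4 * nrm a, nrm (a + b + (c + d)) <= 4 * nrm b,
      nrm (a + b + (c + d)) <= 4 * nrm c | nrm (a + b + (c + d)) <= 4 * nrm d].
Proof.
have := nrmD (a + b) (c + d); have := nrmD a b; have := nrmD c d.
move: (nrm (a + b + (c + d))) (nrm (a + b)) (nrm (c + d)) => N ab cd.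
move: (nrm a) (nrm b) (nrm c) (nrm d) => na nb nc nd h1 h2 h3.
case: (leP N (4 * na)) => ha; first by constructor 1.
case: (leP N (4 * nb)) => hb; first by constructor 2.
case: (leP N (4 * nc)) => hc; first by constructor 3.
by constructor 4; lra.
Qed.

(** The integrals over the four quarters of a square add up to that over the
    square. *)
Lemma bisect g x y t : 0 < t -> exists x' y',
  [/\ x <= x' /\ x' + t / 2 <= x + t, y <= y' /\ y' + t / 2 <= y + t &
      nrm (sqint g x y t) <= 4 * nrm (sqint g x' y' (t / 2))].
Proof.
move=> t0.
have E : sqint g x y t = sqint g x y (t / 2) + sqint g (x + t / 2) y (t / 2)
    + (sqint g x (y + t / 2) (t / 2) + sqint g (x + t / 2) (y + t / 2) (t / 2)).
  rewrite /sqint -[x + t / 2 + t / 2]addrA -[y + t / 2 + t / 2]addrA -splitr.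
  rewrite (rint_caty g x (x + t) y (y + t / 2) (y + t)).
  rewrite (rint_catx g x (x + t / 2) (x + t) y (y + t / 2)).
  by rewrite (rint_catx g x (x + t / 2) (x + t) (y + t / 2) (y + t)).
have lo z : z <= z /\ z + t / 2 <= z + t by split; lra.
have hi z : z <= z + t / 2 /\ z + t / 2 + t / 2 <= z + t by split; lra.
rewrite E; move: (lo x) (hi x) (lo y) (hi y) => lox hix loy hiy.
have [H|H|H|H] := large_summand (sqint g x y (t / 2)) (sqint g (x + t / 2) y (t / 2))
  (sqint g x (y + t / 2) (t / 2)) (sqint g (x + t / 2) (y + t / 2) (t / 2)).
- by exists x, y; split; [exact: lox|exact: loy|exact: H].
- by exists (x + t / 2), y; split; [exact: hix|exact: loy|exact: H].
- by exists x, (y + t / 2); split; [exact: lox|exact: hiy|exact: H].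
- by exists (x + t / 2), (y + t / 2); split; [exact: hix|exact: hiy|exact: H].
Qed.

Lemma nested_intervals (x t : nat -> R) : (forall n, 0 <= t n) ->
  (forall n, x n <= x n.+1 /\ x n.+1 + t n.+1 <= x n + t n) ->
  exists X, forall n, [/\ x 0 <= x n, x n <= X, X <= x n + t n & x n + t n <= x 0 + t 0].
Proof.
move=> t0 xS.
have mono n k : x n <= x (n + k)%N /\ x (n + k)%N + t (n + k)%N <= x n + t n.
  elim: k => [|k [h1 h2]]; first by rewrite addn0.
  have [k1 k2] := xS (n + k)%N; rewrite addnS.
  by split; [exact: le_trans h1 k1|exact: le_trans k2 h2].
have cmp m n : x m <= x n + t n.
  case: (leqP m n) => [/subnKC|/ltnW /subnKC] <-.
    by have [h1 _] := mono m (n - m)%N; rewrite (le_trans h1) // lerDl.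
  have [_] := mono n (m - n)%N; apply: le_trans; by rewrite lerDl.
exists (sup (range x)) => n; have [h1 h2] := mono 0 n; split => //.
- by apply: ub_le_sup; [exists (x 0 + t 0) => _ [m _ <-]; exact: cmp|exists n].
- by apply: ge_sup => [|_ [m _ <-]]; [exists (x 0), 0|exact: cmp].
Qed.

Lemma nested_squares g u v s : 0 < s -> exists (x y : nat -> R) (X Y : R), forall n,
  [/\ [/\ u <= x n, x n <= X, X <= x n + s / 2 ^+ n & x n + s / 2 ^+ n <= u + s],
      [/\ v <= y n, y n <= Y, Y <= y n + s / 2 ^+ n & y n + s / 2 ^+ n <= v + s] &
      nrm (sqint g u v s) <= 4 ^+ n * nrm (sqint g (x n) (y n) (s / 2 ^+ n))].
Proof.
move=> s0; pose t n := s / 2 ^+ n.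
have t0 n : 0 < t n by rewrite divr_gt0 ?exprn_gt0.
have tS n : t n.+1 = t n / 2 by rewrite /t exprSr invfM mulrA.
have ex (p : nat * (R * R)) : exists p' : R * R,
    [/\ p.2.1 <= p'.1 /\ p'.1 + t p.1.+1 <= p.2.1 + t p.1,
        p.2.2 <= p'.2 /\ p'.2 + t p.1.+1 <= p.2.2 + t p.1 &
        nrm (sqint g p.2.1 p.2.2 (t p.1)) <= 4 * nrm (sqint g p'.1 p'.2 (t p.1.+1))].
  have [x' [y' H]] := bisect g p.2.1 p.2.2 (t0 p.1).
  by exists (x', y'); rewrite tS.
have [nx nxP] := choice ex.
pose f := nat_rect (fun=> (R * R)%type) (u, v) (fun n p => nx (n, p)).
have fS n := nxP (n, f n).
have [|X XP] := @nested_intervals (fun n => (f n).1) t (fun n => ltW (t0 n)).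
  by move=> n; have [] := fS n.
have [|Y YP] := @nested_intervals (fun n => (f n).2) t (fun n => ltW (t0 n)).
  by move=> n; have [] := fS n.
exists (fun n => (f n).1), (fun n => (f n).2), X, Y => n.
have t0s : t 0 = s by rewrite /t expr0 divr1.
split; first by have := XP n; rewrite t0s.
  by have := YP n; rewrite t0s.
elim: n => [|n IH]; first by rewrite !expr0 divr1 mul1r.
have [_ _ H] := fS n; apply: le_trans IH _.
by rewrite exprSr -mulrA ler_pM2l ?exprn_gt0.
Qed.

(** Goursat: bisect a square on which the integral does not vanish; around the
    common point of the nested squares the integrand is affine up to a
    negligible error, and affine integrands have a primitive. *)
Lemma goursat g u v s : a0 < u -> a0 < v -> 0 < s ->
  (forall y, ccont (g^~ y)) -> (forall x, ccont (g x)) ->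
  (forall x y, u <= x <= u + s -> v <= y <= v + s -> exists a b : C,
     forall e : R, 0 < e -> exists2 d : R, 0 < d & forall x' y',
       u <= x' <= u + s -> v <= y' <= v + s ->
       `|x' - x| + `|y' - y| < d ->
       nrm (g x' y' - (a + pt x' y' * b)) <= e * (`|x' - x| + `|y' - y|)) ->
  rint g u (u + s) v (v + s) = 0.
Proof.
move=> au av s0 cx cy gd; apply/eqP; rewrite -nrm_eq0.
have := nrm_ge0 (rint g u (u + s) v (v + s)).
set N := nrm _; rewrite le_eqVlt => /predU1P[<-|N0]; first by rewrite eqxx.
exfalso.
have [x [y [X [Y nest]]]] := nested_squares g u v s0.
have Xin : u <= X <= u + s.
  have [[h1 h2 h3 h4] _ _] := nest 0%N.
  by rewrite (le_trans h1 h2) (le_trans h3 h4).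
have Yin : v <= Y <= v + s.
  have [_ [h1 h2 h3 h4] _] := nest 0%N.
  by rewrite (le_trans h1 h2) (le_trans h3 h4).
have [a [b gab]] := gd X Y Xin Yin.
(* With this constant the upper bound on the [n]-th square is half of the lower
   bound [N / 4 ^ n]. *)
have e0 : 0 < N / (16 * s ^+ 2) by rewrite divr_gt0 ?mulr_gt0 ?exprn_gt0.
have [d d0 gabd] := gab _ e0.
have [n tn] : exists n, 2 * (s / 2 ^+ n) < d.
  have [k Hk] : exists k : nat, 2 * s / d < k%:R.
    by exists (Num.bound (2 * s / d)); apply: archi_boundP; rewrite divr_ge0 ?mulr_ge0 // ltW.
  exists k; rewrite mulrA ltr_pdivrMr ?exprn_gt0 // [ltRHS]mulrC -ltr_pdivrMr //.
  apply: lt_trans Hk _; rewrite -natrX ltr_nat; exact: ltn_expl.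
have [[x1 x2 x3 x4] [y1 y2 y3 y4]] := nest n.
have tn0 : 0 < s / 2 ^+ n by rewrite divr_gt0 ?exprn_gt0.
rewrite -/N -ler_pdivrMl ?exprn_gt0 // => big.
have [xt yt] : x n <= x n + s / 2 ^+ n /\ y n <= y n + s / 2 ^+ n.
  by split; rewrite lerDl ltW.
have near (z z' Z t : R) : z <= Z -> Z <= z + t -> z <= z' <= z + t -> `|z' - Z| <= t.
  by move=> h1 h2 /andP[h3 h4]; rewrite ler_norml; apply/andP; split; lra.
have inside (z z' l r t : R) : l <= z -> z + t <= r -> z <= z' <= z + t -> l <= z' <= r.
  by move=> h1 h2 /andP[h3 h4]; rewrite (le_trans h1 h3) (le_trans h4 h2).
have := @rint_affine g (x n) (x n + s / 2 ^+ n) (y n) (y n + s / 2 ^+ n) a b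
  (N / (16 * s ^+ 2) * (2 * (s / 2 ^+ n))).
move=> /(_ (And4 (cx _) (cx _) (cy _) (cy _)) (lt_le_trans au x1) xt
  (lt_le_trans av y1) yt) bound.
have {bound} bound : nrm (sqint g (x n) (y n) (s / 2 ^+ n))
    <= 2 * (N / (16 * s ^+ 2) * (2 * (s / 2 ^+ n))) * (s / 2 ^+ n + s / 2 ^+ n).
  rewrite [x n + _]addrC [y n + _]addrC !addrK in bound.
  rewrite /sqint [x n + _]addrC [y n + _]addrC.
  apply: bound => x' y'; rewrite ![s / _ + _]addrC => xx yy _.
  have dd : `|x' - X| + `|y' - Y| <= 2 * (s / 2 ^+ n).
    rewrite mulr_natl mulr2n; apply: lerD.
      exact: near x2 x3 xx.
    exact: near y2 y3 yy.
  apply: le_trans (gabd x' y' (inside _ _ _ _ _ x1 x4 xx) (inside _ _ _ _ _ y1 y4 yy) _) _.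
    exact: le_lt_trans dd tn.
  by apply: ler_wpM2l dd; exact: ltW.
have {big bound} := le_trans big bound.
have -> : 2 * (N / (16 * s ^+ 2) * (2 * (s / 2 ^+ n))) * (s / 2 ^+ n + s / 2 ^+ n)
    = (4 ^+ n)^-1 * (N / 2).
  rewrite (_ : 4 = 2 * 2) ?exprMn; last by ring.
  have : (2 : R) ^+ n != 0 by rewrite expf_neq0.
  by move: (2 ^+ n) => k k0; field; rewrite k0 gt_eqF.
rewrite ler_pM2l ?invr_gt0 ?exprn_gt0 //; clear -N0; lra.
Qed.

End Cauchy.

(** * Cauchy's theorem on a square with an exceptional centre *)

Section CauchyEstimates.
Variable R : realType.
Local Notation C := (CC R).
Implicit Types (x y r s : R).

Definition cderivable (W : normedModType C) (f : C -> W) (z : C) :=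
  exists l, tangent setT (fun h => f (z + h)) l.

Definition clamp (a b x : R) := Num.max a (Num.min x b).

Lemma clamp_in a b x : a <= b -> a <= clamp a b x <= b.
Proof. by move=> ab; rewrite /clamp le_max lexx /= ge_max ab ge_min lexx orbT. Qed.

Lemma clamp_id a b x : a <= x <= b -> clamp a b x = x.
Proof.
by move=> /andP[ax xb]; rewrite /clamp (min_idPl xb) (max_idPr ax).
Qed.

Lemma clamp_lip a b x y : `|clamp a b x - clamp a b y| <= `|x - y|.
Proof.
rewrite /clamp; have := ler_norm (x - y); have := ler_norm (y - x).
rewrite (distrC y); have := normr_ge0 (x - y).
by case: (leP x b) => ?; case: (leP y b) => ?;
  [case: (leP a x) => ?; case: (leP a y) => ?|
   case: (leP a x) => ?; case: (leP a b) => ?|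
   case: (leP a b) => ?; case: (leP a y) => ?|case: (leP a b) => ?] => *;
  rewrite ler_norml; apply/andP; split; lra.
Qed.

Lemma cderivable_cont (W : normedModType C) (f : C -> W) z : cderivable f z ->
  forall e : R, 0 < e -> exists2 d : R, 0 < d &
    forall z', nrm (z' - z) < d -> nrm (f z' - f z) < e.
Proof.
move=> [l fl] e e0; have [d d0 H] := tangent_cont fl e0.
exists d => // z' zd; have := H (z' - z) I zd.
by rewrite addr0 [z + _]addrC subrK.
Qed.

Lemma ccont_hline (k : C -> C) a b x' :
  (forall x, cderivable k (pt (clamp a b x) x')) ->
  ccont (fun x => k (pt (clamp a b x) x')).
Proof.
move=> kd y e e0; have [d d0 H] := cderivable_cont (kd y) e0.
exists d => // z zy; apply: H; rewrite ptB subrr.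
apply: le_lt_trans (nrm_pt _ _) _; rewrite normr0 addr0.
exact: le_lt_trans (clamp_lip _ _ _ _) zy.
Qed.

Lemma ccont_vline (k : C -> C) a b x' :
  (forall x, cderivable k (pt x' (clamp a b x))) ->
  ccont (fun x => k (pt x' (clamp a b x))).
Proof.
move=> kd y e e0; have [d d0 H] := cderivable_cont (kd y) e0.
exists d => // z zy; apply: H; rewrite ptB subrr.
apply: le_lt_trans (nrm_pt _ _) _; rewrite normr0 add0r.
exact: le_lt_trans (clamp_lip _ _ _ _) zy.
Qed.

(** Values of [k] on the rectangle, extended constantly along the axes so that
    the primitives along full lines exist. *)
Definition grid (k : C -> C) a b c d x y := k (pt (clamp a b x) (clamp c d y)).

Lemma goursat_square (k : C -> C) a0 x0 x1 y0 y1 :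
  a0 < x0 -> a0 < y0 -> x0 < x1 -> x1 - x0 = y1 - y0 ->
  (forall x y, x0 <= x <= x1 -> y0 <= y <= y1 -> cderivable k (pt x y)) ->
  rint a0 (grid k x0 x1 y0 y1) x0 x1 y0 y1 = 0.
Proof.
move=> ax ay x01 sq kd.
have x01' := ltW x01; have y01 : y0 <= y1 by lra.
have [Ex Ey] : x1 = x0 + (x1 - x0) /\ y1 = y0 + (x1 - x0) by split; lra.
rewrite {2}Ex {2}Ey; apply: goursat => //; first by lra.
- by move=> y; apply: ccont_hline => x; apply: kd; apply: clamp_in.
- by move=> y; apply: ccont_vline => x; apply: kd; apply: clamp_in.
rewrite -Ex -Ey => x y xx yy; have [l kl] := kd x y xx yy.
exists (k (pt x y) - pt x y * l), l => e e0.
have [d d0 H] := kl e e0; exists d => // x' y' xx' yy' dd.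
rewrite /grid !clamp_id //.
have hd : nrm (pt x' y' - pt x y) <= `|x' - x| + `|y' - y| by rewrite ptB nrm_pt.
have := H (pt x' y' - pt x y) I (le_lt_trans hd dd).
rewrite addr0 [pt x y + _]addrC subrK => H'.
have -> : k (pt x' y') - (k (pt x y) - pt x y * l + pt x' y' * l)
   = k (pt x' y') - k (pt x y) - (pt x' y' - pt x y) * l by ring.
by apply: le_trans H' _; rewrite ler_pM2l.
Qed.

Section Centre.
Variables (k : C -> C) (r : R).
Hypothesis r0 : 0 < r.
Hypothesis kd : forall x y, -r <= x <= r -> -r <= y <= r ->
  pt x y != 0 -> cderivable k (pt x y).

(* A base point to the left of and below the square. *)
Let a0 := - r - 1.
Let g := grid k (-r) r (-r) r.

Lemma pt_neq0 x y : (x != 0) || (y != 0) -> pt x y != 0.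
Proof. by rewrite eq_complex /= negb_and. Qed.

Let rr : - r <= r. Proof. by have r0' := r0; lra. Qed.

Let hcont y : -r <= y <= r -> y != 0 -> ccont (g^~ y).
Proof.
move=> yr yn; rewrite /g /grid /=; apply: ccont_hline => x.
by apply: kd; [exact: clamp_in|exact: clamp_in|]; apply: pt_neq0; rewrite (clamp_id yr) yn orbT.
Qed.

Let vcont x : -r <= x <= r -> x != 0 -> ccont (g x).
Proof.
move=> xr xn; rewrite /g /grid /=; apply: ccont_vline => y.
by apply: kd; [exact: clamp_in|exact: clamp_in|]; apply: pt_neq0; rewrite (clamp_id xr) xn.
Qed.

Lemma square_off_centre x0 x1 y0 y1 :
  -r <= x0 -> x1 <= r -> -r <= y0 -> y1 <= r -> x0 < x1 -> x1 - x0 = y1 - y0 ->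
  x0 != 0 -> x1 != 0 -> y0 != 0 -> y1 != 0 ->
  [|| 0 < x0, x1 < 0, 0 < y0 | y1 < 0] ->
  rint a0 g x0 x1 y0 y1 = 0.
Proof.
move=> rx0 rx1 ry0 ry1 x01 sq nx0 nx1 ny0 ny1 away.
have kd' x y : x0 <= x <= x1 -> y0 <= y <= y1 -> cderivable k (pt x y).
  move=> /andP[xx0 xx1] /andP[yy0 yy1]; apply: kd; try (by apply/andP; split; lra).
  apply: pt_neq0; case/or4P: away => H; apply/orP.
  - by left; rewrite gt_eqF //; lra.
  - by left; rewrite lt_eqF //; lra.
  - by right; rewrite gt_eqF //; lra.
  - by right; rewrite lt_eqF //; lra.
have ax : a0 < x0 by rewrite /a0; lra.
have ay : a0 < y0 by rewrite /a0; lra.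
rewrite -(goursat_square ax ay x01 sq kd') /rint.
have x01' := ltW x01; have y01 : y0 <= y1 by lra.
have xr x : x0 <= x <= x1 -> -r <= x <= r.
  by move=> /andP[? ?]; apply/andP; split; lra.
have yr y : y0 <= y <= y1 -> -r <= y <= r.
  by move=> /andP[? ?]; apply/andP; split; lra.
have E x y : x0 <= x <= x1 -> y0 <= y <= y1 ->
    g x y = grid k x0 x1 y0 y1 x y.
  move=> xx yy; rewrite /g /grid (clamp_id (xr _ xx)) (clamp_id (yr _ yy)).
  by rewrite (clamp_id xx) (clamp_id yy).
have hc y : ccont ((grid k x0 x1 y0 y1)^~ y).
  by apply: ccont_hline => x; apply: kd'; apply: clamp_in.
have vc x : ccont (grid k x0 x1 y0 y1 x).
  by apply: ccont_vline => y; apply: kd'; apply: clamp_in.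
have ex0 : x0 <= x0 <= x1 by rewrite lexx.
have ex1 : x0 <= x1 <= x1 by rewrite lexx x01'.
have ey0 : y0 <= y0 <= y1 by rewrite lexx.
have ey1 : y0 <= y1 <= y1 by rewrite lexx y01.
rewrite (seg_eq (hc y0) (hcont (yr _ ey0) ny0)) // => [|x xx]; last exact: E.
rewrite (seg_eq (hc y1) (hcont (yr _ ey1) ny1)) // => [|x xx]; last exact: E.
rewrite (seg_eq (vc x0) (vcont (xr _ ex0) nx0)) // => [|y yy]; last exact: E.
by rewrite (seg_eq (vc x1) (vcont (xr _ ex1) nx1)) // => y yy; exact: E.
Qed.

(** Only the middle one of nine equal squares meets the centre, so the integral
    over a centred square does not change when its side is divided by three. *)
Lemma rint_third s : 0 < s -> s <= r ->
  rint a0 g (-s) s (-s) s = rint a0 g (-(s / 3)) (s / 3) (-(s / 3)) (s / 3).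
Proof.
move=> s0 sr.
rewrite (rint_catx _ _ (-s) (-(s / 3)) s) (rint_catx _ _ (-(s / 3)) (s / 3) s).
rewrite (rint_caty _ _ (-s) (-(s/3)) (-s) (-(s / 3)) s).
rewrite (rint_caty _ _ (-s) (-(s/3)) (-(s/3)) (s / 3) s).
rewrite (rint_caty _ _ (-(s/3)) (s/3) (-s) (-(s / 3)) s).
rewrite (rint_caty _ _ (-(s/3)) (s/3) (-(s/3)) (s / 3) s).
rewrite (rint_caty _ _ (s/3) s (-s) (-(s / 3)) s).
rewrite (rint_caty _ _ (s/3) s (-(s/3)) (s / 3) s).
have n1 : -s != 0 by rewrite lt_eqF //; lra.
have n2 : -(s/3) != 0 by rewrite lt_eqF //; lra.
have n3 : s/3 != 0 by rewrite gt_eqF //; lra.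
have n4 : s != 0 by rewrite gt_eqF.
have p1 : 0 < s / 3 by lra.
have p2 : -(s / 3) < 0 by lra.
have z00 : rint a0 g (-s) (-(s / 3)) (-s) (-(s / 3)) = 0.
  by apply: square_off_centre; rewrite ?p1 ?p2 ?orbT //; lra.
have z01 : rint a0 g (-s) (-(s / 3)) (-(s / 3)) (s / 3) = 0.
  by apply: square_off_centre; rewrite ?p1 ?p2 ?orbT //; lra.
have z02 : rint a0 g (-s) (-(s / 3)) (s / 3) s = 0.
  by apply: square_off_centre; rewrite ?p1 ?p2 ?orbT //; lra.
have z10 : rint a0 g (-(s / 3)) (s / 3) (-s) (-(s / 3)) = 0.
  by apply: square_off_centre; rewrite ?p1 ?p2 ?orbT //; lra.
have z12 : rint a0 g (-(s / 3)) (s / 3) (s / 3) s = 0.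
  by apply: square_off_centre; rewrite ?p1 ?p2 ?orbT //; lra.
have z20 : rint a0 g (s / 3) s (-s) (-(s / 3)) = 0.
  by apply: square_off_centre; rewrite ?p1 ?p2 ?orbT //; lra.
have z21 : rint a0 g (s / 3) s (-(s / 3)) (s / 3) = 0.
  by apply: square_off_centre; rewrite ?p1 ?p2 ?orbT //; lra.
have z22 : rint a0 g (s / 3) s (s / 3) s = 0.
  by apply: square_off_centre; rewrite ?p1 ?p2 ?orbT //; lra.
by rewrite z00 z01 z02 z10 z12 z20 z21 z22 !add0r !addr0.
Qed.

Lemma sides_centred s : 0 < s -> s <= r -> sides_cont g (-s) s (-s) s.
Proof.
move=> s0 sr; have n1 : -s != 0 by rewrite lt_eqF //; lra.
have n4 : s != 0 by rewrite gt_eqF.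
have e1 : -r <= -s <= r by apply/andP; split; lra.
have e2 : -r <= s <= r by apply/andP; split; lra.
by split; [apply: hcont|apply: hcont|apply: vcont|apply: vcont].
Qed.

Lemma nrm_side s x y : 0 < s -> -s <= x <= s -> -s <= y <= s ->
  [|| x == -s, x == s, y == -s | y == s] -> s <= nrm (pt x y) < 2 * s.
Proof.
move=> s0 xs ys sd.
have xs' : x ^+ 2 <= s ^+ 2 by have := xs; move=> /andP[? ?]; nra.
have ys' : y ^+ 2 <= s ^+ 2 by have := ys; move=> /andP[? ?]; nra.
have lo : s ^+ 2 <= nrm (pt x y) ^+ 2.
  rewrite nrm2 /=; have := sqr_ge0 x; have := sqr_ge0 y.
  by case/or4P: sd => /eqP ->; rewrite ?sqrrN; lra.
apply/andP; split.
  by rewrite -(@ler_pXn2r _ 2) ?nnegrE ?nrm_ge0 ?(ltW s0).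
rewrite -(@ltr_pXn2r _ 2) ?nnegrE ?nrm_ge0 ?mulr_ge0 ?(ltW s0) //.
rewrite nrm2 /=; have := exprn_gt0 2 s0; rewrite exprMn; lra.
Qed.

(** The squares can be shrunk until the smallness of [|k z| |z|] outweighs the
    perimeter, which is comparable to [|z|]. *)
Lemma rint_centre :
  (forall e : R, 0 < e -> exists2 d : R, 0 < d & forall z, z != 0 ->
    nrm z < d -> nrm (k z) * nrm z <= e) ->
  rint a0 g (-r) r (-r) r = 0.
Proof.
move=> small; apply/eqP; rewrite -nrm_eq0 eq_le nrm_ge0 andbT.
apply/ler_addgt0Pl => e e0; rewrite addr0.
have e8 : 0 < e / 8 by rewrite divr_gt0.
have [d d0 H] := small _ e8.
have s0 n : 0 < r / 3 ^+ n by rewrite divr_gt0 ?exprn_gt0.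
have sr n : r / 3 ^+ n <= r.
  by rewrite ler_pdivrMr ?exprn_gt0 // ler_peMr ?(ltW r0) // exprn_ege1 //; lra.
have E n : rint a0 g (-r) r (-r) r
    = rint a0 g (-(r / 3 ^+ n)) (r / 3 ^+ n) (-(r / 3 ^+ n)) (r / 3 ^+ n).
  elim: n => [|n IH]; first by rewrite expr0 divr1.
  by rewrite IH rint_third // exprSr invfM mulrA.
have [n sn] : exists n, 2 * (r / 3 ^+ n) < d.
  have [m Hm] : exists m : nat, 2 * r / d < m%:R.
    by exists (Num.bound (2 * r / d)); apply: archi_boundP; rewrite divr_ge0 ?mulr_ge0 // ltW.
  exists m; rewrite mulrA ltr_pdivrMr ?exprn_gt0 // [ltRHS]mulrC -ltr_pdivrMr //.
  apply: lt_trans Hm _; rewrite -natrX ltr_nat; exact: ltn_expl.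
rewrite (E n); move: (s0 n) (sr n) sn; set s := r / 3 ^+ n => {}s0 {}sr sn.
apply: (le_trans (rint_bound (e := e / 8 / s) (sides_centred s0 sr) _ _ _ _ _)).
- by rewrite /a0; lra.
- by lra.
- by rewrite /a0; lra.
- by lra.
- move=> x y xs ys sd; have /andP[lo hi] := nrm_side s0 xs ys sd.
  have p0 : pt x y != 0 by rewrite -nrm_gt0; exact: lt_le_trans lo.
  have rx : -r <= x <= r by case/andP: xs => *; apply/andP; split; lra.
  have ry : -r <= y <= r by case/andP: ys => *; apply/andP; split; lra.
  rewrite /g /grid !clamp_id // ler_pdivlMr //.
  apply: le_trans (H _ p0 (lt_trans hi sn)).
  by apply: ler_wpM2l lo; exact: nrm_ge0.
rewrite [leLHS](_ : _ = e) //; field; rewrite gt_eqF //.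
Qed.

End Centre.
End CauchyEstimates.

(** * Cauchy estimates *)

Section Estimates.
Variable R : realType.
Local Notation C := (CC R).
Implicit Types (x y r s : R).

Lemma cderivable_id (z : C) : cderivable (fun z : C => z) z.
Proof.
exists (0 + 1); apply: tangentD; first exact: tangent_cst.
exact: tangent_id.
Qed.

Lemma cderivable_cst (W : normedModType C) (w : W) (z : C) :
  cderivable (fun=> w) z.
Proof. by exists 0; exact: tangent_cst. Qed.

Lemma cderivableB (W : normedModType C) (f g : C -> W) z :
  cderivable f z -> cderivable g z -> cderivable (fun z => f z - g z) z.
Proof. by move=> [l fl] [k gk]; exists (l - k); apply: tangentB. Qed.

Lemma cderivableM (f g : C -> C) z :
  cderivable f z -> cderivable g z -> cderivable (fun z => f z * g z) z.
Proof. by move=> [l fl] [k gk]; eexists; exact: tangentM fl gk. Qed.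

Lemma cderivableV (f : C -> C) z : f z != 0 ->
  cderivable f z -> cderivable (fun z => (f z)^-1) z.
Proof.
move=> fz [l fl]; eexists; apply: tangentV fl => //.
by rewrite addr0.
Qed.

Lemma cderivableX (f : C -> C) n z :
  cderivable f z -> cderivable (fun z => f z ^+ n) z.
Proof. by move=> [l fl]; apply: tangentiableX; first by []; exists l. Qed.

Lemma cderivableZ (W : normedModType C) (f : C -> C) (g : C -> W) z :
  cderivable f z -> cderivable g z -> cderivable (fun z => f z *: g z) z.
Proof.
move=> [l fl] [k gk]; eexists.
apply: (@tangent_bilinear _ setT _ _ _ (fun (x : C) (y : W) => x *: y)) fl gk.
- by move=> x x' y; rewrite scalerBl.
- by move=> x y y'; rewrite scalerBr.
- by move=> h x y _; rewrite scalerA.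
- by move=> h x y _; rewrite !scalerA mulrC.
- by move=> x y; rewrite nrmZ.
Qed.

Lemma cderivable_near (W : normedModType C) (f g : C -> W) z :
  (exists2 d : R, 0 < d & forall z', nrm (z' - z) < d -> f z' = g z') ->
  cderivable f z -> cderivable g z.
Proof.
move=> [d d0 fg] [l fl]; exists l; apply: tangent_near fl => //.
by exists d => // h _ hd; apply: fg; rewrite addrC addKr.
Qed.

(** The four sides of a centred square each contribute a positive imaginary
    part to the integral of [dz / z]. *)
Lemma rint_inv r : 0 < r ->
  4 <= nrm (rint (- r - 1) (grid (fun z : C => z^-1) (-r) r (-r) r) (-r) r (-r) r).
Proof.
move=> r0; set a0 := - r - 1; set g := grid _ _ _ _ _.
have kd x y : -r <= x <= r -> -r <= y <= r -> pt x y != 0 ->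
    cderivable (fun z : C => z^-1) (pt x y).
  by move=> _ _ p0; apply: cderivableV => //; exact: cderivable_id.
have [c1 c2 c3 c4] := sides_centred r0 kd r0 (lexx r).
have ax : a0 < -r by rewrite /a0; lra.
have rr : -r <= r by lra.
have rin : -r <= r <= r by rewrite rr lexx.
have lin : -r <= -r <= r by rewrite rr lexx.
have side (f : R -> C) (u : C) : ccont f ->
    (forall x, -r <= x <= r -> complex.Re (u * f x) <= - (2 * r)^-1) ->
    complex.Re (u * seg a0 f (-r) r) <= -1.
  move=> cf uf; have -> : -1 = - (2 * r)^-1 * (r - - r).
    by field; rewrite gt_eqF.
  apply: (mean_value_Re rr (Gd := f)) => // x /andP[rx _].
  by apply: prim_tangent => //; exact: lt_le_trans rx.
have inv x y : (pt x y)^-1 = ((x / (x ^+ 2 + y ^+ 2)) -i* (y / (x ^+ 2 + y ^+ 2)))%C by [].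
have est x : -r <= x <= r -> - (r / (r ^+ 2 + x ^+ 2)) <= - (2 * r)^-1.
  move=> /andP[x1 x2]; rewrite lerN2.
  have D0 : 0 < r ^+ 2 + x ^+ 2 by have := sqr_ge0 x; have := exprn_gt0 2 r0; lra.
  by rewrite ler_pdivlMr // ler_pdivrMl ?mulr_gt0 //; nra.
have h1 := side (g^~ (-r)) 'i c1; have h2 := side (g^~ r) (- 'i) c2.
have h3 := side (g (-r)) 1 c3; have h4 := side (g r) (-1) c4.
have {}h1 : complex.Re ('i * seg a0 (g^~ (-r)) (-r) r) <= -1.
  apply: h1 => x xr; rewrite /g /grid (clamp_id xr) (clamp_id lin) inv /=.
  rewrite sqrrN [_ + r ^+ 2]addrC; apply: le_trans (est x xr).
  by rewrite le_eqVlt; apply/orP; left; apply/eqP; rewrite mulNr; ring.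
have {}h2 : complex.Re (- 'i * seg a0 (g^~ r) (-r) r) <= -1.
  apply: h2 => x xr; rewrite /g /grid (clamp_id xr) (clamp_id rin) inv /=.
  rewrite [_ + r ^+ 2]addrC; apply: le_trans (est x xr).
  by rewrite le_eqVlt; apply/orP; left; apply/eqP; ring.
have {}h3 : complex.Re (1 * seg a0 (g (-r)) (-r) r) <= -1.
  apply: h3 => x xr; rewrite /g /grid (clamp_id xr) (clamp_id lin) inv /=.
  rewrite sqrrN; apply: le_trans (est x xr).
  by rewrite le_eqVlt; apply/orP; left; apply/eqP; rewrite mulNr; ring.
have {}h4 : complex.Re (-1 * seg a0 (g r) (-r) r) <= -1.
  apply: h4 => x xr; rewrite /g /grid (clamp_id xr) (clamp_id rin) inv /=.
  apply: le_trans (est x xr).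
  by rewrite le_eqVlt; apply/orP; left; apply/eqP; ring.
apply: le_trans (normIm _); apply: le_trans (ler_norm _).
move: h1 h2 h3 h4; rewrite /rint.
case: (seg a0 (g^~ (-r)) (-r) r) => [u1 v1]; case: (seg a0 (g r) (-r) r) => [u2 v2].
case: (seg a0 (g^~ r) (-r) r) => [u3 v3]; case: (seg a0 (g (-r)) (-r) r) => [u4 v4] /=.
lra.
Qed.

Lemma nrm_square r x y : 0 < r -> -r <= x <= r -> -r <= y <= r ->
  nrm (pt x y) < 2 * r.
Proof.
move=> r0 xs ys.
have xs' : x ^+ 2 <= r ^+ 2 by have := xs; move=> /andP[? ?]; nra.
have ys' : y ^+ 2 <= r ^+ 2 by have := ys; move=> /andP[? ?]; nra.
rewrite -(@ltr_pXn2r _ 2) ?nnegrE ?nrm_ge0 ?mulr_ge0 ?(ltW r0) //.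
by rewrite nrm2 /=; have := exprn_gt0 2 r0; rewrite exprMn; lra.
Qed.

(** The function may be merely continuous at the centre: the integral of
    [(q z - q 0) / z] vanishes, so that [q 0] times the integral of [1 / z], of
    modulus at least [4], is the integral of [q z / z], of modulus at most
    [8 * B]. *)
Lemma centre_bound_scalar (q : C -> C) r (B : R) : 0 < r ->
  (forall z, z != 0 -> nrm z < 2 * r -> cderivable q z) ->
  (forall e : R, 0 < e -> exists2 d : R, 0 < d & forall z, nrm z < d ->
     nrm (q z - q 0) < e) ->
  (forall z, r <= nrm z < 2 * r -> nrm (q z) <= B) ->
  nrm (q 0) <= 2 * B.
Proof.
move=> r0 qd qc qB.
pose k (z : C) := (q z - q 0) * z^-1.
pose f (z : C) := q z * z^-1.
pose v (z : C) := z^-1.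
have vd x y : -r <= x <= r -> -r <= y <= r -> pt x y != 0 -> cderivable v (pt x y).
  by move=> _ _ p0; apply: cderivableV => //; exact: cderivable_id.
have fd x y : -r <= x <= r -> -r <= y <= r -> pt x y != 0 -> cderivable f (pt x y).
  move=> xr yr p0; apply: cderivableM; last exact: vd.
  by apply: qd => //; exact: nrm_square.
have kd x y : -r <= x <= r -> -r <= y <= r -> pt x y != 0 -> cderivable k (pt x y).
  move=> xr yr p0; apply: cderivableM; last exact: vd.
  apply: cderivableB; last exact: cderivable_cst.
  by apply: qd => //; exact: nrm_square.
have K0 := rint_centre r0 kd.
have {}K0 : rint (- r - 1) (grid k (-r) r (-r) r) (-r) r (-r) r = 0.
  apply: K0 => e e0; have [d d0 H] := qc e e0.
  exists d => // z z0 zd; rewrite /k nrmM nrmV divfK ?nrm_eq0 //.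
  exact/ltW/H.
have fc := sides_centred r0 fd r0 (lexx r).
have kc := sides_centred r0 kd r0 (lexx r).
have vc := sides_centred r0 vd r0 (lexx r).
have rr : -r <= r by lra.
have ax : - r - 1 < -r by lra.
have E : rint (- r - 1) (grid f (-r) r (-r) r) (-r) r (-r) r =
    rint (- r - 1) (grid k (-r) r (-r) r) (-r) r (-r) r
    + q 0 * rint (- r - 1) (grid v (-r) r (-r) r) (-r) r (-r) r.
  have fkv z : f z = k z + q 0 * v z by rewrite /f /k /v; ring.
  by apply: (rint_lin kc vc fc ax rr ax rr) => x y; exact: fkv.
have lo := rint_inv r0; rewrite -/v in lo.
have hi : nrm (rint (- r - 1) (grid f (-r) r (-r) r) (-r) r (-r) r)
    <= 2 * (B / r) * ((r - - r) + (r - - r)).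
  apply: rint_bound => // x y xr yr sd.
  have /andP[p1 p2] := nrm_side r0 xr yr sd.
  rewrite /grid (clamp_id xr) (clamp_id yr) /f nrmM nrmV.
  have B0 : 0 <= B by apply: le_trans (nrm_ge0 _) (qB (pt x y) _); rewrite p1.
  apply: ler_pM; rewrite ?invr_ge0 ?nrm_ge0 //; first by rewrite qB // p1.
  by rewrite lef_pV2 // posrE // (lt_le_trans r0).
move: hi; rewrite E K0 add0r nrmM.
have -> : 2 * (B / r) * ((r - - r) + (r - - r)) = 8 * B by field; rewrite gt_eqF.
have := nrm_ge0 (q 0); move: lo; set c := nrm (rint _ _ _ _ _ _); nra.
Qed.

(** Enough bounded functionals to compute the norm of any vector: what reduces
    vector valued estimates to scalar ones. *)
Definition normed_by_functionals (W : normedModType C) :=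
  forall w : W, exists l : W -> C,
    [/\ forall a (x y : W), l (a *: x + y) = a * l x + l y,
        forall x : W, nrm (l x) <= nrm x & l w = (nrm w)%:C%C].

Lemma normed_by_functionals_scalar : normed_by_functionals C.
Proof.
move=> w; have [->|w0] := eqVneq w 0.
  exists (fun=> 0); split => [a x y|x|]; rewrite ?mulr0 ?addr0 ?nrm0 ?nrm_ge0 //.
exists (fun z => z * (w^* / (nrm w)%:C%C)).
have n0 : nrm w != 0 by rewrite nrm_eq0.
have n0' : (nrm w)%:C%C != 0 :> C by rewrite (inj_eq (@complexI R)).
split => [a x y|x|].
- by rewrite /GRing.scale /=; ring.
- rewrite !nrmM nrmV nrmJ nrmR ger0_norm ?nrm_ge0 // divff // mulr1.
  by [].
- by rewrite mulrA mulJ_nrm rmorphXn /= expr2 mulfK.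
Qed.

Section Vector.
Variable W : normedModType C.
Hypothesis WF : normed_by_functionals W.

Lemma functional_B (l : W -> C) : (forall a (x y : W), l (a *: x + y) = a * l x + l y) ->
  forall x y : W, l (x - y) = l x - l y.
Proof. by move=> lL x y; rewrite addrC -scaleN1r lL mulN1r addrC. Qed.

Lemma functional_Z (l : W -> C) : (forall a (x y : W), l (a *: x + y) = a * l x + l y) ->
  forall a (x : W), l (a *: x) = a *: l x.
Proof.
move=> lL a x; have l0 : l 0 = 0 by rewrite -(subrr (0 : W)) functional_B // subrr.
by rewrite -[a *: x]addr0 lL l0 addr0.
Qed.

Lemma tangent_functional S (l : W -> C) (f : C -> W) k :
  (forall a (x y : W), l (a *: x + y) = a * l x + l y) ->
  (forall x : W, nrm (l x) <= nrm x) ->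
  tangent S f k -> tangent S (fun z => l (f z)) (l k).
Proof.
move=> lL lN; apply: (@tangent_linear _ _ _ _ _ 1) => [x y|h x _|x].
- exact: functional_B.
- exact: functional_Z.
- by rewrite mul1r.
Qed.

Lemma centre_bound (q : C -> W) r (B : R) : 0 < r ->
  (forall z, z != 0 -> nrm z < 2 * r -> cderivable q z) ->
  (forall e : R, 0 < e -> exists2 d : R, 0 < d & forall z, nrm z < d ->
     nrm (q z - q 0) < e) ->
  (forall z, r <= nrm z < 2 * r -> nrm (q z) <= B) ->
  nrm (q 0) <= 2 * B.
Proof.
move=> r0 qd qc qB; have [l [lL lN lq]] := WF (q 0).
rewrite -[leLHS]ger0_norm ?nrm_ge0 // -nrmR -lq.
apply: (centre_bound_scalar (q := l \o q) r0).
- move=> z z0 zr; have [k qk] := qd z z0 zr.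
  by exists (l k); exact: tangent_functional.
- move=> e e0; have [d d0 H] := qc e e0; exists d => // z zd /=.
  by rewrite -functional_B //; apply: le_lt_trans (lN _) (H z zd).
- by move=> z zr /=; apply: le_trans (lN _) (qB z zr).
Qed.

Lemma mean_value (f f' : C -> W) (a b : C) (M : R) :
  (forall s, 0 <= s <= 1 ->
     tangent setT (fun h => f (a + (s%:C%C : C) * (b - a) + h)) (f' (a + (s%:C%C : C) * (b - a)))) ->
  (forall s, 0 <= s <= 1 -> nrm (f' (a + (s%:C%C : C) * (b - a))) <= M) ->
  nrm (f b - f a) <= M * nrm (b - a).
Proof.
move=> ff' fM; have [l [lL lN lq]] := WF (f b - f a).
rewrite -[leLHS]ger0_norm ?nrm_ge0 // -nrmR -lq functional_B //.
pose G s : C := l (f (a + (s%:C%C : C) * (b - a))).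
have -> : l (f b) - l (f a) = G 1 - G 0.
  by rewrite /G rmorph1 rmorph0 mul1r mul0r addr0 [a + _]addrC subrK.
rewrite -[leRHS]mulr1 -[X in _ * X]subr0.
apply: (mean_value_nrm ler01
  (Gd := fun s => (b - a) * l (f' (a + (s%:C%C : C) * (b - a))))) => s s01.
  have := tangent_functional lL lN (ff' s s01).
  move=> /(@tangent_reparam _ _ (@realline R) _ _ _ (b - a) (fun _ _ => I)).
  apply: tangent_near; first exact: realline0.
  exists 1 => // h Sh _; rewrite /G rmorphD /= Sh; congr (l (f _)); ring.
by rewrite nrmM mulrC ler_wpM2r ?nrm_ge0 //; apply: le_trans (lN _) (fM s s01).
Qed.

(** The bound at the centre for the difference quotient, completed by [l]. *)
Lemma cauchy_estimate (f : C -> W) l r (M : R) : 0 < r ->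
  (forall z, nrm z < 2 * r -> cderivable f z) ->
  (forall z, nrm z < 2 * r -> nrm (f z) <= M) ->
  tangent setT f l -> nrm l <= 4 * M / r.
Proof.
move=> r0 fd fM fl.
pose q (z : C) : W := if z == 0 then l else z^-1 *: (f z - f 0).
have q0 : q 0 = l by rewrite /q eqxx.
have r20 : nrm (0 : C) < 2 * r by rewrite nrm0 mulr_gt0.
rewrite -q0 (_ : 4 * M / r = 2 * (2 * M / r)); last by field; rewrite gt_eqF.
apply: (centre_bound r0).
- move=> z z0 zr; apply: (@cderivable_near _ (fun z : C => z^-1 *: (f z - f 0))).
    exists (nrm z); first by rewrite nrm_gt0.
    move=> z' zz'; rewrite /q; case: eqP => // z'0.
    by move: zz'; rewrite z'0 sub0r nrmN ltxx.
  apply: cderivableZ; first by apply: cderivableV => //; exact: cderivable_id.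
  by apply: cderivableB; [exact: fd|exact: cderivable_cst].
- move=> e e0; have [d d0 H] := fl (e / 2) (divr_gt0 e0 (ltr0n _ 2)).
  exists d => // z zd; rewrite q0 /q; case: eqP => [_|/eqP z0].
    by rewrite subrr nrm0.
  have -> : z^-1 *: (f z - f 0) - l = z^-1 *: (f z - f 0 - z *: l).
    by rewrite [RHS]scalerBr scalerA mulVf // scale1r.
  rewrite nrmZ nrmV ltr_pdivrMl ?nrm_gt0 //.
  apply: le_lt_trans (H z I zd) _; rewrite mulrC ltr_pM2l ?nrm_gt0 //; lra.
- move=> z /andP[rz zr]; rewrite /q; case: eqP => [z0|/eqP z0].
    by move: rz; rewrite z0 nrm0; lra.
  rewrite nrmZ nrmV mulrC; apply: ler_pM; rewrite ?invr_ge0 ?nrm_ge0 //.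
    by have := nrmDB (f z) (f 0); have := fM z zr; have := fM 0 r20; lra.
  by rewrite lef_pV2 // posrE // (lt_le_trans r0).
Qed.

End Vector.
End Estimates.

(** * Second-order estimates *)

Section SecondOrder.
Variable R : realType.
Local Notation C := (CC R).
Implicit Types (r s : R).

Section Taylor.
Variable W : normedModType C.
Hypothesis WF : normed_by_functionals W.
Variables (f f' : C -> W) (r M : R).
Hypothesis r0 : 0 < r.
Hypothesis fd : forall z, nrm z < 8 * r ->
  tangent setT (fun h => f (z + h)) (f' z).
Hypothesis fM : forall z, nrm z < 8 * r -> nrm (f z) <= M.

Lemma cderivable_translate (g : C -> W) a z :
  cderivable g (a + z) -> cderivable (fun w => g (a + w)) z.
Proof.
by move=> [l gl]; exists l; apply: tangent_ext gl => // h; rewrite addrA.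
Qed.

Lemma derivative_bound z : nrm z < 4 * r -> nrm (f' z) <= 2 * M / r.
Proof.
move=> zr; have r20 : 0 < 2 * r by rewrite mulr_gt0.
have -> : 2 * M / r = 4 * M / (2 * r) by field; rewrite gt_eqF.
have in8 w : nrm w < 2 * (2 * r) -> nrm (z + w) < 8 * r.
  by move=> wr; have := nrmD z w; lra.
apply: (cauchy_estimate WF (f := fun w => f (z + w)) r20) => [w wr|w wr|].
- by apply: cderivable_translate; exists (f' (z + w)); apply: fd; exact: in8.
- by apply: fM; exact: in8.
- by apply: fd; have := r0; lra.
Qed.

Lemma segment_bound a b t (B : R) : nrm a < B -> nrm b < B -> 0 <= t <= 1 ->
  nrm (a + (t%:C%C : C) * (b - a)) < B.
Proof.
move=> aB bB /andP[t0 t1].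
have -> : a + (t%:C%C : C) * (b - a) = (1 - t)%:C%C * a + t%:C%C * b.
  by rewrite rmorphB rmorph1; ring.
apply: le_lt_trans (nrmD _ _) _.
rewrite !nrmM !nrmR !ger0_norm ?subr_ge0 //.
apply: (@le_lt_trans _ _ (Num.max (nrm a) (nrm b))); last by rewrite gt_max aB.
have : nrm a <= Num.max (nrm a) (nrm b) by rewrite le_max lexx.
have : nrm b <= Num.max (nrm a) (nrm b) by rewrite le_max lexx orbT.
move: (Num.max _ _) => m; nra.
Qed.

Lemma holomorphic_lipschitz a b : nrm a < 4 * r -> nrm b < 4 * r ->
  nrm (f b - f a) <= 2 * M / r * nrm (b - a).
Proof.
move=> ar br; apply: (mean_value WF (f' := f')) => s s01.
  by apply: fd; have := segment_bound ar br s01; have := r0; lra.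
exact/derivative_bound/segment_bound.
Qed.

Lemma derivative_lipschitz a : nrm a <= 2 * r ->
  nrm (f' a - f' 0) <= 8 * M / r ^+ 2 * nrm a.
Proof.
move=> ar; have r0' := r0.
have -> : 8 * M / r ^+ 2 * nrm a = 4 * (2 * M / r * nrm a) / r.
  by field; rewrite gt_eqF.
have in8 w : nrm w < 2 * r -> nrm w < 4 * r /\ nrm (a + w) < 4 * r.
  by move=> wr; have := nrmD a w; lra.
have n0 : nrm (0 : C) < 8 * r by rewrite nrm0; lra.
apply: (cauchy_estimate WF (f := fun w => f (a + w) - f w) r0) => [w wr|w wr|].
- apply: cderivableB.
    apply: cderivable_translate; exists (f' (a + w)).
    by apply: fd; have [_] := in8 _ wr; lra.
  by exists (f' w); apply: fd; have [] := in8 _ wr; lra.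
- have [w4 aw4] := in8 _ wr.
  by have := holomorphic_lipschitz w4 aw4; rewrite addrK.
- apply: tangentB => //; first by apply: fd; lra.
  have := fd n0; apply: tangent_ext => // h; first by rewrite add0r.
Qed.

(** Cauchy's estimate bounds [f'], hence the increments of [f]; applied to
    [f (a + w) - f w] it shows that [f'] is Lipschitz, and the mean value
    inequality for [f z - z f' 0] then leaves a quadratic error. *)
Lemma taylor_bound h : nrm h <= 2 * r ->
  nrm (f h - f 0 - h *: f' 0) <= 8 * M / r ^+ 2 * nrm h ^+ 2.
Proof.
move=> hr; have r0' := r0.
have M0 : 0 <= M.
  by apply: le_trans (nrm_ge0 _) (fM (z := 0) _); rewrite nrm0; lra.
have := mean_value WF (f := fun z => f z - z *: f' 0)
  (f' := fun z => f' z - f' 0) (a := 0) (b := h) (M := 8 * M / r ^+ 2 * nrm h).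
rewrite scale0r !subr0 expr2 mulrA [f h - f 0 - _]addrAC; apply=> s s01.
  have hs : nrm (0 + (s%:C%C : C) * h) <= 2 * r.
    case/andP: s01 => s0 s1; rewrite add0r nrmM nrmR ger0_norm //.
    by have := nrm_ge0 h; nra.
  apply: tangentB => //; first by apply: fd; lra.
  have H : tangent setT (fun z => (0 + (s%:C%C : C) * h) *: f' 0 + z *: f' 0)
      (0 + f' 0).
    by apply: tangentD; [exact: tangent_cst|exact: tangent_scale].
  move: H; rewrite (add0r (f' 0)); apply: tangent_ext => // z.
  by rewrite -scalerDl.
have hs : nrm (0 + (s%:C%C : C) * h) <= nrm h.
  case/andP: s01 => s0 s1; rewrite add0r nrmM nrmR ger0_norm //.
  by have := nrm_ge0 h; nra.
apply: le_trans (derivative_lipschitz (le_trans hs hr)) _.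
by apply: ler_wpM2l => //; rewrite divr_ge0 ?mulr_ge0 ?exprn_ge0 ?(ltW r0).
Qed.

End Taylor.

Lemma pow_small (k : R) : 0 <= k < 1 -> exists n, 2 * k ^+ n < 1.
Proof.
move=> /andP[k0 k1]; have /cvg_expr : `|k| < 1 by rewrite ger0_norm.
move=> /cvgrPdist_lt /(_ (1 / 2) ltac:(lra)) [n _ /(_ n (leqnn n))] /=.
rewrite sub0r normrN normrX ger0_norm // => H; exists n; lra.
Qed.

(** The real part of a holomorphic function does not exceed, up to an arbitrary
    error, its central value somewhere on the annulus: otherwise high powers of
    [1 - tau (psi - psi 0)] violate the bound for the value at the centre. *)
Lemma exists_Re_le (psi : C -> C) r (B d : R) : 0 < r -> 0 < d ->
  (forall z, nrm z < 2 * r -> cderivable psi z) ->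
  (forall z, nrm z < 2 * r -> nrm (psi z - psi 0) <= B) ->
  exists2 z, r <= nrm z < 2 * r & complex.Re (psi z) <= complex.Re (psi 0) + d.
Proof.
move=> r0 d0 pd pB; apply: contrapT => nex.
have {}nex z : r <= nrm z < 2 * r ->
    d < complex.Re (psi z) - complex.Re (psi 0).
  move=> zr; rewrite ltrBrDl; case: ltP => // H.
  by exfalso; apply: nex; exists z.
have zr : r <= nrm (r%:C%C : C) < 2 * r by rewrite nrmR gtr0_norm // lexx; lra.
have dB : d < B.
  apply: lt_le_trans (nex _ zr) _; have /andP[_ zr'] := zr.
  apply: le_trans (pB _ zr'); apply: le_trans (ler_norm _) _.
  by rewrite -raddfB normRe.
have B0 : 0 < B by exact: lt_trans dB.
pose tau := d / B ^+ 2.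
pose q (z : C) : C := 1 - (tau%:C%C : C) * (psi z - psi 0).
pose k := 1 - d ^+ 2 / B ^+ 2.
have tau0 : 0 < tau by rewrite divr_gt0 ?exprn_gt0.
have k01 : 0 <= k < 1.
  rewrite /k -expr_div_n; have : 0 < d / B < 1.
    by rewrite divr_gt0 //= ltr_pdivrMr // mul1r.
  by case/andP => u0 u1; apply/andP; split; nra.
have qk z : r <= nrm z < 2 * r -> nrm (q z) ^+ 2 <= k.
  move=> zr2; have H := nex _ zr2; have /andP[_ zr3] := zr2.
  have HB : nrm (psi z - psi 0) ^+ 2 <= B ^+ 2.
    by rewrite ler_pXn2r ?nnegrE ?nrm_ge0 ?(ltW B0) // pB.
  have -> : nrm (q z) ^+ 2 = 1 - 2 * tau * (complex.Re (psi z) - complex.Re (psi 0))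
      + tau ^+ 2 * nrm (psi z - psi 0) ^+ 2.
    rewrite !nrm2 /q; case: (psi z) (psi 0) => [a b] [c e] /=; ring.
  have -> : k = 1 - 2 * tau * d + tau ^+ 2 * B ^+ 2.
    by rewrite /k /tau; field; rewrite gt_eqF.
  have : 0 < tau ^+ 2 by rewrite exprn_gt0.
  nra.
have [n kn] := pow_small k01.
have q0 : q 0 = 1 by rewrite /q subrr mulr0 subr0.
have := centre_bound_scalar (q := fun z => q z ^+ (2 * n)) (B := k ^+ n) r0.
rewrite q0 expr1n nrm1 => H; move: kn; apply/negP; rewrite -leNgt; apply: H.
- move=> z _ zr2; apply: cderivableX; apply: cderivableB; first exact: cderivable_cst.
  apply: cderivableM; first exact: cderivable_cst.
  by apply: cderivableB; [exact: pd|exact: cderivable_cst].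
- move=> e e0; have r20 : nrm (0 : C) < 2 * r by rewrite nrm0 mulr_gt0.
  have qd : cderivable (fun z => q z ^+ (2 * n)) 0.
    apply: cderivableX; apply: cderivableB; first exact: cderivable_cst.
    apply: cderivableM; first exact: cderivable_cst.
    by apply: cderivableB; [exact: pd|exact: cderivable_cst].
  have [d' d'0 H] := cderivable_cont qd e0; exists d' => // z zd.
  by have := H z; rewrite subr0 q0 expr1n => /(_ zd).
- move=> z zr2; rewrite nrmX exprM; apply: lerXn2r (qk z zr2).
    by rewrite nnegrE exprn_ge0 ?nrm_ge0.
  by rewrite nnegrE; case/andP: k01.
Qed.

Lemma complete_seq (W : completeNormedModType C) (u : nat -> W) :
  (forall e : R, 0 < e -> exists N, forall m n, (N <= m)%N -> (N <= n)%N ->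
     nrm (u m - u n) < e) ->
  exists l, forall e : R, 0 < e -> exists N, forall n, (N <= n)%N ->
     nrm (u n - l) < e.
Proof.
move=> cu; have : cauchy (u @ \oo).
  apply: cauchy_exP => e e0.
  have e0' : 0 < complex.Re e by rewrite -ltcR RRe_real ?gtr0_real.
  have [N HN] := cu _ e0'; exists (u N); exists N => // n /= Nn.
  rewrite -ball_normE /ball_ /= nrmE -[e]RRe_real ?gtr0_real // ltcR.
  exact: HN.
move=> /cauchy_cvgP /cvg_ex[l ul]; exists l => e e0.
have e0' : 0 < (e%:C%C : C) by rewrite ltcR.
have [N _ HN] := (cvgrPdist_lt _ _).1 ul _ e0'.
exists N => n Nn; have := HN n Nn.
by rewrite /= nrmE ltcR nrmB.
Qed.

End SecondOrder.

(** * Derivatives of holomorphic maps *)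

Section SecondDerivative.
Variable R : realType.
Local Notation C := (CC R).
Variables (V : normedModType C) (W : completeNormedModType C).
Hypothesis WF : normed_by_functionals W.

Lemma diff_locally_bounded (W' : normedModType C) (F : V -> W') x :
  differentiable F x ->
  exists M : R, exists2 d : R, 0 < d & forall y, nrm (y - x) < d -> nrm (F y) <= M.
Proof.
move=> /differentiable_continuous /cvgrPdist_lt Fc.
have [d d0 H] := (nbhs_nrmP _ _).1 (Fc 1 ltr01).
exists (nrm (F x) + 1), d => // y /H /=; rewrite nrmE -(rmorph1 (real_complex R)) ltcR.
move=> Hy; have := nrm_tri (F y) (F x) 0; rewrite !subr0 nrmB; lra.
Qed.

(** Directional derivatives of a holomorphic map are again differentiable along
    complex lines, as locally uniform limits of difference quotients. *)
Lemma holomorphic_derivative (U : set V) (F : V -> W) (x u v : V) :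
  open U -> (forall y, U y -> differentiable F y) -> U x ->
  cderivable (fun z => 'd F (x + z *: u) v) 0.
Proof.
move=> oU FU Ux.
have [d1 d10 H1] := open_nrm oU Ux.
have [M [d2 d20 H2]] := diff_locally_bounded (FU x Ux).
pose d := Num.min d1 d2; have d0 : 0 < d by rewrite lt_min d10.
pose A := nrm u + nrm v + 1.
have A0 : 0 < A by rewrite ltr_wpDl // addr_ge0 ?nrm_ge0.
pose r := d / (16 * A); have r0 : 0 < r by rewrite divr_gt0 ?mulr_gt0.
have small (z w : C) : nrm z < 8 * r -> nrm w < 8 * r ->
    nrm (x + z *: u + w *: v - x) < d.
  move=> zr wr; rewrite addrAC [x + _]addrC addrK.
  apply: le_lt_trans (nrmD _ _) _; rewrite !nrmZ.
  have -> : d = 8 * r * A + 8 * r * A by rewrite /r; field; rewrite gt_eqF.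
  have := nrm_ge0 u; have := nrm_ge0 v; have := nrm_ge0 z; have := nrm_ge0 w.
  rewrite /A; nra.
have inU (z w : C) : nrm z < 8 * r -> nrm w < 8 * r -> U (x + z *: u + w *: v).
  by move=> zr wr; apply: H1; have := small z w zr wr; rewrite lt_min => /andP[].
have FM (z w : C) : nrm z < 8 * r -> nrm w < 8 * r ->
    nrm (F (x + z *: u + w *: v)) <= M.
  by move=> zr wr; apply: H2; have := small z w zr wr; rewrite lt_min => /andP[].
have z8 : nrm (0 : C) < 8 * r by rewrite nrm0 mulr_gt0.
have M0 : 0 <= M by exact: le_trans (nrm_ge0 _) (FM 0 0 z8 z8).
pose G (z : C) := 'd F (x + z *: u) v.
pose K := 8 * M / r ^+ 2.
have K0 : 0 <= K by apply: divr_ge0; [exact: mulr_ge0|exact/exprn_ge0/ltW].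
(* [f w] is the difference quotient of [F] with step [w] in the direction [v];
   [f' w] is its derivative along [u]. *)
pose f (w z : C) : W := w^-1 *: (F (x + z *: u + w *: v) - F (x + z *: u)).
pose f' (w z : C) : W :=
  w^-1 *: ('d F (x + z *: u + w *: v) u - 'd F (x + z *: u) u).
have alongv (z : C) : nrm z < 8 * r -> forall w, nrm w < 8 * r ->
    tangent setT (fun h => F (x + z *: u + (w + h) *: v)) ('d F (x + z *: u + w *: v) v).
  move=> zr w wr; apply: tangent_ext (diff_tangent v (FU _ (inU z w zr wr))) => // h.
  by rewrite scalerDl addrA.
have taylorv (z w : C) : nrm z < 8 * r -> nrm w <= 2 * r ->
    nrm (F (x + z *: u + w *: v) - F (x + z *: u) - w *: G z) <= K * nrm w ^+ 2.
  move=> zr wr.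
  have := taylor_bound WF r0 (alongv z zr) (FM z ^~ zr) wr.
  by rewrite scale0r addr0.
have fG (w z : C) : w != 0 -> nrm z < 8 * r -> nrm w <= 2 * r ->
    nrm (f w z - G z) <= K * nrm w.
  move=> w0 zr wr.
  have -> : f w z - G z = w^-1 *: (F (x + z *: u + w *: v) - F (x + z *: u) - w *: G z).
    by rewrite [RHS]scalerBr scalerA mulVf // scale1r.
  rewrite nrmZ nrmV ler_pdivrMl ?nrm_gt0 // mulrCA -expr2.
  exact: taylorv.
have fder (w z : C) : nrm w < 8 * r -> nrm z < 8 * r ->
    tangent setT (fun h => f w (z + h)) (f' w z).
  move=> wr zr; apply: tangentZ; apply: tangentB => //.
    apply: tangent_ext (diff_tangent u (FU _ (inU z w zr wr))) => // h.
    by rewrite scalerDl addrA [_ + w *: v + _]addrAC.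
  have := inU z 0 zr z8; rewrite scale0r addr0 => Uz.
  apply: tangent_ext (diff_tangent u (FU _ Uz)) => // h.
  by rewrite scalerDl addrA.
have GM z : nrm z < 8 * r -> nrm (G z) <= 2 * M / r.
  move=> zr; have := derivative_bound WF r0 (alongv z zr) (FM z ^~ zr) (z := 0).
  by rewrite scale0r addr0 nrm0; apply; rewrite mulr_gt0.
pose M2 := 2 * M / r + K * (2 * r).
have fM w z : w != 0 -> nrm w <= 2 * r -> nrm z < 8 * r -> nrm (f w z) <= M2.
  move=> w0 wr zr; have := nrm_tri (f w z) (G z) 0; rewrite !subr0.
  move=> H; apply: le_trans H _; rewrite addrC; apply: lerD; first exact: GM.
  by apply: le_trans (fG w z w0 zr wr) _; apply: ler_wpM2l.
pose w n : C := (r / n.+1%:R)%:C%C.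
have wE n : nrm (w n) = r / n.+1%:R by rewrite nrmR ger0_norm // divr_ge0 // ltW.
have w0 n : w n != 0 by rewrite -nrm_gt0 wE divr_gt0.
have wr n : nrm (w n) <= r.
  by rewrite wE ler_pdivrMr // ler_peMr ?(ltW r0) // ler1n.
have wr2 n : nrm (w n) <= 2 * r by have := wr n; lra.
have wr8 n : nrm (w n) < 8 * r by have := wr n; lra.
have wsmall (e : R) : 0 < e -> exists N, forall n, (N <= n)%N -> nrm (w n) < e.
  move=> e0; exists (Num.bound (r / e)) => n Nn.
  rewrite wE ltr_pdivrMr // mulrC -ltr_pdivrMr //.
  apply: lt_le_trans (archi_boundP (divr_ge0 (ltW r0) (ltW e0))) _.
  by rewrite ler_nat ltnW.
pose L n := f' (w n) 0.
(* The quotients converge uniformly, so by Cauchy's estimate their derivatives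
   [L n] at the centre form a Cauchy sequence. *)
have LL m n : nrm (L m - L n) <= K / r * (nrm (w m) + nrm (w n)).
  have r40 : 0 < 4 * r by rewrite mulr_gt0.
  have -> : K / r * (nrm (w m) + nrm (w n)) = 4 * (K * (nrm (w m) + nrm (w n))) / (4 * r).
    by field; rewrite gt_eqF.
  apply: (cauchy_estimate WF (f := fun z => f (w m) z - f (w n) z) r40).
  - move=> z zr; apply: cderivableB; [exists (f' (w m) z)|exists (f' (w n) z)];
      by apply: fder => //; lra.
  - move=> z zr; have zr' : nrm z < 8 * r by lra.
    rewrite mulrDr.
    have -> : f (w m) z - f (w n) z = (f (w m) z - G z) - (f (w n) z - G z).
      by rewrite opprB addrA subrK.
    by apply: le_trans (nrmDB _ _) _; apply: lerD; exact: fG.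
  - by apply: tangentB => //; have := fder _ 0 (wr8 _) z8; [move=> /(_ m)|move=> /(_ n)];
      apply: tangent_ext => // h; rewrite add0r.
have K10 : 0 < K / r + 1 by rewrite ltr_wpDl // divr_ge0 // ltW.
have [|l Ll] := @complete_seq R W L.
  move=> e e0; have [N HN] := wsmall (e / (2 * (K / r + 1))) ltac:(by rewrite divr_gt0 ?mulr_gt0).
  exists N => m n Nm Nn; apply: le_lt_trans (LL m n) _.
  have Hm := HN m Nm; have Hn := HN n Nn.
  apply: (@le_lt_trans _ _ ((K / r + 1) * (nrm (w m) + nrm (w n)))).
    by apply: ler_wpM2r; rewrite ?addr_ge0 ?nrm_ge0 // lerDl.
  rewrite mulrC -ltr_pdivlMr //.
  have -> : e / (K / r + 1) = e / (2 * (K / r + 1)) + e / (2 * (K / r + 1)).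
    by field; rewrite ?gt_eqF // ltr_wpDl // mulr_ge0.
  exact: ltrD.
exists l => e e0.
pose K2 := 8 * M2 / r ^+ 2.
have M20 : 0 <= M2 by exact: le_trans (nrm_ge0 _) (fM _ 0 (w0 0%N) (wr2 0%N) z8).
have K20 : 0 <= K2 by apply: divr_ge0; [exact: mulr_ge0|exact/exprn_ge0/ltW].
have K210 : 0 < K2 + 1 by rewrite ltr_wpDl.
exists (Num.min (2 * r) (e / (K2 + 1))); first by rewrite lt_min mulr_gt0 //= divr_gt0.
move=> h _; rewrite lt_min => /andP[hr he].
have h8 : nrm h < 8 * r by lra.
rewrite !add0r -/(G h) -/(G 0).
apply: (@le_trans _ _ (K2 * nrm h ^+ 2)); last first.
  rewrite expr2 mulrA; apply: ler_wpM2r; first exact: nrm_ge0.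
  move: he; rewrite ltr_pdivlMr // mulrC; have := nrm_ge0 h; lra.
apply/ler_addgt0Pl => eps eps0.
pose c := 2 * K + nrm h + 1.
have c0 : 0 < c by rewrite ltr_wpDl // addr_ge0 ?nrm_ge0 // mulr_ge0.
have [N1 HN1] := wsmall (eps / c) (divr_gt0 eps0 c0).
have [N2 HN2] := Ll (eps / c) (divr_gt0 eps0 c0).
pose n := maxn N1 N2.
have A1 := HN1 n (leq_maxl _ _); have A2 := HN2 n (leq_maxr _ _).
have T : nrm (f (w n) h - f (w n) 0 - h *: L n) <= K2 * nrm h ^+ 2.
  exact: (taylor_bound WF r0 (fun z => fder (w n) z (wr8 n))
    (fun z => fM (w n) z (w0 n) (wr2 n)) (ltW hr)).
have -> : G h - G 0 - h *: l = (f (w n) h - f (w n) 0 - h *: L n)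
    - (f (w n) h - G h) + (f (w n) 0 - G 0) + h *: (L n - l).
  rewrite scalerBr; move: (f (w n) h) (f (w n) 0) (h *: L n) (G h) (G 0) => a b c' a' b'.
  rewrite opprB [a - b - c' + _]addrC !addrA subrK.
  rewrite -[a' - b - c' + b]addrA [- c' + b]addrC addrA subrK.
  by rewrite [a' - c' - b']addrAC -[a' - b' - c' + c']addrA addNr addr0.
apply: le_trans (nrmD _ _) _; rewrite nrmZ.
have := nrmD (f (w n) h - f (w n) 0 - h *: L n - (f (w n) h - G h)) (f (w n) 0 - G 0).
have := nrmDB (f (w n) h - f (w n) 0 - h *: L n) (f (w n) h - G h).
have := fG (w n) h (w0 n) h8 (wr2 n); have := fG (w n) 0 (w0 n) z8 (wr2 n).
have : K * nrm (w n) + K * nrm (w n) + nrm h * nrm (L n - l) <= eps.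
  apply: (@le_trans _ _ (c * (eps / c))); last by rewrite mulrC divfK // gt_eqF.
  have := nrm_ge0 h; have := ltW A1; have := ltW A2; have : 0 < eps / c by rewrite divr_gt0.
  rewrite /c; nra.
lra.
Qed.

End SecondDerivative.

(** * Isolated common zeros *)

Section IsolatedZeros.
Variable R : realType.
Local Notation C := (CC R).
Implicit Types (r s : R).

Lemma nrm_continuous (W : normedModType C) : continuous (@nrm R W).
Proof.
move=> x; apply/cvgrPdist_lt => e e0.
apply/nbhs_nrmP; exists e => // y yx /=.
have := nrm_tri x y 0; have := nrm_tri y x 0; rewrite !subr0 (nrmB x y) => H1 H2.
by apply: le_lt_trans yx; rewrite ler_norml; apply/andP; split; lra.
Qed.

Lemma nrm_coord t (y : 'rV[C]_t) i : nrm (y 0 i) <= nrm y.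
Proof.
apply/ler_addgt0Pl => e e0; rewrite addrC; apply: ltW.
have e0' : 0 < ((nrm y + e)%:C%C : C) by rewrite ltcR ltr_wpDl ?nrm_ge0.
have : ball (0 : 'rV[C]_t) (nrm y + e)%:C%C y.
  by rewrite mx_norm_ball /ball_ /= sub0r normrN (nrmE y) ltcR ltrDl.
move=> [_ /(_ 0 i)]; rewrite -ball_normE /ball_ /= mxE sub0r normrN nrmE ltcR.
by [].
Qed.

Lemma nrm_le_coord t (y : 'rV[C]_t) (e : R) : 0 <= e ->
  (forall i, nrm (y 0 i) <= e) -> nrm y <= e.
Proof.
move=> e0 ye; have [y0|] := eqVneq `|y| 0.
  by rewrite /nrm y0.
move=> /mx_norm_neq0 [[i j]] /=; rewrite (ord1 i) => H.
have -> : nrm y = nrm (y 0 j) by congr complex.Re; exact: H.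
exact: ye.
Qed.

Definition csquare s : set C := (fun xy : R * R => pt xy.1 xy.2) @` (`[-s, s] `*` `[-s, s]).

Lemma compact_csquare s : compact (csquare s).
Proof.
apply: continuous_compact; last by apply: compact_setX; exact: segment_compact.
apply: continuous_subspaceT => -[a b]; apply/cvgrPdist_lt => e e0.
have e0' : 0 < complex.Re e by rewrite -ltcR RRe_real ?gtr0_real.
near=> xy; rewrite -[e]RRe_real ?gtr0_real // nrmE ltcR ptB.
apply: le_lt_trans (nrm_pt _ _) _; rewrite [ltRHS]splitr; apply: ltrD.
  near: xy; have /cvgrPdist_lt : fst x @[x --> (a, b)] --> a by exact: cvg_fst.
  by apply; rewrite divr_gt0.
near: xy; have /cvgrPdist_lt : snd x @[x --> (a, b)] --> b by exact: cvg_snd.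
by apply; rewrite divr_gt0.
Unshelve. all: by end_near. Qed.

(** A bounded closed set lies in a product of closed squares. *)
Lemma compact_nrm_ball t s (A : set 'rV[C]_t) :
  closed A -> (forall y, A y -> nrm y <= s) -> compact A.
Proof.
move=> cA As; apply: (subclosed_compact cA (rV_compact (fun=> @compact_csquare s))).
move=> y /As ys i; have yi : nrm (y 0 i) <= s by exact: le_trans (nrm_coord _ _) ys.
exists (complex.Re (y 0 i), complex.Im (y 0 i)) => /=; last first.
  by rewrite /pt; case: (y 0 i).
by split; rewrite /= in_itv /= -ler_norml; apply: le_trans yi;
  [exact: normRe|exact: normIm].
Qed.

Lemma closed_nrm (t : nat) (D : set R) : closed D ->
  closed ((@nrm R _ : 'rV[C]_t -> R) @^-1` D).
Proof. by move=> cD; apply: preimage_closed => // x _; exact: nrm_continuous. Qed.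

Lemma cvg_sum_real (T : Type) (F : set_system T) (I : Type) (l : seq I)
    (f : I -> T -> R) (a : I -> R) : Filter F ->
  (forall i, f i x @[x --> F] --> a i) ->
  (\sum_(i <- l) f i x) @[x --> F] --> \sum_(i <- l) a i.
Proof.
move=> FF fa; elim: l => [|i l IH].
  by rewrite big_nil; under eq_fun do rewrite big_nil; exact: cvg_cst.
by rewrite big_cons; under eq_fun do rewrite big_cons; apply: cvgD.
Qed.

Lemma row_linear_sum t (D : 'rV[C]_t -> C) :
  (forall a u v, D (a *: u + v) = a * D u + D v) ->
  forall v, D v = \sum_i v 0 i * D (delta_mx 0 i).
Proof.
move=> DL v; have D0 : D 0 = 0.
  by have := DL (-1) 0 0; rewrite scaler0 addr0 mulN1r addNr.
rewrite {1}(row_sum_delta v); elim: (index_enum _) => [|i l IH].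
  by rewrite !big_nil D0.
by rewrite !big_cons DL IH.
Qed.

Lemma sum_sq_eq0 t (g : 'I_t -> C) :
  \sum_i nrm (g i) ^+ 2 = 0 -> forall i, g i = 0.
Proof.
move=> /eqP; rewrite psumr_eq0 => [/allP g0 i|i _]; last first.
  by rewrite exprn_ge0 ?nrm_ge0.
have := g0 i (mem_index_enum i).
by rewrite /= expf_eq0 /= nrm_eq0 => /eqP.
Qed.

(** A row of a square matrix being zero, some direction is killed by all of the
    [t] linear forms. *)
Lemma common_kernel t (D : 'I_t -> 'rV[C]_t -> C) i0 :
  (forall j a u v, D j (a *: u + v) = a * D j u + D j v) ->
  (forall v, D i0 v = 0) -> exists2 v, v != 0 & forall j, D j v = 0.
Proof.
move=> DL Di0; pose A : 'M[C]_t := \matrix_(i, j) D j (delta_mx 0 i).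
have detA : \det A = 0.
  rewrite -det_tr; rewrite (expand_det_row _ i0) big1 // => j _.
  by rewrite !mxE Di0 mul0r.
have : (A \in unitmx) = false by rewrite unitmxE detA unitr0.
rewrite -row_free_unit -kermx_eq0 => /negbT /rowV0Pn[v /sub_kermxP vA v0].
exists v => // j; rewrite (row_linear_sum (DL j)).
move/matrixP/(_ 0 j) : vA; rewrite !mxE => vA; rewrite -[RHS]vA.
by apply: eq_bigr => i _; rewrite !mxE.
Qed.

(** Fewer than [t] holomorphic functions of [t] variables have no isolated
    common zero. Otherwise [|f|^2 - e |y|^2] has, for small [e], an interior
    minimum on a small ball; on a complex line through it in a direction killed
    by the differential of [f], the first term is constant to second order up
    to the real part of a holomorphic function, and the second one decreases. *)
Lemma no_isolated_zero t (f : 'I_t -> 'rV[C]_t -> C)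
    (Df : 'I_t -> 'rV[C]_t -> 'rV[C]_t -> C) (i0 : 'I_t) (rho : R) :
  0 < rho ->
  (forall j y, nrm y < rho -> {for y, continuous (f j)}) ->
  (forall j y v, nrm y < rho -> tangent setT (fun h => f j (y + h *: v)) (Df j y v)) ->
  (forall j y a u v, Df j y (a *: u + v) = a * Df j y u + Df j y v) ->
  (forall y, f i0 y = 0) -> (forall y v, Df i0 y v = 0) ->
  (forall j, f j 0 = 0) ->
  exists y, [/\ y != 0, nrm y < rho & forall j, f j y = 0].
Proof.
move=> rho0 fc fD DL fi0 Di0 f0; apply: contrapT => nex.
pose s := rho / 2; have s0 : 0 < s by rewrite divr_gt0.
have srho (y : 'rV[C]_t) : nrm y <= s -> nrm y < rho by rewrite /s => ?; lra.
pose F (y : 'rV[C]_t) : R := \sum_j nrm (f j y) ^+ 2.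
pose Q (y : 'rV[C]_t) : R := \sum_i nrm (y 0 i) ^+ 2.
have sqcont (y : 'rV[C]_t) (g : 'rV[C]_t -> C) : {for y, continuous g} ->
    nrm (g x) ^+ 2 @[x --> y] --> nrm (g y) ^+ 2.
  move=> gc; have c1 : nrm (g x) @[x --> y] --> nrm (g y).
    by apply: continuous_comp; [exact: gc|exact: nrm_continuous].
  by rewrite expr2; under eq_fun do rewrite expr2; exact: (cvgM c1 c1).
have Fc y : nrm y < rho -> {for y, continuous F}.
  by move=> yr; apply: (@cvg_sum_real _ (nbhs y) _ _ _ _ (nbhs_filter y)) => j; apply: sqcont; exact: fc.
have Qc y : {for y, continuous Q}.
  apply: (@cvg_sum_real _ (nbhs y) _ _ _ _ (nbhs_filter y)) => i; apply: (sqcont _ (fun y : 'rV[C]_t => y 0 i)).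
  exact: coord_continuous.
have F0 y : 0 <= F y by apply: sumr_ge0 => j _; rewrite exprn_ge0 ?nrm_ge0.
pose Sph : set 'rV[C]_t := (@nrm R _) @^-1` [set s].
pose Bal : set 'rV[C]_t := (@nrm R _) @^-1` [set x | x <= s].
have cSph : compact Sph.
  apply: (@compact_nrm_ball _ s); first by apply: closed_nrm; exact: closed_eq.
  by move=> y ->.
have cBal : compact Bal.
  by apply: (@compact_nrm_ball _ s) => //; apply: closed_nrm; exact: closed_le.
have Sph0 : Sph !=set0.
  pose v : 'rV[C]_t := delta_mx 0 i0.
  have v0 : nrm v != 0.
    rewrite nrm_eq0; apply/eqP => /matrixP/(_ 0 i0); rewrite !mxE !eqxx /=.
    exact/eqP/oner_neq0.
  exists ((s / nrm v)%:C%C *: v).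
  rewrite /Sph /= nrmZ nrmR ger0_norm; first by rewrite mulrVK ?unitfE.
  by apply: divr_ge0; [exact: ltW|exact: nrm_ge0].
have [c cS Fmin] : exists2 c, c \in Sph & forall y, y \in Sph -> F c <= F y.
  apply: compact_EVT_min => //; apply: continuous_in_subspaceT => y.
  by rewrite inE => yS; apply: Fc; apply: srho; rewrite yS.
have Fc0 : 0 < F c.
  rewrite lt_def F0 andbT; apply/eqP => Fc00; apply: nex; exists c.
  move: cS; rewrite inE /Sph /= => cS; split.
  - by rewrite -nrm_gt0 cS.
  - by apply: srho; rewrite cS.
  - exact: sum_sq_eq0 Fc00.
(* With this [e], [F] exceeds [e * Q] on the sphere, while [chi 0 = 0]: the minimum
   of [chi] lies inside. *)
pose e := F c / (t%:R * s ^+ 2 + 1).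
have den0 : 0 < t%:R * s ^+ 2 + 1 by rewrite ltr_wpDl // mulr_ge0 ?exprn_ge0 ?(ltW s0).
have e0 : 0 < e by rewrite divr_gt0.
pose chi y := F y - e * Q y.
have [x0 x0B chimin] : exists2 c, c \in Bal & forall y, y \in Bal -> chi c <= chi y.
  apply: compact_EVT_min => //; first by exists 0; rewrite /Bal /= nrm0 ltW.
  apply: continuous_in_subspaceT => y; rewrite inE => yB.
  exact: (cvgB (Fc y (srho y yB)) (cvgM (cvg_cst e) (Qc y))).
have x0s : nrm x0 < s.
  move: (x0B); rewrite inE /Bal /= le_eqVlt => /predU1P[x0S|//].
  have chi0 : chi 0 = 0.
    rewrite /chi /F /Q !big1 ?mulr0 ?subr0 // => i _.
      by rewrite mxE nrm0 expr0n.
    by rewrite f0 nrm0 expr0n.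
  have : chi x0 <= 0.
    by rewrite -chi0; apply: chimin; rewrite inE /Bal /= nrm0 ltW.
  have Fx0 : F c <= F x0 by apply: Fmin; rewrite inE.
  have Qx0 : Q x0 <= t%:R * s ^+ 2.
    rewrite /Q; apply: (@le_trans _ _ (\sum_(i < t) s ^+ 2)).
      apply: ler_sum => i _; rewrite lerXn2r ?nnegrE ?nrm_ge0 ?(ltW s0) //.
      by rewrite -x0S nrm_coord.
    by rewrite sumr_const card_ord mulr_natl.
  have E : F c = e * (t%:R * s ^+ 2) + e.
    by rewrite /e; field; rewrite gt_eqF.
  rewrite /chi; have : e * Q x0 <= e * (t%:R * s ^+ 2) by rewrite ler_pM2l.
  lra.
have [v v0 Dv] := common_kernel (DL ^~ x0) (Di0 x0).
have x0rho : nrm x0 < rho by apply: srho; exact: ltW.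
pose N := Q v.
have N0 : 0 < N.
  rewrite lt_def sumr_ge0 ?andbT; last by move=> i _; rewrite exprn_ge0 ?nrm_ge0.
  apply: contra_neq v0 => Nv; apply/rowP => i; rewrite mxE.
  exact: sum_sq_eq0 Nv i.
have nv0 : 0 < nrm v by rewrite nrm_gt0.
pose phi j (z : C) := f j (x0 + z *: v).
have inball (z : C) (r : R) : 0 < r -> nrm z < r -> r * nrm v <= s - nrm x0 ->
    nrm (x0 + z *: v) < s.
  move=> r0 zr rs; apply: le_lt_trans (nrmD _ _) _; rewrite nrmZ.
  have : nrm z * nrm v < r * nrm v by rewrite ltr_pM2r.
  lra.
have phiD j (z : C) : nrm (x0 + z *: v) < s ->
    tangent setT (fun h => phi j (z + h)) (Df j (x0 + z *: v) v).
  move=> zs; apply: tangent_ext (fD j _ v (srho _ (ltW zs))) => // h.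
  by rewrite /phi scalerDl addrA.
have [K [r [r0 K0 rs phiK]]] : exists K r : R, [/\ 0 < r, 0 <= K,
    8 * r * nrm v <= s - nrm x0 &
    forall j (z : C), nrm z <= 2 * r -> nrm (phi j z - f j x0) <= K * nrm z ^+ 2].
  have [M [d d0 dM]] : exists M : R, exists2 d : R, 0 < d &
      forall j y, nrm (y - x0) < d -> nrm (f j y) <= M.
    have /nbhs_nrmP[d d0 dM] : \forall y \near x0, F y < F x0 + 1.
      by apply: (cvgr_lt _ (Fc x0 x0rho)); rewrite ltrDl.
    exists (F x0 + 2), d => // j y /dM Fy.
    have : nrm (f j y) ^+ 2 <= F y.
      rewrite /F (bigD1 j) //= lerDl; apply: sumr_ge0 => i _.
      by rewrite exprn_ge0 ?nrm_ge0.
    by have := nrm_ge0 (f j y); nra.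
  pose d' := Num.min d (s - nrm x0).
  have d'0 : 0 < d' by rewrite lt_min d0 /= subr_gt0.
  pose r := d' / (8 * nrm v).
  have r0 : 0 < r by rewrite divr_gt0 ?mulr_gt0.
  have r8 : 8 * r * nrm v = d' by rewrite /r; field; rewrite gt_eqF.
  have M0 : 0 <= M.
    apply: le_trans (nrm_ge0 _) (dM i0 x0 _); rewrite subrr nrm0 //.
  exists (8 * M / r ^+ 2), r; split => //.
  - by apply: divr_ge0; [exact: mulr_ge0|exact/exprn_ge0/ltW].
  - by rewrite r8 /d' ge_min lexx orbT.
  move=> j z zr; have zd (w : C) : nrm w < 8 * r ->
      nrm (x0 + w *: v) < s /\ nrm (x0 + w *: v - x0) < d.
    move=> wr; split.
      apply: (inball _ (8 * r)) => //; first by rewrite mulr_gt0.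
      by rewrite r8 /d' ge_min lexx orbT.
    rewrite addrC addKr nrmZ; apply: (@lt_le_trans _ _ d').
      by rewrite -r8 ltr_pM2r.
    by rewrite /d' ge_min lexx.
  have := taylor_bound (@normed_by_functionals_scalar R) r0
    (f := phi j) (f' := fun z => Df j (x0 + z *: v) v) (M := M)
    (fun w wr => phiD j w (zd w wr).1) (fun w wr => dM j _ (zd w wr).2) zr.
  by rewrite {2}/phi scale0r addr0 Dv scaler0 subr0.
pose S := \sum_i v 0 i * (x0 0 i)^*.
(* Up to terms of fourth order in [z], [chi (x0 + z v) - chi x0] is twice the
   increment of [Re psi] minus [e |z|^2 N]. *)
pose psi (z : C) : C := \sum_j (f j x0)^* * phi j z - e%:C%C * z * S.
(* Small enough for the fourth-order terms to be at most a quarter of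
   [e |z|^2 N]. *)
pose rr := Num.min r (Num.min 1 (e * N / (16 * (t%:R * K ^+ 2 + 1)))).
have tK0 : 0 < t%:R * K ^+ 2 + 1 by rewrite ltr_wpDl // mulr_ge0 ?exprn_ge0.
have rr0 : 0 < rr.
  rewrite /rr !lt_min r0 ltr01 /=; apply: divr_gt0; first exact: mulr_gt0.
  by apply: mulr_gt0.
have rrr : rr <= r by rewrite /rr ge_min lexx.
have rr1 : rr <= 1 by rewrite /rr !ge_min lexx orbT.
have rr2 : rr * (16 * (t%:R * K ^+ 2 + 1)) <= e * N.
  by rewrite -ler_pdivlMr ?mulr_gt0 // /rr !ge_min lexx !orbT.
have ins (z : C) : nrm z < 2 * rr -> nrm (x0 + z *: v) < s.
  by move=> zr; apply: (inball _ (8 * r)) => //; [rewrite mulr_gt0|lra].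
have psid (z : C) : nrm z < 2 * rr -> cderivable psi z.
  move=> zr; apply: cderivableB.
    eexists; apply: tangent_sum => // j; apply: tangentZ.
    exact: phiD (ins _ zr).
  apply: cderivableM; last exact: cderivable_cst.
  by apply: cderivableM; [exact: cderivable_cst|exact: cderivable_id].
have psi0 : psi 0 = \sum_j (f j x0)^* * f j x0.
  by rewrite /psi mulr0 mul0r subr0; apply: eq_bigr => j _; rewrite /phi scale0r addr0.
have psiB : forall z : C, nrm z < 2 * rr -> nrm (psi z - psi 0)
    <= \sum_j (nrm (f j x0) * (K * 4)) + e * 2 * nrm S.
  move=> z zr; rewrite psi0 /psi addrAC -sumrB; apply: le_trans (nrmDB _ _) _.
  have z2 : nrm z < 2 by lra.
  apply: lerD.
    elim: (index_enum _) => [|j l IH]; first by rewrite !big_nil nrm0.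
    rewrite !big_cons; apply: le_trans (nrmD _ _) _; apply: lerD IH.
    rewrite -mulrBr nrmM nrmJ; apply: ler_wpM2l; first exact: nrm_ge0.
    apply: le_trans (phiK j z _) _; first lra.
    by apply: ler_wpM2l => //; have := nrm_ge0 z; nra.
  rewrite !nrmM nrmR gtr0_norm //; apply: ler_wpM2r; first exact: nrm_ge0.
  by rewrite ler_pM2l // ltW.
have [|z zr Rez] := exists_Re_le rr0 _ psid psiB (d := e * N * rr ^+ 2 / 16).
  by apply: divr_gt0 => //; apply: mulr_gt0; [exact: mulr_gt0|exact: exprn_gt0].
have /andP[z1 z2] := zr.
have xz := ins z z2.
have : chi x0 <= chi (x0 + z *: v) by apply: chimin; rewrite inE; exact: ltW.
have fE j : nrm (f j (x0 + z *: v)) ^+ 2 = nrm (f j x0) ^+ 2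
   + (2 * (complex.Re ((f j x0)^* * phi j z) - complex.Re ((f j x0)^* * f j x0))
   + nrm (phi j z - f j x0) ^+ 2).
  rewrite /phi !nrm2; case: (f j x0) (f j (x0 + z *: v)) => [a b] [a' b'] /=; ring.
have QE : Q (x0 + z *: v) = Q x0 + 2 * complex.Re (z * S) + nrm z ^+ 2 * N.
  rewrite /Q /N /S mulr_sumr raddf_sum /= !mulr_sumr -!big_split /=.
  apply: eq_bigr => i _; rewrite !mxE !nrm2.
  case: (z) (v 0 i) (x0 0 i) => [a b] [a' b'] [c1 c2] /=; ring.
have FE : F (x0 + z *: v) = F x0
   + (2 * (complex.Re (psi z) - complex.Re (psi 0)) + 2 * e * complex.Re (z * S)
   + \sum_j nrm (phi j z - f j x0) ^+ 2).
  rewrite psi0 /psi /F (eq_bigr _ (fun j _ => fE j)) !big_split /=; congr (_ + (_ + _)).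
  rewrite -mulr_sumr sumrB raddfB /= !raddf_sum /=.
  by case: (z) (S) => [a b] [a' b'] /=; ring.
have err : \sum_j nrm (phi j z - f j x0) ^+ 2 <= t%:R * (K * nrm z ^+ 2) ^+ 2.
  apply: (@le_trans _ _ (\sum_(j < t) (K * nrm z ^+ 2) ^+ 2)).
    apply: ler_sum => j _; rewrite lerXn2r ?nnegrE ?nrm_ge0 ?mulr_ge0 ?exprn_ge0 ?nrm_ge0 //.
    by apply: phiK; lra.
  by rewrite sumr_const card_ord mulr_natl.
rewrite /chi FE QE.
have err2 : t%:R * (K * nrm z ^+ 2) ^+ 2 <= e * N / 4 * nrm z ^+ 2.
  have -> : t%:R * (K * nrm z ^+ 2) ^+ 2 = t%:R * K ^+ 2 * nrm z ^+ 2 * nrm z ^+ 2 by ring.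
  apply: ler_wpM2r; first by rewrite exprn_ge0 ?nrm_ge0.
  have tK : 0 <= t%:R * K ^+ 2 by rewrite mulr_ge0 ?exprn_ge0.
  have zz : nrm z ^+ 2 <= 4 * rr by have := nrm_ge0 z; nra.
  have : t%:R * K ^+ 2 * nrm z ^+ 2 <= t%:R * K ^+ 2 * (4 * rr) by rewrite ler_wpM2l.
  nra.
have zz : rr ^+ 2 <= nrm z ^+ 2 by rewrite lerXn2r ?nnegrE ?nrm_ge0 ?(ltW rr0).
have rrp : 0 < rr ^+ 2 by rewrite exprn_gt0.
have eN : 0 < e * N by rewrite mulr_gt0.
have : e * N * rr ^+ 2 <= e * N * nrm z ^+ 2 by rewrite ler_pM2l.
have : 0 < e * N * rr ^+ 2 by rewrite mulr_gt0.
lra.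
Qed.

End IsolatedZeros.

(** * Directions taken near a common zero *)

Section Directions.
Variable R : realType.
Local Notation C := (CC R).

Lemma continuous_atB (V : normedModType C) (f h : V -> C) w :
  {for w, continuous f} -> {for w, continuous h} ->
  {for w, continuous (fun u => f u - h u)}.
Proof. by move=> fc hc; exact: (continuousB fc hc). Qed.

Lemma continuous_atD (V : normedModType C) (f h : V -> C) w :
  {for w, continuous f} -> {for w, continuous h} ->
  {for w, continuous (fun u => f u + h u)}.
Proof. by move=> fc hc; exact: (continuousD fc hc). Qed.

Lemma continuous_atM (V : normedModType C) (f h : V -> C) w :
  {for w, continuous f} -> {for w, continuous h} ->
  {for w, continuous (fun u => f u * h u)}.
Proof. by move=> fc hc; exact: (continuousM fc hc). Qed.

Lemma nrm_mulmx_bound t m (A : 'M[C]_(t, m)) :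
  exists2 K : R, 0 < K & forall y : 'rV[C]_t, nrm (y *m A) <= K * nrm y.
Proof.
exists (\sum_i nrm (row i A) + 1).
  by rewrite ltr_wpDl // sumr_ge0 // => i _; exact: nrm_ge0.
move=> y; rewrite mulmx_sum_row mulrDl mul1r.
apply: (@le_trans _ _ ((\sum_i nrm (row i A)) * nrm y)); last by rewrite lerDl nrm_ge0.
rewrite mulr_suml; elim: (index_enum _) => [|i l IH].
  by rewrite !big_nil nrm0.
rewrite !big_cons; apply: le_trans (nrmD _ _) _; apply: lerD IH.
by rewrite nrmZ mulrC ler_wpM2l ?nrm_ge0 ?nrm_coord.
Qed.

Variables (m t : nat) (p : 'I_t -> 'rV[C]_m -> C) (g : 'rV[C]_m -> 'rV[C]_t).
Variables (U : set 'rV[C]_m) (w : 'rV[C]_m).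
Hypotheses (oU : open U) (Uw : U w).
Hypothesis pd : forall j u, U u -> differentiable (p j) u.
Hypothesis gd : differentiable g w.
Hypothesis grank : \rank ('J g w) = t.
Hypothesis gw : g w = 0.
Hypothesis pw : forall j, p j w = 0.
Hypothesis pg : forall u, U u -> (forall j, p j u = 0) -> g u = 0.

(** Arbitrarily close to a point where the common zeros of [p] form a
    submanifold of the expected codimension, the vector [p] takes every
    direction. If it avoided the line of [xi], the [t - 1] equations of that
    line would cut out the same zeros, which are isolated on a transversal
    slice of dimension [t]. *)
Lemma direction_attained (xi : 'I_t -> C) i0 (d : R) : xi i0 != 0 -> 0 < d ->
  exists u, [/\ U u, nrm (u - w) < d &
    exists2 l : C, l != 0 & forall j, p j u = l * xi j].
Proof.
move=> xi0 d0.
have /row_fullP[A AJ] : row_full ('J g w) by rewrite /row_full grank.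
have [K K0 KA] := nrm_mulmx_bound A.
have [d1 d10 H1] := open_nrm oU Uw.
have e0 : 0 < (2 * K)^-1 by rewrite invr_gt0 mulr_gt0.
have [d2 d20 H2] := diff_eps gd e0.
pose dd := Num.min d (Num.min d1 d2).
have dd0 : 0 < dd by rewrite !lt_min d0 d10.
(* Along this slice the derivative of [g] at the origin is the identity, so that
   [g] has no other zero nearby. *)
pose s (y : 'rV[C]_t) := w + y *m A.
have near_w (y : 'rV[C]_t) : nrm y < dd / K -> nrm (y *m A) < dd.
  move=> yd; apply: le_lt_trans (KA y) _; by rewrite mulrC -ltr_pdivlMr.
have sU y : nrm y < dd / K -> U (s y).
  move=> /near_w; rewrite !lt_min => /and3P[_ yd1 _]; apply: H1.
  by rewrite /s addrC addKr.
pose f j (y : 'rV[C]_t) : C := xi i0 * p j (s y) - xi j * p i0 (s y).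
have [dp [dpT dpL]] : exists dp : 'I_t -> 'rV[C]_m -> 'rV[C]_m -> C,
    (forall j u v, U u -> tangent setT (fun h => p j (u + h *: v)) (dp j u v)) /\
    (forall j u a v v', dp j u (a *: v + v') = a * dp j u v + dp j u v').
  exists (fun j u v => 'd (p j) u v); split=> [j u v Uu|j u a v v'].
    exact: diff_tangent (pd j Uu).
  exact: (linearP ('d (p j) u)).
pose Df j (y v : 'rV[C]_t) : C :=
  xi i0 * dp j (s y) (v *m A) - xi j * dp i0 (s y) (v *m A).
have sc y : {for y, continuous s}.
  have Fy : Filter (nbhs y) by exact: nbhs_filter.
  apply/cvgrPdist_lt => e e00.
  have e1 : 0 < complex.Re e by rewrite -ltcR RRe_real ?gtr0_real.
  apply/(@nbhs_nrmP R _ (y : 'rV[C]_t)); exists (complex.Re e / K); first by rewrite divr_gt0.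
  move=> z zy; rewrite nrmE -[e]RRe_real ?gtr0_real // ltcR /=.
  rewrite /s opprD addrACA subrr add0r -mulmxBl.
  by apply: le_lt_trans (KA _) _; rewrite mulrC -ltr_pdivlMr // nrmB.
have [|||||||y [y0 yd fy]] := @no_isolated_zero R t f Df i0 (dd / K).
- by rewrite divr_gt0.
- move=> j y yd.
  have pc k : p k (s x) @[x --> y] --> p k (s y).
    apply: continuous_comp; first exact: sc.
    by apply: differentiable_continuous; apply: pd; exact: sU.
  exact: (cvgB (cvgM (cvg_cst _) (pc j)) (cvgM (cvg_cst _) (pc i0))).
- move=> j y v yd; apply: tangentB => //.
    apply: tangentZ; apply: tangent_ext (dpT j _ (v *m A) (sU y yd)) => // h.
    by rewrite /s mulmxDl -scalemxAl addrA.
  apply: tangentZ; apply: tangent_ext (dpT i0 _ (v *m A) (sU y yd)) => // h.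
  by rewrite /s mulmxDl -scalemxAl addrA.
- move=> j y a u v; rewrite /Df mulmxDl -scalemxAl (dpL j) (dpL i0); ring.
- by move=> y; rewrite /f subrr.
- by move=> y v; rewrite /Df subrr.
- by move=> j; rewrite /f /s mul0mx addr0 !pw !mulr0 subrr.
exists (s y); split; first exact: sU.
  by have := near_w y yd; rewrite lt_min /s addrC addKr => /andP[].
have pE j : p j (s y) = p i0 (s y) / xi i0 * xi j.
  by move/eqP: (fy j); rewrite subr_eq0 => /eqP H; apply: (mulfI xi0); rewrite H; field.
exists (p i0 (s y) / xi i0) => //.
rewrite mulf_neq0 ?invr_neq0 //; apply: contraNneq y0 => p0.
have gs : g (s y) = 0 by apply: pg; [exact: sU|move=> j; rewrite pE p0 !mul0r].
have := near_w y yd; rewrite !lt_min => /and3P[_ _ /H2].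
have -> : 'd g w (y *m A) = y.
  by rewrite -[RHS]mulmx1 -AJ mulmxA /jacobian mul_rV_lin1.
rewrite -/(s y) gs gw subrr sub0r nrmN => Hy.
rewrite -nrm_eq0 eq_le nrm_ge0 andbT.
have := KA y; have := nrm_ge0 y.
have : (2 * K)^-1 * nrm (y *m A) <= (2 * K)^-1 * (K * nrm y) by rewrite ler_pM2l.
have -> : (2 * K)^-1 * (K * nrm y) = nrm y / 2 by field; rewrite gt_eqF.
by lra.
Qed.

(** The points where [p] has the direction [xi] accumulate at [w]. *)
Lemma limit_along_direction (G : 'rV[C]_m -> C) (xi : 'I_t -> C) i0 :
  xi i0 != 0 -> {for w, continuous G} ->
  (forall u (l : C), U u -> l != 0 -> (forall j, p j u = l * xi j) -> G u = 0) ->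
  G w = 0.
Proof.
move=> xi0 Gc G0; apply/eqP; rewrite -nrm_eq0 eq_le nrm_ge0 andbT leNgt.
apply/negP => Gw.
have e0 : 0 < ((nrm (G w))%:C%C : C) by rewrite ltcR.
have [d d0 H] := (nbhs_nrmP _ _).1 ((cvgrPdist_lt _ _).1 Gc _ e0).
have [u [Uu ud [l l0 pu]]] := direction_attained xi0 d0.
by have := H u ud; rewrite /= (G0 u l Uu l0 pu) subr0 nrmE ltxx.
Qed.

Section Coefficients.
Variable b : 'I_t -> 'I_t -> 'rV[C]_m -> C.
Hypothesis bc : forall j l, {for w, continuous (b j l)}.
Let h j u := \sum_l b j l u * p l u.

Lemma coordinate_direction i u (l : C) : (forall j, p j u = l * (j == i)%:R) ->
  forall j, h j u = l * b j i u.
Proof.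
move=> pu j; rewrite /h (bigD1 i) //= big1 => [|k ki].
  by rewrite pu eqxx addr0 mulr1 mulrC.
by rewrite pu (negPf ki) !mulr0.
Qed.

(** Where [p] is proportional to the [i]-th unit vector, the equation says that the
    [i]-th column of [b] is that vector. *)
Lemma coefficients_identity : (forall u j, U u -> h j u = p j u) ->
  forall j l, b j l w = (j == l)%:R.
Proof.
move=> hp j i; apply/eqP; rewrite -subr_eq0; apply/eqP.
apply: (limit_along_direction (G := fun u => b j i u - (j == i)%:R)
  (xi := fun k => (k == i)%:R) (i0 := i)).
- by rewrite eqxx oner_neq0.
- apply: continuous_atB; [exact: bc|exact: cst_continuous].
move=> u l Uu l0 pu; have := hp u j Uu.
rewrite (coordinate_direction pu) pu => /(mulfI l0) ->; exact: subrr.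
Qed.

(** The hypothesis says that the matrix [b] maps [p] to a multiple of itself. For
    [p] proportional to unit vectors this makes the limit diagonal, and for sums of
    two unit vectors it makes the diagonal entries equal. *)
Lemma coefficients_scalar :
  (forall u i j, U u -> p i u * h j u = p j u * h i u) ->
  forall j l i0, b j l w = b i0 i0 w * (j == l)%:R.
Proof.
move=> hp.
have off i j : i != j -> b j i w = 0.
  move=> ij; apply: (limit_along_direction (G := b j i)
    (xi := fun k => (k == i)%:R) (i0 := i)) => //; first by rewrite eqxx oner_neq0.
  move=> u l Uu l0 pu; have := hp u i j Uu.
  rewrite !(coordinate_direction pu) !pu eqxx eq_sym (negPf ij) mulr0 mul0r mulr1.
  by move=> /eqP; rewrite !mulf_eq0 (negPf l0) /= => /eqP.
have diag i j : b j j w = b i i w.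
  have [->//|ij] := eqVneq i j; apply/eqP; rewrite -subr_eq0; apply/eqP.
  have : b j i w + b j j w - (b i i w + b i j w) = 0.
    apply: (limit_along_direction
      (G := fun u => b j i u + b j j u - (b i i u + b i j u))
      (xi := fun k => ((k == i) || (k == j))%:R) (i0 := i)).
    - by rewrite eqxx oner_neq0.
    - by apply: continuous_atB; apply: continuous_atD; exact: bc.
    move=> u l Uu l0 pu.
    have hE k : h k u = l * (b k i u + b k j u).
      rewrite /h (bigD1 i) //= (bigD1 j) 1?eq_sym //= big1 => [|k' /andP[ki kj]].
        by rewrite !pu !eqxx orbT addr0 /=; ring.
      by rewrite pu (negPf ki) (negPf kj) !mulr0.
    have := hp u i j Uu; rewrite !hE !pu !eqxx orbT /= mulr1 => /(mulfI l0) /(mulfI l0) ->.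
    by rewrite subrr.
  by rewrite off // (off j i) 1?eq_sym // add0r addr0.
move=> j l i0; have [->|jl] := eqVneq j l; first by rewrite mulr1; exact: diag.
by rewrite mulr0 off // eq_sym.
Qed.

End Coefficients.
End Directions.

(** * Homogeneous generators *)

Section Homogeneous.
Variables (R : realType) (m d : nat).
Local Notation C := (CC R).

(** The other monomials of [a] contribute in higher degrees only. *)
Lemma homogeneous_part (a p : cpoly R m) : homogeneous d p ->
  mpoly.pihomog (@mpoly.mdeg m) d (a * p) = mpoly.mcoeff (@mpoly.mnm0 m) a *: p.
Proof.
move=> hp; elim/mpoly.mpolyind : a => [|c n a _ _ IH].
  by rewrite mul0r mpoly.pihomog0 mpoly.mcoeff0 scale0r.
rewrite mulrDl -scalerAl mpoly.pihomog_is_linear IH mpoly.mcoeffD scalerDl.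
congr (_ + _); rewrite mpoly.mcoeffZ mpoly.mcoeffX -scalerA; congr (_ *: _).
have [->|n0] := eqVneq n (@mpoly.mnm0 m).
  by rewrite mpoly.mpolyX0 mul1r mpoly.pihomog_dE // scale1r.
rewrite scale0r (mpoly.pihomog_ne0 (d := (mpoly.mdeg n + d)%N)) //.
  by rewrite -[X in _ != X]add0n eqn_add2r mpoly.mdeg_eq0.
by apply: mpoly.dhomogM hp; rewrite mpoly.dhomogX.
Qed.

(** Comparing homogeneous parts of degree [d] in an expression by generators
    leaves only the constant terms of the coefficients. *)
Lemma homogeneous_generators t (p q : 'I_t -> cpoly R m) :
  (forall j, homogeneous d (p j)) -> (forall j, homogeneous d (q j)) ->
  (forall j, ideal_gen p (q j)) ->
  exists A : 'M[C]_t, forall k, q k = \sum_l A k l *: p l.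
Proof.
move=> hp hq qp; have [a aE] := choice qp.
exists (\matrix_(k, l) mpoly.mcoeff (@mpoly.mnm0 m) (a k l)) => k.
rewrite -(mpoly.pihomog_dE (hq k)) [in LHS](aE k).
rewrite raddf_sum; apply: eq_bigr => l _; rewrite mxE.
exact: homogeneous_part.
Qed.

End Homogeneous.

(** * Inner product and multiplication by polynomials *)

Lemma conjvK (R : realType) d (x : 'rV[CC R]_d) : conjv (conjv x) = x.
Proof. by apply/rowP => i; rewrite !mxE conjCK. Qed.

Lemma nrm_conjvB (R : realType) d (x y : 'rV[CC R]_d) :
  nrm (conjv x - conjv y) <= nrm (x - y).
Proof.
apply: nrm_le_coord => [|i]; first exact: nrm_ge0.
rewrite !mxE -rmorphB nrmJ; apply: le_trans (nrm_coord (x - y) i).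
by rewrite !mxE.
Qed.

Lemma continuous_atP (R : realType) (V W : normedModType (CC R)) (f : V -> W) x :
  {for x, continuous f} <-> (forall e : R, 0 < e -> exists2 d : R, 0 < d &
    forall y, nrm (y - x) < d -> nrm (f y - f x) < e).
Proof.
split=> [/cvgrPdist_lt fc e e0|fc].
  have e0' : 0 < (e%:C%C : CC R) by rewrite ltcR.
  have [d d0 H] := (nbhs_nrmP _ _).1 (fc _ e0').
  by exists d => // y /H; rewrite nrmB nrmE ltcR.
apply/cvgrPdist_lt => e e0.
have e1 : 0 < complex.Re e by rewrite -ltcR RRe_real ?gtr0_real.
have [d d0 H] := fc _ e1; apply/nbhs_nrmP; exists d => // y /H.
by rewrite nrmB nrmE -[e]RRe_real ?gtr0_real // ltcR.
Qed.

Section InnerProduct.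
Variables (R : realType) (m : nat) (Om : set 'rV[CC R]_m).
Variable H : analytic_hilbert_module Om.
Local Notation C := (CC R).
Local Notation dot := (ahm_dot H).

Lemma dotPl a (u v w : H) : dot (a *: u + v) w = a * dot u w + dot v w.
Proof. exact: (linearPl dot). Qed.

Lemma dotPr a (u v w : H) : dot w (a *: u + v) = a^* * dot w u + dot w v.
Proof. exact: (linearPr dot). Qed.

Lemma dotC (u v : H) : dot u v = (dot v u)^*.
Proof. by have := hermC dot u v; rewrite expr0 mul1r. Qed.

Lemma dot0l (w : H) : dot 0 w = 0.
Proof. exact: (linear0l dot). Qed.

Lemma dot0r (w : H) : dot w 0 = 0.
Proof. exact: (linear0r dot). Qed.

Lemma dotZl a (u w : H) : dot (a *: u) w = a * dot u w.
Proof. by rewrite -[a *: u]addr0 dotPl dot0l addr0. Qed.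

Lemma dotZr a (u w : H) : dot w (a *: u) = a^* * dot w u.
Proof. by rewrite -[a *: u]addr0 dotPr dot0r addr0. Qed.

Lemma dotBl (u v w : H) : dot (u - v) w = dot u w - dot v w.
Proof. exact: (linearBl dot). Qed.

Lemma dotBr (u v w : H) : dot w (u - v) = dot w u - dot w v.
Proof. exact: (linearBr dot). Qed.

Lemma dot_suml t (a : 'I_t -> C) (v : 'I_t -> H) w :
  dot (\sum_i a i *: v i) w = \sum_i a i * dot (v i) w.
Proof.
elim: (index_enum _) => [|i l IH]; first by rewrite !big_nil dot0l.
by rewrite !big_cons dotPl IH.
Qed.

Lemma dot_sumr t (a : 'I_t -> C) (v : 'I_t -> H) w :
  dot w (\sum_i a i *: v i) = \sum_i (a i)^* * dot w (v i).
Proof.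
elim: (index_enum _) => [|i l IH]; first by rewrite !big_nil dot0r.
by rewrite !big_cons dotPr IH.
Qed.

Lemma dotnn (f : H) : dot f f = (nrm f ^+ 2)%:C%C.
Proof. by rewrite -ahm_normE nrmE rmorphXn. Qed.

Lemma dot_eq0 (f : H) : dot f f = 0 -> f = 0.
Proof.
rewrite dotnn => -[] /eqP; rewrite expf_eq0 /= nrm_eq0 => /eqP; exact.
Qed.

Lemma cauchy_schwarz (f g : H) : nrm (dot f g) <= nrm f * nrm g.
Proof.
have [->|g0] := eqVneq g 0; first by rewrite dot0r !nrm0 mulr0.
have n0 : 0 < nrm g by rewrite nrm_gt0.
have n0' : (nrm g ^+ 2)%:C%C != 0 :> C.
  by rewrite (inj_eq (@complexI R)) expf_neq0 // gt_eqF.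
pose c := dot f g / (nrm g ^+ 2)%:C%C.
have cJ : c^* = (dot f g)^* / (nrm g ^+ 2)%:C%C.
  by rewrite /c rmorphM fmorphV; congr (_ / _); exact: conjc_real.
have : dot (f - c *: g) (f - c *: g)
    = (nrm f ^+ 2)%:C%C - dot f g * (dot f g)^* / (nrm g ^+ 2)%:C%C.
  rewrite dotBl !dotBr !dotZl !dotZr (dotC g f) !dotnn cJ /c.
  move: (dot f g) (nrm f ^+ 2)%:C%C (nrm g ^+ 2)%:C%C n0' => x F G G0.
  by field.
rewrite dotnn mulJ_nrm -fmorph_div -rmorphB => /complexI E.
have : 0 <= nrm f ^+ 2 - nrm (dot f g) ^+ 2 / nrm g ^+ 2.
  by rewrite -E exprn_ge0 ?nrm_ge0.
rewrite subr_ge0 ler_pdivrMr ?exprn_gt0 // -exprMn.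
by rewrite ler_pXn2r ?nnegrE ?mulr_ge0 ?nrm_ge0.
Qed.

Lemma module_normed_by_functionals : normed_by_functionals H.
Proof.
move=> w; have [->|w0] := eqVneq w 0.
  by exists (fun=> 0); split => [a x y|x|]; rewrite ?mulr0 ?addr0 ?nrm0 ?nrm_ge0.
have n0 : 0 < nrm w by rewrite nrm_gt0.
have n0' : (nrm w)%:C%C != 0 :> C by rewrite (inj_eq (@complexI R)) gt_eqF.
exists (fun v => dot v w / (nrm w)%:C%C); split => [a x y|x|].
- by rewrite dotPl mulrDl mulrA.
- rewrite nrmM nrmV nrmR gtr0_norm // ler_pdivrMr //; exact: cauchy_schwarz.
- by rewrite dotnn rmorphXn /= expr2 mulfK.
Qed.

Lemma closure_orthogonal (S : set H) (e x : H) :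
  (forall y, S y -> dot y e = 0) -> closure S x -> dot x e = 0.
Proof.
move=> Se Sx; apply/eqP; rewrite -nrm_eq0 eq_le nrm_ge0 andbT.
apply/ler_addgt0Pl => r r0; rewrite addr0.
have e0 : 0 < nrm e + 1 by rewrite ltr_wpDl ?nrm_ge0.
have [|y [Sy yx]] := Sx [set y | nrm (y - x) < r / (nrm e + 1)].
  by apply/nbhs_nrmP; exists (r / (nrm e + 1)) => //; rewrite divr_gt0.
have -> : dot x e = dot (x - y) e by rewrite dotBl (Se y Sy) subr0.
apply: le_trans (cauchy_schwarz _ _) _; rewrite nrmB.
have := nrm_ge0 e; have := nrm_ge0 (y - x); move: yx; rewrite /= ltr_pdivlMr //.
nra.
Qed.

Lemma continuous_dot_antiholomorphic (U : set 'rV[C]_m) (G : 'rV[C]_m -> H) h w :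
  open U -> U w -> antiholomorphic_on U G ->
  {for w, continuous (fun u => dot h (G u))}.
Proof.
move=> oU Uw aG.
have Gc : {for conjv w, continuous (G \o @conjv R m)}.
  by apply: differentiable_continuous; apply: aG; rewrite /= conjvK.
apply/continuous_atP => e e0.
have h0 : 0 < nrm h + 1 by rewrite ltr_wpDl ?nrm_ge0.
have [d d0 dG] := (continuous_atP _ _).1 Gc _ (divr_gt0 e0 h0).
exists d => // u ud.
have := dG (conjv u) (le_lt_trans (nrm_conjvB _ _) ud).
rewrite /= !conjvK ltr_pdivlMr // => Hu.
rewrite -dotBr; apply: le_lt_trans (cauchy_schwarz _ _) _; apply: le_lt_trans Hu.
by rewrite mulrC ler_wpM2l ?nrm_ge0 // lerDl.
Qed.

(** A row killed by the Gram matrix is a combination of the vectors of norm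
    zero. *)
Lemma gram_unit t (v : 'I_t -> H) :
  (forall a : 'I_t -> C, \sum_(j < t) a j *: v j = 0 -> forall j, a j = 0) ->
  (\matrix_(i, j) dot (v j) (v i)) \in unitmx.
Proof.
move=> free; set N := (X in X \in unitmx); rewrite -row_free_unit -kermx_eq0.
apply/negP => /negP /rowV0Pn[u /sub_kermxP uN].
apply/negP; rewrite negbK; apply/eqP/rowP => i; rewrite mxE.
pose s := \sum_j (u 0 j)^* *: v j.
have s0 : s = 0.
  apply: dot_eq0; rewrite {1}/s dot_suml big1 // => j _.
  rewrite /s dot_sumr (_ : \sum_i _ = 0) ?mulr0 //.
  move/matrixP/(_ 0 j): uN; rewrite !mxE => uN; rewrite -[RHS]uN.
  by apply: eq_bigr => k _; rewrite !mxE conjCK.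
by have := free _ s0 i => /eqP; rewrite conjC_eq0 => /eqP.
Qed.

End InnerProduct.

Section ModuleOperations.
Variables (R : realType) (m : nat) (Om : set 'rV[CC R]_m).
Variable H : analytic_hilbert_module Om.
Local Notation C := (CC R).
Local Notation dot := (ahm_dot H).

Lemma fun0 z : Om z -> ahm_fun (0 : H) z = 0.
Proof.
move=> Oz; have := ahm_fun_linear (-1) (0 : H) 0 Oz.
by rewrite scaler0 addr0 mulN1r addNr.
Qed.

Lemma polyM a b : ahm_mul a (ahm_poly H b) = ahm_poly H (a * b).
Proof.
apply: ahm_fun_inj => z Oz; rewrite ahm_mulE // !ahm_polyE //.
by rewrite /peval mpoly.mevalM.
Qed.

Lemma poly_sum t (c : 'I_t -> C) (p : 'I_t -> cpoly R m) :
  ahm_poly H (\sum_l c l *: p l) = \sum_l c l *: ahm_poly H (p l).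
Proof.
elim: (index_enum _) => [|i l IH].
  rewrite !big_nil; apply: ahm_fun_inj => z Oz.
  by rewrite ahm_polyE // fun0 // /peval mpoly.meval0.
rewrite !big_cons -IH; apply: ahm_fun_inj => z Oz.
rewrite ahm_fun_linear // !ahm_polyE //.
by rewrite /peval mpoly.mevalD mpoly.mevalZ.
Qed.

Lemma mul_comp a b (f : H) : ahm_mul (a * b) f = ahm_mul a (ahm_mul b f).
Proof.
apply: ahm_fun_inj => z Oz; rewrite !ahm_mulE //.
by rewrite /peval mpoly.mevalM mulrA.
Qed.

Lemma mulP c a b (f : H) : ahm_mul (c *: a + b) f = c *: ahm_mul a f + ahm_mul b f.
Proof.
apply: ahm_fun_inj => z Oz; rewrite ahm_fun_linear // !ahm_mulE //.
by rewrite /peval mpoly.mevalD mpoly.mevalZ mulrDl mulrA.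
Qed.

Lemma mul1 (f : H) : ahm_mul 1 f = f.
Proof.
by apply: ahm_fun_inj => z Oz; rewrite ahm_mulE // /peval mpoly.meval1 mul1r.
Qed.

Lemma mul0 (f : H) : ahm_mul 0 f = 0.
Proof.
by apply: ahm_fun_inj => z Oz; rewrite ahm_mulE // fun0 // /peval mpoly.meval0 mul0r.
Qed.

(** Vectors of the fibre over [w] turn multiplication by a polynomial into
    multiplication by its value at [w]. *)
Lemma joint_kernel_eigen (M S : set H) w F :
  S `<=` M -> (forall a g, S g -> S (ahm_mul a g)) -> joint_kernel M w F ->
  forall a g, S g -> dot (ahm_mul a g) F = peval a w * dot g F.
Proof.
move=> SM Smul [_ Fk].
have X i g : S g -> dot (ahm_mul (mpoly.mpolyX C (mpoly.mnm1 i)) g) F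
    = w 0 i * dot g F.
  move=> Sg; have [_ _ /(_ g (SM g Sg))] := Fk i.
  by rewrite dotBl dotZl dot0r => /eqP; rewrite subr_eq0 => /eqP.
pose P a := forall g, S g -> dot (ahm_mul a g) F = peval a w * dot g F.
have P1 : P 1 by move=> g _; rewrite mul1 /peval mpoly.meval1 mul1r.
have PM a b : P a -> P b -> P (a * b).
  move=> Pa Pb g Sg; rewrite mul_comp Pa; last exact: Smul.
  by rewrite Pb // /peval mpoly.mevalM mulrA.
have PX i : P (mpoly.mpolyX C (mpoly.mnm1 i)).
  by move=> g Sg; rewrite X // /peval mpoly.mevalXU.
have PXn i n : P (mpoly.mpolyX C (mpoly.mnm1 i) ^+ n).
  by elim: n => [|n IH]; [rewrite expr0|rewrite exprS; exact: PM].
elim/mpoly.mpolyind => [|c n a _ _ IH] g Sg.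
  by rewrite mul0 dot0l /peval mpoly.meval0 mul0r.
have Pn : P (mpoly.mpolyX C n).
  by rewrite mpoly.mpolyXE_id; apply: big_ind => // i _; exact: PXn.
rewrite mulP dotPl IH // (Pn g Sg).
by rewrite /peval mpoly.mevalD mpoly.mevalZ mulrDl mulrA.
Qed.

End ModuleOperations.

(** * The canonical frame as a dual basis *)

Lemma continuous_at_sum (R : realType) (V : normedModType (CC R)) (I : Type)
    (r : seq I) (f : I -> V -> CC R) w :
  (forall i, {for w, continuous (f i)}) ->
  {for w, continuous (fun u => \sum_(i <- r) f i u)}.
Proof.
move=> fc; elim: r => [|i r IH].
  have -> : (fun u => \sum_(i <- [::]) f i u) = cst 0.
    by apply/funext => u; rewrite big_nil.
  exact: cst_continuous.
have -> : (fun u => \sum_(j <- i :: r) f j u) = (fun u => f i u + \sum_(j <- r) f j u).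
  by apply/funext => u; rewrite big_cons.
exact: (@continuous_atD R V (f i) (fun u => \sum_(j <- r) f j u) w (fc i) IH).
Qed.

Section Frames.
Variables (R : realType) (m t : nat) (Om : set 'rV[CC R]_m).
Local Notation C := (CC R).
Variable I : set (cpoly R m).

(** Pair [h] with the local decomposition of the reproducing kernel. *)
Lemma frame_expansion (H : analytic_hilbert_module Om) (M : set H)
    (p : 'I_t -> cpoly R m) F w : canonical_frame M p F -> zero_set M w ->
  exists (U : set 'rV[C]_m) (G : 'I_t -> 'rV[C]_m -> H),
    [/\ open U, U w & U `<=` Om] /\
    [/\ forall j, antiholomorphic_on U (G j), forall j, G j w = F j w &
      forall h u, M h -> U u ->
        ahm_fun h u = \sum_k ahm_dot H h (G k u) * peval (p k) u].
Proof.
move=> [_ _ _ [K KM Kloc]] Vw; have [U [G [[oU Uw UOm] [aG GM GF GK]]]] := Kloc w Vw.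
exists U, G; split=> //; split=> // [j|h u Mh Uu]; first exact: GF.
have [_ ->] // := KM u (UOm _ Uu).
rewrite GK // dot_sumr; apply: eq_bigr => k _.
by rewrite conjCK mulrC.
Qed.

Lemma poly_in_closure (H : analytic_hilbert_module Om) f : I f ->
  ideal_closure H I (ahm_poly H f).
Proof. by move=> If; apply: subset_closure; exists f. Qed.

Hypothesis hSub : submanifold_codim t Om (ideal_zeros Om I).
Variable p : 'I_t -> cpoly R m.
Hypothesis hIp : I = ideal_gen p.

Lemma generator_in j : I (p j).
Proof.
rewrite hIp; exists (fun k => (k == j)%:R); rewrite (bigD1 j) //= eqxx mul1r.
by rewrite big1 ?addr0 // => k /negPf ->; rewrite mul0r.
Qed.

Lemma ideal_mul a f : I f -> I (a * f).
Proof.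
rewrite hIp => -[b ->]; exists (fun k => a * b k).
by rewrite mulr_sumr; apply: eq_bigr => k _; rewrite mulrA.
Qed.

Variable H : analytic_hilbert_module Om.

(** The generators, seen as functions, satisfy around any of their common zeros
    the conditions under which they take all directions. *)
Lemma generators_local w (U : set 'rV[C]_m) : ideal_zeros Om I w -> open U -> U w ->
  exists (U' : set 'rV[C]_m) (g : 'rV[C]_m -> 'rV[C]_t),
  [/\ open U', U' w, U' `<=` U & U' `<=` Om] /\
  [/\ forall j u, U' u -> differentiable (ahm_fun (ahm_poly H (p j))) u,
      differentiable g w, \rank ('J g w) = t & g w = 0] /\
  ((forall j, ahm_fun (ahm_poly H (p j)) w = 0) /\
   forall u, U' u -> (forall j, ahm_fun (ahm_poly H (p j)) u = 0) -> g u = 0).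
Proof.
move=> Vw oU Uw; have [_ /(_ w Vw)[U1 [g [[oU1 U1w U1Om] [gh VU1 grk]]]]] := hSub.
exists (U `&` U1), g; split.
  split; [exact: openI|by []|by move=> u []|by move=> u [_ /U1Om]].
split.
  split => [j u [_ U1u]|||].
  - exact/ahm_fun_hol/U1Om.
  - exact: gh.
  - exact: grk.
  - by have : (ideal_zeros Om I `&` U1) w by []; rewrite VU1 => -[].
split=> [j|u [_ U1u] pu].
  have [Ow V0] := Vw; rewrite ahm_polyE //.
  by apply: V0; exact: generator_in.
have : (ideal_zeros Om I `&` U1) u; last by rewrite VU1 => -[].
split=> //; split; first exact: U1Om.
rewrite hIp => f [a ->]; rewrite /peval raddf_sum /= big1 // => j _.
have := pu j; rewrite ahm_polyE; last exact: U1Om.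
by rewrite /peval mpoly.mevalM => ->; rewrite mulr0.
Qed.

(** Near [w] the function [p j] is the combination of the [p l] with coefficients
    [<p j, G l u>]. As [p] takes all directions near [w], these agree at [w] with
    the coefficients of the trivial expansion. *)
Lemma frame_dual F w : canonical_frame (ideal_closure H I) p F ->
  zero_set (ideal_closure H I) = ideal_zeros Om I -> ideal_zeros Om I w ->
  forall j l, ahm_dot H (ahm_poly H (p j)) (F l w) = (j == l)%:R.
Proof.
move=> hF hV Vw j l; have Zw := Vw; rewrite -hV in Zw.
have [U [G [[oU Uw UOm] [aG GF Gexp]]]] := frame_expansion hF Zw.
have [U' [g [[oU' U'w U'U U'Om] [[pd gd grk gw] [pw pg]]]]] :=
  generators_local Vw oU Uw.
rewrite -GF.
apply: (coefficients_identity oU' U'w pd gd grk gw pw pg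
  (b := fun j l u => ahm_dot H (ahm_poly H (p j)) (G l u))).
  by move=> j' l'; exact: continuous_dot_antiholomorphic oU Uw (aG l').
move=> u k U'u; rewrite [RHS]Gexp; last 2 first.
- exact/poly_in_closure/generator_in.
- exact: U'U.
by apply: eq_bigr => i _; rewrite ahm_polyE //; exact: U'Om.
Qed.

End Frames.

(** * Transport of the frame by a unitary equivalence *)

Section Transfer.
Variables (R : realType) (m t : nat) (Om : set 'rV[CC R]_m).
Local Notation C := (CC R).
Variables (I : set (cpoly R m)) (p q : 'I_t -> cpoly R m).
Variables (H H' : analytic_hilbert_module Om).
Variables (Fp : 'I_t -> 'rV[CC R]_m -> H) (Fq : 'I_t -> 'rV[CC R]_m -> H').
Hypotheses (hIp : I = ideal_gen p) (hIq : I = ideal_gen q).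
Hypothesis hV : zero_set (ideal_closure H I) = ideal_zeros Om I.
Hypothesis hV' : zero_set (ideal_closure H' I) = ideal_zeros Om I.
Hypothesis hSub : submanifold_codim t Om (ideal_zeros Om I).
Hypothesis hFp : canonical_frame (ideal_closure H I) p Fp.
Hypothesis hFq : canonical_frame (ideal_closure H' I) q Fq.
Variable L : H -> H'.
Hypothesis Lim : L @` ideal_closure H I = ideal_closure H' I.
Hypothesis Liso : forall f g, ideal_closure H I f -> ideal_closure H I g ->
  ahm_dot H' (L f) (L g) = ahm_dot H f g.
Hypothesis Lmul : forall a f, ideal_closure H I f ->
  L (ahm_mul a f) = ahm_mul a (L f).
Variables (A B : 'M[C]_t).
Hypothesis qA : forall k, q k = \sum_l A k l *: p l.
Hypothesis pB : forall k, p k = \sum_l B k l *: q l.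

(** Near a zero, [L (p j)] is a combination of the generators; its coefficient
    matrix at the zero is scalar by [frames_intertwined], and this is the diagonal
    entry of index [i0]. *)
Definition multiplier (i0 : 'I_t) (w : 'rV[C]_m) : C :=
  \sum_k A k i0 * ahm_dot H' (L (ahm_poly H (p i0))) (Fq k w).

Let h j := L (ahm_poly H (p j)).

Lemma image_in f : I f -> ideal_closure H' I (L (ahm_poly H f)).
Proof. by move=> If; rewrite -Lim; exists (ahm_poly H f) => //; exact: poly_in_closure. Qed.

Lemma image_mul a f : I f -> L (ahm_poly H (a * f)) = ahm_mul a (L (ahm_poly H f)).
Proof. by move=> If; rewrite -polyM Lmul //; exact: poly_in_closure. Qed.

(** Both sides are values of [L (p i * p j)]. *)
Lemma generators_intertwined i j u : Om u ->
  peval (p i) u * ahm_fun (h j) u = peval (p j) u * ahm_fun (h i) u.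
Proof.
move=> Ou; rewrite -!ahm_mulE // -!image_mul ?[p j * _]mulrC //;
  exact: generator_in hIp _.
Qed.

(** The expansion of [L (p j)] in terms of [q] becomes one in terms of [p] by
    [q = A p], to which the relations above apply. *)
Lemma frames_intertwined i0 w : ideal_zeros Om I w -> forall j l,
  \sum_k A k l * ahm_dot H' (h j) (Fq k w) = multiplier i0 w * (j == l)%:R.
Proof.
move=> Vw j l; have Zw := Vw; rewrite -hV' in Zw.
have [U [G [[oU Uw UOm] [aG GF Gexp]]]] := frame_expansion hFq Zw.
have [U' [g [[oU' U'w U'U U'Om] [[pd gd grk gw] [pw pg]]]]] :=
  generators_local hSub hIp H Vw oU Uw.
pose b j l u := \sum_k A k l * ahm_dot H' (h j) (G k u).
have bw j' l' : b j' l' w = \sum_k A k l' * ahm_dot H' (h j') (Fq k w).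
  by apply: eq_bigr => k _; rewrite GF.
rewrite -bw /multiplier -[\sum_k _]bw.
apply: (coefficients_scalar oU' U'w pd gd grk gw pw pg (b := b)).
  move=> j' l'; apply: continuous_at_sum => k.
  apply: continuous_atM; first exact: cst_continuous.
  exact: continuous_dot_antiholomorphic oU Uw (aG k).
have hE u j' : U' u -> \sum_l b j' l u * ahm_fun (ahm_poly H (p l)) u = ahm_fun (h j') u.
  move=> U'u; rewrite Gexp; last 2 first.
  - exact/image_in/(generator_in hIp).
  - exact: U'U.
  rewrite (eq_bigr (fun i => \sum_k A k i * ahm_dot H' (h j') (G k u) * peval (p i) u));
    last first.
    by move=> i _; rewrite (ahm_polyE _ _ (U'Om _ U'u)) /b mulr_suml.
  rewrite exchange_big /=; apply: eq_bigr => k _.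
  rewrite qA /peval raddf_sum /= mulr_sumr; apply: eq_bigr => i _.
  by rewrite mpoly.mevalZ /peval mulrA [A k i * _]mulrC.
move=> u i j' U'u; rewrite !hE // !ahm_polyE; try exact: U'Om.
by apply: generators_intertwined; exact: U'Om.
Qed.

(** Pair the dual frame with [p j], expressed through [q] and back through [p]. *)
Lemma generators_change w : ideal_zeros Om I w -> B *m A = 1%:M.
Proof.
move=> Vw; apply/matrixP => j l; rewrite !mxE.
rewrite -(frame_dual hSub hIp hFp hV Vw j l) (pB j) poly_sum dot_suml.
apply: eq_bigr => k _; congr (_ * _); rewrite qA poly_sum dot_suml.
rewrite (bigD1 l) //= (frame_dual hSub hIp hFp hV Vw) eqxx mulr1 big1 ?addr0 // => i il.
by rewrite (frame_dual hSub hIp hFp hV Vw) (negPf il) mulr0.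
Qed.

(** The preimages under [L] of one frame are, up to the constant matrix and the
    multiplier, the other frame: all these vectors lie in the joint kernels, so
    that their products with the dense ideal are determined by those with the
    generators. *)
Lemma gram_relation i0 w : ideal_zeros Om I w ->
  A^T *m gram Fq w *m map_mx Num.conj A
    = (multiplier i0 w * (multiplier i0 w)^*) *: gram Fp w.
Proof.
move=> Vw; have Zw := Vw; have Zw' := Vw; rewrite -hV in Zw; rewrite -hV' in Zw'.
have inM' k : ideal_closure H' I (Fq k w) by exact: canonical_frame_in hFq _ _ Zw'.
have inM k : ideal_closure H I (Fp k w) by exact: canonical_frame_in hFp _ _ Zw.
have ex k : exists y, ideal_closure H I y /\ L y = Fq k w.
  have : (L @` ideal_closure H I) (Fq k w) by rewrite Lim.
  by move=> [y My Ly]; exists y.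
have [f fP] := choice ex.
set mu := multiplier i0 w.
have kerp j : joint_kernel (ideal_closure H I) w (Fp j w).
  have [_ ->] := canonical_frame_basis hFp Zw.
  exists (fun k => (k == j)%:R); rewrite (bigD1 j) //= eqxx scale1r big1 ?addr0 //.
  by move=> k /negPf ->; rewrite scale0r.
have kerq j : joint_kernel (ideal_closure H' I) w (Fq j w).
  have [_ ->] := canonical_frame_basis hFq Zw'.
  exists (fun k => (k == j)%:R); rewrite (bigD1 j) //= eqxx scale1r big1 ?addr0 //.
  by move=> k /negPf ->; rewrite scale0r.
pose S : set H := ahm_poly H @` I.
pose S' : set H' := [set L (ahm_poly H g) | g in I].
have SM : S `<=` ideal_closure H I by exact: subset_closure.
have SM' : S' `<=` ideal_closure H' I by move=> _ [g Ig <-]; exact: image_in.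
have Smul a g : S g -> S (ahm_mul a g).
  by move=> [g' Ig' <-]; rewrite polyM; exists (a * g') => //; exact: ideal_mul hIp _ _ Ig'.
have Smul' a g : S' g -> S' (ahm_mul a g).
  move=> [g' Ig' <-]; rewrite -image_mul //.
  by exists (a * g') => //; exact: ideal_mul hIp _ _ Ig'.
(* The difference lies in the module and is orthogonal to the ideal, which is
   dense in it. *)
have key l : \sum_k (A k l)^* *: f k = mu^* *: Fp l w.
  apply/eqP; rewrite -subr_eq0; apply/eqP; apply: dot_eq0.
  set e := _ - _.
  have Se y : S y -> ahm_dot H y e = 0.
    move=> [g Ig <-]; move: Ig; rewrite {1}hIp => -[a ->].
    rewrite /e dotBr dotZr conjCK dot_sumr.
    have polysum : ahm_poly H (\sum_j a j * p j) = \sum_j 1 *: ahm_poly H (a j * p j).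
      rewrite -poly_sum; congr (ahm_poly H _); apply: eq_bigr => j _.
      by rewrite scale1r.
    rewrite polysum dot_suml; apply/eqP; rewrite subr_eq0; apply/eqP.
    under eq_bigr => k _ do rewrite dot_suml conjCK mulr_sumr.
    rewrite exchange_big /= mulr_sumr; apply: eq_bigr => j _.
    rewrite mul1r -polyM.
    rewrite (joint_kernel_eigen SM Smul (kerp l)); last by exists (p j) => //; exact: (generator_in hIp).
    rewrite (frame_dual hSub hIp hFp hV Vw) mulrCA -(frames_intertwined i0 Vw) mulr_sumr.
    apply: eq_bigr => k _; rewrite mul1r.
    have [Mf Lf] := fP k.
    rewrite -Liso //; last by rewrite polyM; apply/poly_in_closure/(ideal_mul hIp)/(generator_in hIp).
    rewrite Lf polyM image_mul; last exact: (generator_in hIp).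
    rewrite (joint_kernel_eigen SM' Smul' (kerq k)); last by exists (p j) => //; exact: (generator_in hIp).
    by rewrite mulrCA.
  have Me y : ideal_closure H I y -> ahm_dot H y e = 0.
    by move=> My; exact: closure_orthogonal Se My.
  have Ef : ahm_dot H (\sum_k (A k l)^* *: f k) e = 0.
    by rewrite dot_suml big1 // => k _; rewrite (Me _ (fP k).1) mulr0.
  by rewrite {1}/e dotBl dotZl Ef (Me _ (inM l)) mulr0 subr0.
apply/matrixP => i j.
have -> : (mu * mu^* *: gram Fp w) i j = ahm_dot H (mu^* *: Fp j w) (mu^* *: Fp i w).
  by rewrite !mxE dotZl dotZr conjCK mulrA [mu^* * _]mulrC.
rewrite -!key dot_suml !mxE; apply: eq_bigr => k _; rewrite !mxE dot_sumr mulrC.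
congr (_ * _); apply: eq_bigr => n _; rewrite !mxE conjCK; congr (_ * _).
have [Mk <-] := fP k; have [Mn <-] := fP n.
by rewrite Liso.
Qed.

End Transfer.

(** * Wirtinger derivatives of matrices *)

Section RealDerivatives.
Variable R : realType.
Local Notation C := (CC R).
Local Notation rl := (@realline R).

Lemma increment_Re (y y0 l : C) (h : R) :
  `|complex.Re y - complex.Re y0 - h * complex.Re l|
    <= nrm (y - y0 - (h%:C%C : C) *: l).
Proof.
have -> : complex.Re y - complex.Re y0 - h * complex.Re l
    = complex.Re (y - y0 - (h%:C%C : C) *: l).
  by case: y y0 l => [a b] [a' b'] [a'' b'']; rewrite /GRing.scale /=; ring.
exact: normRe.
Qed.

Lemma increment_Im (y y0 l : C) (h : R) :
  `|complex.Im y - complex.Im y0 - h * complex.Im l|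
    <= nrm (y - y0 - (h%:C%C : C) *: l).
Proof.
have -> : complex.Im y - complex.Im y0 - h * complex.Im l
    = complex.Im (y - y0 - (h%:C%C : C) *: l).
  by case: y y0 l => [a b] [a' b'] [a'' b'']; rewrite /GRing.scale /=; ring.
exact: normIm.
Qed.

Lemma real_deriveE d (f : 'rV[C]_d -> C) v z l :
  tangent rl (fun h => f (z + h *: v)) l -> real_derive f v z = l.
Proof.
move=> fl.
have Dr : is_derive 0 (1 : R) (fun s : R => complex.Re (f (z + (s%:C%C : C) *: v)))
    (complex.Re l).
  apply/is_derive_epsP => e e0; have [r r0 H] := fl e e0.
  exists r => // h hr; have := H h%:C%C (reallineR h); rewrite nrmR => /(_ hr) H'.
  by apply: le_trans H'; rewrite add0r; exact: increment_Re.
have Di : is_derive 0 (1 : R) (fun s : R => complex.Im (f (z + (s%:C%C : C) *: v)))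
    (complex.Im l).
  apply/is_derive_epsP => e e0; have [r r0 H] := fl e e0.
  exists r => // h hr; have := H h%:C%C (reallineR h); rewrite nrmR => /(_ hr) H'.
  by apply: le_trans H'; rewrite add0r; exact: increment_Im.
rewrite /real_derive !derive1E (@derive_val _ _ _ _ _ _ _ Dr).
by rewrite (@derive_val _ _ _ _ _ _ _ Di); case: (l).
Qed.

Definition mtangent n (A : C -> 'M[C]_n) (L : 'M[C]_n) :=
  forall i j, tangent rl (fun h => A h i j) (L i j).

Lemma mtangent_near n (A B : C -> 'M[C]_n) L :
  (exists2 d : R, 0 < d & forall h, rl h -> nrm h < d -> A h = B h) ->
  mtangent A L -> mtangent B L.
Proof.
move=> [d d0 AB] AL i j; apply: tangent_near (AL i j); first exact: realline0.
by exists d => // h Sh hd; rewrite AB.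
Qed.

Lemma mtangent_scale n (f : C -> C) (A : C -> 'M[C]_n) l L :
  tangent rl f l -> mtangent A L ->
  mtangent (fun h => f h *: A h) (l *: A 0 + f 0 *: L).
Proof.
move=> fl AL i j; rewrite !mxE.
apply: tangent_ext (tangentM fl (AL i j)); first exact: realline0.
by move=> h; rewrite mxE.
Qed.

Lemma mtangent_scaler n (f : C -> C) (X : 'M[C]_n) l :
  tangent rl f l -> mtangent (fun h => f h *: X) (l *: X).
Proof.
move=> fl; have X0 : mtangent (fun=> X) 0.
  by move=> i j; rewrite mxE; exact: tangent_cst.
by have := mtangent_scale fl X0; rewrite scaler0 addr0.
Qed.

Lemma mtangentD n (A B : C -> 'M[C]_n) L K :
  mtangent A L -> mtangent B K -> mtangent (fun h => A h + B h) (L + K).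
Proof.
move=> AL BK i j; rewrite !mxE.
apply: tangent_ext (tangentD (AL i j) (BK i j)); first exact: realline0.
by move=> h; rewrite mxE.
Qed.

Lemma mtangent_mul n (P Q : 'M[C]_n) (A : C -> 'M[C]_n) L :
  mtangent A L -> mtangent (fun h => P *m A h *m Q) (P *m L *m Q).
Proof.
move=> AL i j; rewrite mxE.
have E (X : 'M[C]_n) : (P *m X *m Q) i j = \sum_k \sum_l (Q k j * P i l) *: X l k.
  rewrite mxE; apply: eq_bigr => k _; rewrite mxE mulr_suml; apply: eq_bigr => l _.
  by rewrite -[RHS]/(_ * _); ring.
have -> : \sum_k (P *m L) i k * Q k j = \sum_k \sum_l (Q k j * P i l) *: L l k.
  by rewrite -E mxE.
apply: (tangent_ext (S := rl) (@realline0 R)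
   (f := fun h => \sum_k \sum_l (Q k j * P i l) *: A h l k)).
  by move=> h; rewrite E.
apply: tangent_sum => [|k]; first exact: realline0.
by apply: tangent_sum => [|l]; [exact: realline0|exact: tangentZ].
Qed.

Lemma mulmx_comb n (P Q X Y : 'M[C]_n) (a b : C) :
  P *m (a *: (X + b *: Y)) *m Q = a *: (P *m X *m Q + b *: (P *m Y *m Q)).
Proof. by rewrite -scalemxAr -scalemxAl mulmxDr mulmxDl -scalemxAr -scalemxAl. Qed.

Lemma mx_dzbarE d n (k : 'I_d) (A : 'rV[C]_d -> 'M[C]_n) x L1 L2 :
  mtangent (fun h => A (x + h *: delta_mx 0 k)) L1 ->
  mtangent (fun h => A (x + h *: ('i *: delta_mx 0 k))) L2 ->
  mx_dzbar k A x = 2^-1 *: (L1 + 'i *: L2).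
Proof.
move=> A1 A2; apply/matrixP => i j; rewrite !mxE /dzbar.
by rewrite (real_deriveE (A1 i j)) (real_deriveE (A2 i j)) mulrC.
Qed.

Lemma mx_dzE d n (k : 'I_d) (A : 'rV[C]_d -> 'M[C]_n) x L1 L2 :
  mtangent (fun h => A (x + h *: delta_mx 0 k)) L1 ->
  mtangent (fun h => A (x + h *: ('i *: delta_mx 0 k))) L2 ->
  mx_dz k A x = 2^-1 *: (L1 - 'i *: L2).
Proof.
move=> A1 A2; apply/matrixP => i j; rewrite !mxE /dz.
by rewrite (real_deriveE (A1 i j)) (real_deriveE (A2 i j)) mulrC.
Qed.

Lemma tangentiable_det n (A : C -> 'M[C]_n) :
  (forall i j, tangentiable rl (fun h => A h i j)) ->
  tangentiable rl (fun h => \det (A h)).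
Proof.
move=> Ad; rewrite /determinant.
apply: tangentiable_sum => [|s]; first exact: realline0.
apply: tangentiableM; first exact: tangentiable_cst.
apply: tangentiable_prod => [|i]; first exact: realline0.
exact: Ad.
Qed.

(** By Cramer's formula for the inverse. *)
Lemma tangentiable_inv n (A : C -> 'M[C]_n) :
  (exists2 d : R, 0 < d & forall h, rl h -> nrm h < d -> A h \in unitmx) ->
  (forall i j, tangentiable rl (fun h => A h i j)) ->
  forall i j, tangentiable rl (fun h => invmx (A h) i j).
Proof.
move=> [d d0 Au] Ad i j.
have A0 : A 0 \in unitmx by apply: Au; [exact: realline0|rewrite nrm0].
have [l Hl] : tangentiable rl (fun h => (\det (A h))^-1 * cofactor (A h) j i).
  apply: tangentiableM.
    apply: tangentiableV; last exact: tangentiable_det.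
    by rewrite -unitfE -unitmxE.
  rewrite /cofactor; apply: tangentiableM; first exact: tangentiable_cst.
  apply: tangentiable_det => i' j'.
  apply: tangentiable_ext (Ad (lift j i') (lift i j')); first exact: realline0.
  by move=> h; rewrite !mxE.
exists l; apply: tangent_near Hl; first exact: realline0.
by exists d => // h Sh hd; rewrite /invmx Au // !mxE.
Qed.

Lemma tangentiable_mulmx n (A B : C -> 'M[C]_n) :
  (forall i j, tangentiable rl (fun h => A h i j)) ->
  (forall i j, tangentiable rl (fun h => B h i j)) ->
  forall i j, tangentiable rl (fun h => (A h *m B h) i j).
Proof.
move=> Ad Bd i j.
apply: (tangentiable_ext (@realline0 R) (f := fun h => \sum_k A h i k * B h k j)).
  by move=> h; rewrite mxE.
apply: tangentiable_sum => [|k]; first exact: realline0.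
exact: tangentiableM.
Qed.

Lemma tangentiable_mtangent n (A : C -> 'M[C]_n) :
  (forall i j, tangentiable rl (fun h => A h i j)) -> exists L, mtangent A L.
Proof.
move=> Ad; have [l lP] : exists l : 'I_n * 'I_n -> C,
    forall ij, tangent rl (fun h => A h ij.1 ij.2) (l ij).
  have ex (ij : 'I_n * 'I_n) : exists l, tangent rl (fun h => A h ij.1 ij.2) l.
    exact: Ad.
  by have [l lP] := choice ex; exists l.
exists (\matrix_(i, j) l (i, j)) => i j; rewrite mxE; exact: (lP (i, j)).
Qed.

End RealDerivatives.

(** * Anti-holomorphic maps *)

Section Antiholomorphic.
Variables (R : realType) (m : nat) (Om : set 'rV[CC R]_m).
Variable H : analytic_hilbert_module Om.
Local Notation C := (CC R).
Local Notation rl := (@realline R).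
Local Notation dot := (ahm_dot H).
Variables (d : nat) (D : set 'rV[C]_d).
Hypothesis oD : open D.

Lemma conjv_line (x u : 'rV[C]_d) h : conjv (x + h *: u) = conjv x + h^* *: conjv u.
Proof. by apply/rowP => i; rewrite !mxE rmorphD rmorphM. Qed.

Lemma conjv_delta k : conjv (delta_mx 0 k) = delta_mx 0 k :> 'rV[C]_d.
Proof. by apply/rowP => i; rewrite !mxE rmorph_nat. Qed.

Lemma conjv_idelta k :
  conjv ('i *: delta_mx 0 k) = - 'i *: delta_mx 0 k :> 'rV[C]_d.
Proof. by apply/rowP => i; rewrite !mxE rmorphM /= conjCi rmorph_nat. Qed.

Lemma open_conjv : open (@conjv R d @^-1` D).
Proof.
rewrite openE => x Dx; have [e e0 H1] := open_nrm oD Dx.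
apply/(@nbhs_nrmP R _ (x : 'rV[C]_d)); exists e => // y yx; apply: H1.
exact: le_lt_trans (nrm_conjvB _ _) yx.
Qed.

Lemma line_in (x u : 'rV[C]_d) : D x ->
  exists2 r : R, 0 < r & forall h : C, nrm h < r -> D (x + h *: u).
Proof.
move=> Dx; have [e e0 H1] := open_nrm oD Dx.
have u0 : 0 < nrm u + 1 by rewrite ltr_wpDl ?nrm_ge0.
exists (e / (nrm u + 1)); first by rewrite divr_gt0.
move=> h hr; apply: H1; rewrite addrC addKr nrmZ.
move: hr; rewrite ltr_pdivlMr //; have := nrm_ge0 h; have := nrm_ge0 u; nra.
Qed.

Variable v : 'rV[C]_d -> H.
Hypothesis av : antiholomorphic_on D v.

(** The differential of the holomorphic map [z |-> v (conj z)] at [conj x]. *)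
Definition adiff (x u : 'rV[C]_d) : H := 'd (v \o @conjv R d) (conjv x) u.

Lemma adiff_linear x a u w : adiff x (a *: u + w) = a *: adiff x u + adiff x w.
Proof. exact: (linearP ('d (v \o @conjv R d) (conjv x))). Qed.

Lemma adiffZ x a u : adiff x (a *: u) = a *: adiff x u.
Proof.
have := adiff_linear x a u 0; have -> : adiff x 0 = 0.
  by have := adiff_linear x (-1) 0 0; rewrite scaler0 addr0 scaleN1r addNr.
by rewrite !addr0.
Qed.

Lemma antiholomorphic_diff x : D x -> differentiable (v \o @conjv R d) (conjv x).
Proof. by move=> Dx; apply: av; rewrite /= conjvK. Qed.

Lemma antiholomorphic_tangent x u : D x ->
  tangent rl (fun h => v (x + h *: u)) (adiff x (conjv u)).
Proof.
move=> Dx; have := diff_tangent (conjv u) (antiholomorphic_diff Dx).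
move=> /(tangent_sub (S' := rl) (fun _ _ => I)).
apply: tangent_near; first exact: realline0.
exists 1 => // h Sh _ /=.
by rewrite -[in LHS](reallineJ Sh) -conjv_line conjvK.
Qed.

(** The curvature involves second derivatives of the frame: this is why they
    exist. *)
Lemma adiff_cderivable x u w : D x ->
  cderivable (fun z => 'd (v \o @conjv R d) (conjv x + z *: u) w) 0.
Proof.
move=> Dx; apply: (holomorphic_derivative (@module_normed_by_functionals _ _ _ H)
  (U := @conjv R d @^-1` D)).
- exact: open_conjv.
- by move=> y Dy; apply: av.
- by rewrite /= conjvK.
Qed.

Lemma adiff_tangent x u w : D x -> exists l,
  tangent rl (fun h => adiff (x + h *: u) w) l.
Proof.
move=> Dx; have [l] := adiff_cderivable (conjv u) w Dx.
move=> /(tangent_sub (S' := rl) (fun _ _ => I)) Hl; exists l; apply: tangent_near Hl.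
  exact: realline0.
exists 1; first exact: ltr01.
move=> h Sh _; have E : conjv (x + h *: u) = conjv x + (0 + h) *: conjv u.
  by rewrite conjv_line (reallineJ Sh) add0r.
by rewrite /adiff E.
Qed.


Lemma dot_tangent (f g : C -> H) l k : tangent rl f l -> tangent rl g k ->
  tangent rl (fun h => dot (f h) (g h)) (dot l (g 0) + dot (f 0) k).
Proof.
apply: (@tangent_bilinear _ rl _ _ _ (fun x y : H => dot x y)).
- by move=> x x' y; rewrite dotBl.
- by move=> x y y'; rewrite dotBr.
- by move=> h x y _; rewrite dotZl.
- by move=> h x y Sh; rewrite dotZr reallineJ.
- exact: cauchy_schwarz.
Qed.

End Antiholomorphic.

(** * Curvature under a change of frame and of metric *)

Lemma cderivable_at0 (R : realType) (W : normedModType (CC R)) (f : CC R -> W) :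
  cderivable f 0 -> exists l, tangent setT f l.
Proof.
case=> l Hl; exists l; apply: tangent_ext Hl; first by [].
by move=> h; rewrite add0r.
Qed.

Section Curvature.
Variables (R : realType) (m : nat) (Om : set 'rV[CC R]_m).
Local Notation C := (CC R).
Local Notation rl := (@realline R).
Variables (d t : nat) (D : set 'rV[C]_d).
Hypothesis oD : open D.

(** Of the two terms of a product rule, [dzbar] keeps the one that is antilinear in
    the direction. *)
Lemma half_i (a b : C) : 2^-1 * (a + b + 'i * (- 'i * a + 'i * b)) = a.
Proof.
have -> : a + b + 'i * (- 'i * a + 'i * b) = a + b + ('i * 'i) * (b - a) by ring.
by rewrite -expr2 sqrCi; field.
Qed.

Section Gram.
Variable H : analytic_hilbert_module Om.
Variable v : 'I_t -> 'rV[C]_d -> H.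
Hypothesis av : forall j, antiholomorphic_on D (v j).

Definition gramv (x : 'rV[C]_d) : 'M[C]_t := \matrix_(i, j) ahm_dot H (v j x) (v i x).

Lemma gram_mtangent x u : D x ->
  mtangent (fun h => gramv (x + h *: u))
    (\matrix_(i, j) (ahm_dot H (adiff (v j) x (conjv u)) (v i x)
                   + ahm_dot H (v j x) (adiff (v i) x (conjv u)))).
Proof.
move=> Dx i j; rewrite mxE.
have := dot_tangent (antiholomorphic_tangent (av j) u Dx)
  (antiholomorphic_tangent (av i) u Dx).
rewrite scale0r addr0; apply: tangent_ext; first exact: realline0.
by move=> h; rewrite mxE.
Qed.

(** As the frame is anti-holomorphic, only its own derivative survives. *)
Lemma gram_dzbar l x : D x -> mx_dzbar l gramv x
  = \matrix_(i, j) ahm_dot H (adiff (v j) x (delta_mx 0 l)) (v i x).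
Proof.
move=> Dx.
rewrite (mx_dzbarE (gram_mtangent (delta_mx 0 l) Dx) (gram_mtangent ('i *: delta_mx 0 l) Dx)).
apply/matrixP => i j; rewrite !mxE conjv_delta conjv_idelta !adiffZ dotZl dotZr.
by rewrite rmorphN /= conjCi opprK half_i.
Qed.

Lemma gram_dzbar_tangentiable l x u : D x -> forall i j,
  tangentiable rl (fun h => mx_dzbar l gramv (x + h *: u) i j).
Proof.
move=> Dx i j; have [r r0 Dr] := line_in oD u Dx.
have [k Hk] := adiff_tangent oD (av j) u (delta_mx 0 l) Dx.
have := dot_tangent Hk (antiholomorphic_tangent (av i) u Dx) => Ht.
eexists; apply: tangent_near Ht; first exact: realline0.
by exists r => // h _ hr; rewrite gram_dzbar ?mxE //; exact: Dr.
Qed.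

Hypothesis gu : forall x, D x -> gramv x \in unitmx.

(** Coefficient of [dzbar_l] in the matrix of the Chern connection. *)
Definition connection l x := invmx (gramv x) *m mx_dzbar l gramv x.

Lemma connection_mtangent l x u : D x ->
  exists K, mtangent (fun h => connection l (x + h *: u)) K.
Proof.
move=> Dx; apply: tangentiable_mtangent => i j.
have [r r0 Dr] := line_in oD u Dx.
apply: tangentiable_mulmx => i' j'; last exact: gram_dzbar_tangentiable.
apply: tangentiable_inv.
  by exists r => // h _ hr; apply: gu; exact: Dr.
move=> i2 j2; have T := gram_mtangent u Dx i2 j2.
by eexists; exact: T.
Qed.

End Gram.

Variables (H H' : analytic_hilbert_module Om).
Variables (v : 'I_t -> 'rV[C]_d -> H) (v' : 'I_t -> 'rV[C]_d -> H').
Hypothesis av : forall j, antiholomorphic_on D (v j).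
Hypothesis av' : forall j, antiholomorphic_on D (v' j).
Hypothesis gu : forall x, D x -> gramv v x \in unitmx.
Variables (a : 'I_t -> C) (w : H') (P Q : 'M[C]_t).
Hypotheses (Pu : P \in unitmx) (Qu : Q \in unitmx).
Let th x := \sum_k a k * ahm_dot H' (v' k x) w.
Hypothesis th0 : forall x, D x -> th x != 0.
Hypothesis rel : forall x, D x -> gramv v' x = (th x * (th x)^*) *: (P *m gramv v x *m Q).

Let dth x u := \sum_k a k * ahm_dot H' (adiff (v' k) x u) w.

Lemma dotw_tangent (f : C -> H') l S : tangent S f l ->
  tangent S (fun h => ahm_dot H' (f h) w) (ahm_dot H' l w).
Proof.
apply: (@tangent_linear R S _ _ (fun y : H' => ahm_dot H' y w) (nrm w)) => [x y|h x _|x].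
- exact: dotBl.
- exact: dotZl.
- by rewrite mulrC cauchy_schwarz.
Qed.

Lemma th_tangent x u : D x -> tangent rl (fun h => th (x + h *: u)) (dth x (conjv u)).
Proof.
move=> Dx; apply: tangent_sum => [|k]; first exact: realline0.
apply: tangentZ; apply: dotw_tangent; exact: antiholomorphic_tangent.
Qed.

Lemma dthZ x c u : dth x (c *: u) = c * dth x u.
Proof.
by rewrite /dth mulr_sumr; apply: eq_bigr => k _; rewrite adiffZ dotZl mulrCA.
Qed.

Lemma sigma_tangent x u : D x ->
  tangent rl (fun h => th (x + h *: u) * (th (x + h *: u))^*)
    (dth x (conjv u) * (th x)^* + th x * (dth x (conjv u))^*).
Proof.
move=> Dx; have T := th_tangent u Dx.
have TJ : tangent rl (fun h => (th (x + h *: u))^*) (dth x (conjv u))^*.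
  apply: (@tangent_linear R rl _ _ (fun y : C => y^*) 1) T => [y z|h y Sh|y].
  - by rewrite rmorphB.
  - by rewrite /GRing.scale /= rmorphM /= (reallineJ Sh).
  - by rewrite nrmJ mul1r.
by have := tangentM T TJ; rewrite scale0r addr0.
Qed.

(** As [th] is anti-holomorphic, [dzbar_l] acts on the first factor of
    [th * conj th] only. *)
Lemma sigma_dzbar l x : D x -> exists s1 s2 : C,
  [/\ tangent rl (fun h => th (x + h *: delta_mx 0 l) * (th (x + h *: delta_mx 0 l))^*) s1,
      tangent rl (fun h => th (x + h *: ('i *: delta_mx 0 l))
                         * (th (x + h *: ('i *: delta_mx 0 l)))^*) s2 &
      2^-1 * (s1 + 'i * s2) = dth x (delta_mx 0 l) * (th x)^*].
Proof.
move=> Dx; have T1 := sigma_tangent (delta_mx 0 l) Dx.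
have T2 := sigma_tangent ('i *: delta_mx 0 l) Dx.
rewrite conjv_delta in T1; rewrite conjv_idelta dthZ in T2.
move: T1 T2; set del := dth x _; set T := th x => T1 T2.
eexists; eexists; split; [exact: T1|exact: T2|].
rewrite -[RHS](half_i (del * T^*) (T * del^*)) rmorphM rmorphN /= conjCi opprK.
by move: (T^*) (del^*) => TJ delJ; ring.
Qed.

(** The coefficient of [dzbar_l] in [delbar log |th|^2]. *)
Let kap l x := dth x (delta_mx 0 l) / th x.

Lemma dzbar_relation l x : D x -> mx_dzbar l (gramv v') x
  = (dth x (delta_mx 0 l) * (th x)^*) *: (P *m gramv v x *m Q)
    + (th x * (th x)^*) *: (P *m mx_dzbar l (gramv v) x *m Q).
Proof.
move=> Dx; have [s1 [s2 [S1 S2 <-]]] := sigma_dzbar l Dx.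
have := gram_mtangent av (delta_mx 0 l) Dx.
move: (\matrix_(i, j) _) => X1 G1.
have := gram_mtangent av ('i *: delta_mx 0 l) Dx.
move: (\matrix_(i, j) _) => X2 G2.
rewrite (mx_dzbarE G1 G2).
have lineT u s X : tangent rl (fun h => th (x + h *: u) * (th (x + h *: u))^*) s ->
    mtangent (fun h => gramv v (x + h *: u)) X ->
    mtangent (fun h => gramv v' (x + h *: u))
      (s *: (P *m gramv v x *m Q) + (th x * (th x)^*) *: (P *m X *m Q)).
  move=> sH XH; have := mtangent_scale sH (mtangent_mul P Q XH).
  rewrite scale0r addr0; apply: mtangent_near.
  have [r r0 Dr] := line_in oD u Dx; exists r => [//|h _ hr].
  by rewrite rel //; exact: Dr.
rewrite (mx_dzbarE (lineT _ _ _ S1 G1) (lineT _ _ _ S2 G2)).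
rewrite mulmx_comb.
move: (P *m gramv v x *m Q) (P *m X1 *m Q) (P *m X2 *m Q) (th x * (th x)^*).
by move=> Y1 Y2 Y3 T; apply/matrixP => i j; rewrite !mxE; ring.
Qed.

Lemma connection_relation l x : D x ->
  connection v' l x = kap l x *: 1%:M + invmx Q *m connection v l x *m Q.
Proof.
move=> Dx; have G0 := gu Dx; have T0 := th0 Dx; rewrite /connection.
rewrite dzbar_relation // rel // /kap.
move: (gramv v x) (mx_dzbar l (gramv v) x) (dth x (delta_mx 0 l)) (th x) G0 T0.
move=> G E del T G0 T0.
have TJ0 : T^* != 0 by rewrite conjC_eq0.
have PGQ : P *m G *m Q \in unitmx by rewrite !unitmx_mul Pu G0 Qu.
have TT0 : T * T^* != 0 by rewrite mulf_neq0.
have IV : invmx ((T * T^*) *: (P *m G *m Q))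
    = (T * T^*)^-1 *: (invmx Q *m invmx G *m invmx P).
  have YPGQ : invmx Q *m invmx G *m invmx P *m (P *m G *m Q) = 1%:M.
    by rewrite !mulmxA mulmxKV // mulmxKV // mulVmx.
  have SU : (T * T^*) *: (P *m G *m Q) \in unitmx by rewrite unitmxZ ?unitfE.
  apply: (can_inj (mulmxK SU)); rewrite mulVmx // -scalemxAl -scalemxAr YPGQ.
  by rewrite scalerA mulVf // scale1r.
have E1 : invmx Q *m invmx G *m invmx P *m (P *m G *m Q) = 1%:M.
  by rewrite !mulmxA mulmxKV // mulmxKV // mulVmx.
have E2 : invmx Q *m invmx G *m invmx P *m (P *m E *m Q)
    = invmx Q *m (invmx G *m E) *m Q.
  by rewrite !mulmxA mulmxKV.
rewrite IV; clear IV.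
move: (invmx Q *m invmx G *m invmx P) (P *m G *m Q) (P *m E *m Q) E1 E2 => Y Z W E1 E2.
rewrite mulmxDr -!scalemxAl -!scalemxAr E1 E2 !scalerA mulVf // scale1r.
by congr (_ *: _ + _); move: (T^*) TJ0 => TJ TJ0; field; rewrite T0 TJ0.
Qed.

(** Composed with the conjugation, [kap] is a quotient of holomorphic functions of
    [z]; hence its derivatives in the directions [1] and ['i] are related as for an
    anti-holomorphic function. *)
Lemma kap_tangent l x k : D x -> exists c,
  tangent rl (fun h => kap l (x + h *: delta_mx 0 k)) c /\
  tangent rl (fun h => kap l (x + h *: ('i *: delta_mx 0 k))) (- 'i * c).
Proof.
move=> Dx.
pose Psi j := v' j \o @conjv R d.
pose num z : C := \sum_j a j * ahm_dot H' ('d (Psi j) (conjv x + z *: delta_mx 0 k) (delta_mx 0 l)) w.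
pose den z : C := \sum_j a j * ahm_dot H' (Psi j (conjv x + z *: delta_mx 0 k)) w.
have [n1 Hn] : exists n1, tangent setT num n1.
  have ex j : exists c, tangent setT (fun z => 'd (Psi j) (conjv x + z *: delta_mx 0 k) (delta_mx 0 l)) c.
    exact: cderivable_at0 (adiff_cderivable oD (av' j) (delta_mx 0 k) (delta_mx 0 l) Dx).
  have [c Hc] := choice ex.
  exists (\sum_j a j * ahm_dot H' (c j) w); apply: tangent_sum => // j.
  by apply: tangentZ; exact: dotw_tangent.
have [d1 Hd] : exists d1, tangent setT den d1.
  exists (\sum_j a j * ahm_dot H' ('d (Psi j) (conjv x) (delta_mx 0 k)) w).
  apply: tangent_sum => // j; apply: tangentZ; apply: dotw_tangent.
  exact: diff_tangent (antiholomorphic_diff (av' j) Dx).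
have den0 : den 0 != 0.
  have := th0 Dx; congr (_ != _); apply: eq_bigr => j _.
  by rewrite /Psi /= scale0r addr0 conjvK.
have [c Hc] : exists c, tangent setT (fun z => num z * (den z)^-1) c.
  by eexists; exact: tangentM Hn (tangentV den0 Hd).
have kapE y z : conjv y = conjv x + z *: delta_mx 0 k -> kap l y = num z * (den z)^-1.
  move=> yz; rewrite /kap /th /dth /num /den /adiff yz; congr (_ / _).
  by apply: eq_bigr => j _; rewrite /Psi /= -yz conjvK.
exists c; split.
  apply: tangent_near (tangent_sub (S' := rl) (fun _ _ => I) Hc).
    exact: realline0.
  exists 1 => // h Sh _; apply/esym/kapE.
  by rewrite conjv_line conjv_delta (reallineJ Sh).
apply: tangent_near (tangent_reparam (S' := rl) (c := - 'i) (fun _ _ => I) Hc).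
  exact: realline0.
exists 1 => // h Sh _; apply/esym/kapE.
by rewrite conjv_line conjv_idelta (reallineJ Sh) scalerA mulrC.
Qed.

(** The factor [|th|^2] adds to the connection matrix the scalar matrix of [kap],
    on which [dz_k] vanishes because [kap] is anti-holomorphic. *)
Lemma curvature_relation k l x : D x ->
  mx_dz k (connection v' l) x = invmx Q *m mx_dz k (connection v l) x *m Q.
Proof.
move=> Dx; have [c [c1 c2]] := kap_tangent l k Dx.
have [K1 HK1] := connection_mtangent av gu l (delta_mx 0 k) Dx.
have [K2 HK2] := connection_mtangent av gu l ('i *: delta_mx 0 k) Dx.
have line u ck K : tangent rl (fun h => kap l (x + h *: u)) ck ->
    mtangent (fun h => connection v l (x + h *: u)) K ->
    mtangent (fun h => connection v' l (x + h *: u))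
      (ck *: 1%:M + invmx Q *m K *m Q).
  move=> ckH KH.
  have := mtangentD (mtangent_scaler 1%:M ckH) (mtangent_mul (invmx Q) Q KH).
  apply: mtangent_near.
  have [r r0 Dr] := line_in oD u Dx; exists r => // h _ hr.
  by rewrite connection_relation //; exact: Dr.
have T1 := line _ _ _ c1 HK1; have T2 := line _ _ _ c2 HK2.
move: (connection v' l) (connection v l) T1 T2 HK1 HK2 => A B T1 T2 HK1 HK2.
rewrite (mx_dzE T1 T2) (mx_dzE HK1 HK2) -!scaleNr mulmx_comb.
move: (invmx Q *m K1 *m Q) (invmx Q *m K2 *m Q) => Y1 Y2; congr (_ *: _).
rewrite scalerDr scalerA mulrA mulrNN -expr2 sqrCi mulN1r addrACA.
by rewrite -scalerDl subrr scale0r add0r.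
Qed.

End Curvature.

(** * The curvatures of equivalent modules *)

Lemma chart_in (R : realType) (m d : nat) (V : set 'rV[CC R]_m) (c : chart d V) x :
  chart_dom c x -> V (chart_map c x).
Proof.
move=> cx; have [W _ E] := @chart_embedding _ _ _ _ c _ (@chart_open _ _ _ _ c) (@subset_refl _ (chart_dom c)).
have : (chart_map c @` chart_dom c) (chart_map c x) by exists x.
by rewrite E => -[].
Qed.

Theorem corollary6p3 (R : realType) (m t d : nat) (Omega : set 'rV[CC R]_m)
    (I : set (cpoly R m)) (p q : 'I_t -> cpoly R m)
    (H H' : analytic_hilbert_module Omega)
    (Fp : 'I_t -> 'rV[CC R]_m -> H) (Fq : 'I_t -> 'rV[CC R]_m -> H')
    (hOpen : open Omega) (hConn : connected Omega) (hBdd : bounded_set Omega)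
    (hIp : I = ideal_gen p) (hIq : I = ideal_gen q)
    (hp : forall j, homogeneous d (p j)) (hq : forall j, homogeneous d (q j))
    (hV : zero_set (ideal_closure H I) = ideal_zeros Omega I)
    (hV' : zero_set (ideal_closure H' I) = ideal_zeros Omega I)
    (hSub : submanifold_codim t Omega (ideal_zeros Omega I))
    (hFp : canonical_frame (ideal_closure H I) p Fp)
    (hFq : canonical_frame (ideal_closure H' I) q Fq)
    (hEquiv : unitarily_equivalent (ideal_closure H I) (ideal_closure H' I)) :
  exists2 A : 'M[CC R]_t, A \in unitmx &
    forall (c : chart (m - t) (ideal_zeros Omega I)) (k l : 'I_(m - t)) x,
      chart_dom c x ->
      curvature Fp c k l x
      = invmx (A ^t*) *m curvature Fq c k l x *m A ^t*.
Proof.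
have [[w0 Vw0]|V0] := pselect (exists w, ideal_zeros Omega I w); last first.
  exists 1%:M => [|c k l x cx]; first exact: unitmx1.
  by case: V0; exists (chart_map c x); exact: chart_in.
have [A qA] : exists A : 'M[CC R]_t, forall k, q k = \sum_l A k l *: p l.
  apply: (homogeneous_generators hp hq) => j.
  by rewrite -hIp; exact: (generator_in hIq).
have [B pB] : exists B : 'M[CC R]_t, forall k, p k = \sum_l B k l *: q l.
  apply: (homogeneous_generators hq hp) => j.
  by rewrite -hIq; exact: (generator_in hIp).
have [L [_ Lim Liso Lmul]] := hEquiv.
have BA := generators_change hIp hV hSub hFp qA pB Vw0.
have Au : A \in unitmx by have [] := mulmx1_unit BA.
exists A^T; first by rewrite unitmx_tr.
move=> c k l x cx; rewrite trmxK.
(* A multiplier can only be read off a generator; without any, the matrices are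
   empty. *)
have [[i0 _]|t0] := pselect (exists i : 'I_t, True); last first.
  by apply/matrixP => i; case: t0; exists i.
have Ju : map_mx Num.conj A \in unitmx by rewrite map_unitmx.
have Tu : A^T \in unitmx by rewrite unitmx_tr.
pose v j := Fp j \o chart_map c; pose v' j := Fq j \o chart_map c.
have av j : antiholomorphic_on (chart_dom c) (v j).
  by have := canonical_frame_antihol hFp j; rewrite hV => hc; exact: hc.
have av' j : antiholomorphic_on (chart_dom c) (v' j).
  by have := canonical_frame_antihol hFq j; rewrite hV' => hc; exact: hc.
have gpu y : chart_dom c y -> gramv v y \in unitmx.
  move=> /chart_in Vy.
  have Zy : zero_set (ideal_closure H I) (chart_map c y) by rewrite hV.
  by have [fr _] := canonical_frame_basis hFp Zy; exact: gram_unit fr.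
have gqu y : chart_dom c y -> gramv v' y \in unitmx.
  move=> /chart_in Vy.
  have Zy : zero_set (ideal_closure H' I) (chart_map c y) by rewrite hV'.
  by have [fr _] := canonical_frame_basis hFq Zy; exact: gram_unit fr.
pose w := L (ahm_poly H (p i0)).
pose th y := \sum_k (A k i0)^* * ahm_dot H' (v' k y) w.
have thE y : th y = (multiplier p Fq L A i0 (chart_map c y))^*.
  rewrite /th /multiplier rmorph_sum; apply: eq_bigr => n _.
  by rewrite rmorphM /= -dotC.
(* [gram_relation] solved for the Gram matrix of the second frame. *)
have gE y : chart_dom c y -> gramv v' y
    = (th y * (th y)^*) *: (invmx A^T *m gramv v y *m invmx (map_mx Num.conj A)).
  move=> /chart_in Vy.
  have := gram_relation hIp hV hV' hSub hFp hFq Lim Liso Lmul qA i0 Vy.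
  rewrite thE conjCK [_^* * _]mulrC -[gram Fq _]/(gramv v' y) -[gram Fp _]/(gramv v y).
  rewrite scalemxAl scalemxAr => <-.
  by rewrite !mulmxA (mulVmx Tu) mul1mx (mulmxK Ju).
have th0 y : chart_dom c y -> th y != 0.
  move=> cy; apply/eqP => ty; have := gqu y cy.
  rewrite gE // ty mul0r scale0r => /mulVmx; rewrite mulmx0 => /matrixP/(_ i0 i0).
  by rewrite !mxE eqxx; apply/eqP; rewrite eq_sym oner_eq0.
have := curvature_relation (@chart_open _ _ _ _ c) av av' gpu _ _ th0 gE k l cx.
rewrite !unitmx_inv => /(_ Tu Ju); rewrite invmxK => E.
rewrite -[curvature Fq c k l x]/(mx_dz _ _ _) E.
by rewrite !mulmxA (mulVmx Ju) mul1mx (mulmxKV Ju).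
Qed.
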